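(* Let $q$ be a power of a prime $p$ and let $n\ge\ell\ge 2$ be integers such that $p$ does not divide $Q:=n^2-n\ell+\ell^2$. Assume that $\gcd(n,\ell)=1$ and that $Q$ is prime. Then (the non-singular model over $\mathbf F_{q^2}$ of) the curve $\mathcal X_{n,\ell}$ of equation $$X^nY^\ell+Y^nZ^\ell+Z^nX^\ell=0$$ is $\mathbf F_{q^2}$-maximal if and only if $$q+1\equiv 0\pmod{(n^2-n\ell+\ell^2)}.$$
   Context: An $\mathbf F_{q^2}$-maximal curve of genus $g$ is a projective, geometrically irreducible, non-singular algebraic curve defined over $\mathbf F_{q^2}$ whose number of $\mathbf F_{q^2}$-rational points equals $1+q^2+2qg$. *)

(* Defs.v *)
From HB Require Import structures.
From mathcomp Require Import all_boot all_order all_algebra.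
From mathcomp Require Import boolp classical_sets functions cardinality fsbigop.
From mathcomp Require Import mpoly.

Set Implicit Arguments.
Unset Strict Implicit.
Unset Printing Implicit Defensive.

Import Order.TTheory GRing.Theory Num.Theory.
Local Open Scope classical_set_scope.
Local Open Scope ring_scope.

(* A projective non-singular curve over K is encoded, as usual, by its function
   field iota : K -> F: its closed points are the discrete valuations of F that
   are trivial on K, with the residue field at a point given by the valuation. *)
Section FunctionField.
Variables (K F : fieldType) (iota : {rmorphism K -> F}).

Definition free_mod (W : set F) (d : nat) (b : 'I_d -> F) : Prop :=
  forall c : 'I_d -> K, W (\sum_(i < d) iota (c i) * b i) -> forall i, c i = 0.

Definition basis_mod (V W : set F) (d : nat) (b : 'I_d -> F) : Prop :=
  [/\ forall i, V (b i),
      free_mod W b &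
      forall z, V z ->
        exists c : 'I_d -> K, W (z - \sum_(i < d) iota (c i) * b i)].

(* The K-dimension of V / W, for K-subspaces W of V; 0 if it is infinite. *)
Definition dim_mod (V W : set F) : nat :=
  xget 0%N [set d | exists b : 'I_d -> F, basis_mod V W b].

(* F is an algebraic function field of one variable over K: some x in F is
   transcendental over K and F is finite over K(x). Denominators are cleared in
   the coordinates of z in K(x). *)
Definition is_function_field : Prop :=
  exists x : F, ~ algebraicOver iota x /\
  exists (d : nat) (b : 'I_d -> F), forall z : F,
  exists (c : {poly K}) (a : 'I_d -> {poly K}),
    c != 0 /\
    (map_poly iota c).[x] * z = \sum_(i < d) (map_poly iota (a i)).[x] * b i.

(* F is linearly disjoint over K from the algebraic closure of K, that is,
   F is a regular extension of K; equivalently the tensor product of F with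
   the algebraic closure of K is a field. The field L is any overfield of F. *)
Definition geometrically_irreducible : Prop :=
  forall (L : fieldType) (j : {rmorphism F -> L}) (d : nat) (b : 'I_d -> F),
  free_mod [set 0] b ->
  forall a : 'I_d -> L, (forall i, algebraicOver (j \o iota) (a i)) ->
  \sum_(i < d) a i * j (b i) = 0 -> forall i, a i = 0.

(* Normalized discrete valuations of F / K. The value at 0, mathematically
   +oo, is irrelevant; it is set to 0 so that each place occurs once. *)
Definition places : set (F -> int) :=
  [set v | [/\ v 0 = 0,
    forall x y, x != 0 -> y != 0 -> v (x * y) = v x + v y,
    forall x y, x != 0 -> y != 0 -> x + y != 0 ->
      Num.min (v x) (v y) <= v (x + y),
    forall c : K, c != 0 -> v (iota c) = 0 &
    exists t, v t = 1]].

Definition place_ring (v : F -> int) : set F := [set x | x = 0 \/ 0 <= v x].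
Definition place_ideal (v : F -> int) : set F := [set x | x = 0 \/ 0 < v x].

Definition place_degree (v : F -> int) : nat :=
  dim_mod (place_ring v) (place_ideal v).

Definition rational_places : set (F -> int) :=
  [set v | places v /\ place_degree v = 1%N].

(* Only the values of a divisor at the places matter. *)
Definition is_divisor (D : (F -> int) -> int) : Prop :=
  finite_set [set v | places v /\ D v != 0].

Definition divisor_degree (D : (F -> int) -> int) : int :=
  \sum_(v \in places) D v * (place_degree v)%:Z.

Definition riemann_roch_space (D : (F -> int) -> int) : set F :=
  [set z | z = 0 \/ forall v, places v -> - D v <= v z].

Definition ell (D : (F -> int) -> int) : nat :=
  dim_mod (riemann_roch_space D) [set 0].

(* The genus is the maximum of deg D - ell D + 1 over all divisors D. *)
Definition has_genus (g : nat) : Prop :=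
  (forall D, is_divisor D -> divisor_degree D - (ell D)%:Z + 1 <= g%:Z) /\
  (exists2 D, is_divisor D & divisor_degree D - (ell D)%:Z + 1 = g%:Z).

(* Meant for a field K with q ^ 2 elements. *)
Definition is_maximal (q : nat) : Prop :=
  [/\ is_function_field, geometrically_irreducible &
      exists2 g, has_genus g & (rational_places #= `I_(1 + q ^ 2 + 2 * q * g)%N)%card].

(* F is the function field of the plane projective curve f = 0, for f a
   homogeneous polynomial: P is a generic point of the curve over K, in
   homogeneous coordinates in F, and F consists of the values at P of the
   quotients of homogeneous polynomials of the same degree. *)
Definition is_function_field_of (f : {mpoly K[3]}) (P : 'I_3 -> F) : Prop :=
  (forall (d : nat) (g : {mpoly K[3]}), g \is d.-homog ->
     (mmap iota P g = 0 <-> exists h : {mpoly K[3]}, g = h * f)) /\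
  (forall z : F, exists (d : nat) (g h : {mpoly K[3]}),
     [/\ g \is d.-homog, h \is d.-homog, mmap iota P h != 0 &
         z = mmap iota P g / mmap iota P h]).

End FunctionField.

(* The function field of a plane curve, hence its non-singular model, is unique
   up to K-isomorphism. *)
Definition nonsingular_model_is_maximal (K : fieldType) (f : {mpoly K[3]})
    (q : nat) : Prop :=
  exists (F : fieldType) (iota : {rmorphism K -> F}) (P : 'I_3 -> F),
    is_function_field_of iota f P /\ is_maximal iota q.

Definition curveX (K : fieldType) (n l : nat) : {mpoly K[3]} :=
  let X : {mpoly K[3]} := 'X_(inord 0) in
  let Y : {mpoly K[3]} := 'X_(inord 1) in
  let Z : {mpoly K[3]} := 'X_(inord 2) in
  X ^+ n * Y ^+ l + Y ^+ n * Z ^+ l + Z ^+ n * X ^+ l.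

(* Main.v *)
From HB Require Import structures.
From mathcomp Require Import all_boot all_order all_algebra all_solvable all_field.
From mathcomp Require Import boolp classical_sets functions cardinality fsbigop.
From mathcomp Require Import finmap mpoly.
From mathcomp Require Import zify ring.
Require Import Defs.

(* With Q = n^2 - n l + l^2, the functions t = - X^(n-l) Y^l / Z^n and w = Y / Z
   generate the function field of the curve, 1 - t = - Y^n / (Z^(n-l) X^l), and
     w^Q = (-1)^n t^l (1 - t)^(n-l),
   so the curve is a Kummer cover of degree Q of the line, totally ramified over
   0, 1, oo and unramified elsewhere. The spaces L(m oo) have the basis
   t^j w^i / (t^(l i / Q) (1 - t)^((n-l) i / Q)) (integer quotients), of pole orders
   Q j + c_i, which gives the genus (Q - 1) / 2.
   The rational places are the three branch places and the pairs (tau, om) over K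
   with tau <> 0, 1 and om^Q = (-1)^n tau^l (1 - tau)^(n-l).
   If Q divides q + 1 then tau |-> (tau^(q-1), (1 - tau)^(q-1)) identifies the tau
   outside F_q that have a fibre with pairs of norm-one elements, which are counted
   directly, while every tau in F_q other than 0 and 1 has Q points above it; the
   total is 1 + q^2 + q (Q - 1).
   Conversely, if Q is prime to q^2 - 1 then om |-> om^Q is a bijection of K and
   there are only q^2 + 1 places; if Q divides q - 1 then the number of affine
   points q^2 - 2 + q (Q - 1) would be divisible by Q, which forces Q to divide
   q + 1. *)

Set Implicit Arguments.
Unset Strict Implicit.
Unset Printing Implicit Defensive.

Import Order.TTheory GRing.Theory Num.Theory.
Local Open Scope classical_set_scope.
Local Open Scope ring_scope.

(** With x = X/Z and y = Y/Z, division of the equation by Z^n X^l gives x^(n-l) y^l + y^n / x^l =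
    -1, two monomials with constant sum; hence t and 1 - t. The determinant of their exponents is Q
    = n (n-l) + l l. The obstacle is that [has_genus] ranges over all divisors, while bases are
    explicit only for L(m oo). For a divisor D, multiplication by a polynomial h(t) with enough
    zeros embeds L(D) in some L(m oo), and the vanishing conditions that cut out the image are
    counted through the bound Q deg h on the degree of the zeros of h(t). That bound needs the
    places away from t = 0, 1, oo. They are found by finiteness: modulo an irreducible pi not
    dividing t (1 - t), all elements of K[t, w] satisfy x^N = x for one N > 1. So the primes over pi
    are maximal, with pi as a uniformizer, and pi generates a radical ideal. For the direct
    implication every function field of the curve has to be treated, not only the one constructed:
    the forms vanishing at the generic point are the same, which carries the transcendence of t
    over. *)

(** * Dimensions of quotients of K-subspaces of F *)

Section LinearAlgebra.
Variables (K F : fieldType) (iota : {rmorphism K -> F}).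
Implicit Types (U V W : set F).

Definition subspace V :=
  [/\ V 0, forall x y, V x -> V y -> V (x + y) & forall c x, V x -> V (iota c * x)].

(** [dim_mod] is 0 also when no finite basis exists, so its value alone gives nothing to compute
    with; this relation keeps the basis. *)
Definition isdim V W d := exists b : 'I_d -> F, basis_mod iota V W b.

(** Unlike a basis, such a bound passes at once to subspaces of [V]; [free_bound_isdim] turns it
    back into a dimension. *)
Definition free_bound V W m :=
  forall d (b : 'I_d -> F), (forall i, V (b i)) -> free_mod iota W b -> (d <= m)%N.

Lemma subspaceN V x : subspace V -> V x -> V (- x).
Proof. by case=> _ _ sc /(sc (-1)); rewrite rmorphN1 mulN1r. Qed.

Lemma subspaceB V x y : subspace V -> V x -> V y -> V (x - y).
Proof. by move=> sV Vx Vy; case: (sV) => _ sD _; apply: sD => //; exact: subspaceN. Qed.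

Lemma subspace_sum V I (r : seq I) (P : pred I) (f : I -> F) :
  subspace V -> (forall i, P i -> V (f i)) -> V (\sum_(i <- r | P i) f i).
Proof. by case=> V0 VD _ Vf; elim/big_ind: _ => //; exact: VD. Qed.

Lemma subspace_lin V d (c : 'I_d -> K) (b : 'I_d -> F) :
  subspace V -> (forall i, V (b i)) -> V (\sum_(i < d) iota (c i) * b i).
Proof. by move=> sV Vb; apply: subspace_sum => // i _; case: sV => _ _; apply. Qed.

Lemma subspace0 : subspace [set 0].
Proof. by split=> //= [x y -> ->|c x ->]; rewrite ?addr0 ?mulr0. Qed.

Lemma free_le_span V W d (b : 'I_d -> F) m (b' : 'I_m -> F) :
    subspace W -> (forall i, V (b i)) -> free_mod iota W b ->
    (forall z, V z -> exists c : 'I_m -> K, W (z - \sum_(i < m) iota (c i) * b' i)) ->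
  (d <= m)%N.
Proof.
move=> sW Vb fb sp; rewrite leqNgt; apply/negP => lt_md.
have /choice[C hC] i : exists c : 'I_m -> K, W (b i - \sum_(j < m) iota (c j) * b' j).
  exact/sp.
pose M := \matrix_(i < d, j < m) C i j.
(* With [m < d] the coordinate matrix has a nonzero row in its left kernel, which combines the [b i]
   into an element of [W]. *)
have : kermx M != 0.
  rewrite kermx_eq0 /row_free neq_ltn.
  by rewrite (leq_ltn_trans (rank_leq_col M)).
case/rowV0Pn=> u /sub_kermxP uM0 /rowV0Pn[v v_u v_n0].
have vM0 : v *m M = 0 by case/submxP: v_u => D ->; rewrite -mulmxA uM0 mulmx0.
have : forall i, v 0 i = 0.
  apply: (fb (fun i => v 0 i)).
  have -> : \sum_(i < d) iota (v 0 i) * b i =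
     \sum_(i < d) iota (v 0 i) * (b i - \sum_(j < m) iota (C i j) * b' j).
    rewrite -[LHS]subr0; under [RHS]eq_bigr do rewrite mulrBr.
    rewrite big_split /= sumrN; congr (_ - _).
    under eq_bigr do rewrite mulr_sumr.
    rewrite exchange_big /= big1 // => j _.
    have /matrixP/(_ 0 j) := vM0; rewrite !mxE => /(congr1 iota).
    rewrite rmorph0 rmorph_sum /= => /esym e.
    have -> : \sum_i iota (v 0 i) * (iota (C i j) * b' j) =
       (\sum_i iota (v 0 i * M i j)) * b' j.
      by rewrite mulr_suml; apply: eq_bigr => i _; rewrite mxE rmorphM mulrA.
    by rewrite -e mul0r.
  exact: subspace_lin.
by move=> v0; case/eqP: v_n0; apply/rowP => i; rewrite v0 mxE.
Qed.

Lemma isdim_bound V W d : subspace W -> isdim V W d -> free_bound V W d.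
Proof. by move=> sW [b [_ _ sp]] d' b' Vb' fb'; apply: free_le_span Vb' fb' sp. Qed.

Lemma isdim_uniq V W d d' : subspace W -> isdim V W d -> isdim V W d' -> d = d'.
Proof.
move=> sW h h'; apply/eqP; rewrite eqn_leq.
case: (h) (h') => [b [Vb fb _]] [b' [Vb' fb' _]].
by rewrite (isdim_bound sW h' Vb fb) (isdim_bound sW h Vb' fb').
Qed.

Lemma isdim_dim V W d : subspace W -> isdim V W d -> dim_mod iota V W = d.
Proof.
by move=> sW h; rewrite /dim_mod; case: xgetP => [d' _ /= h'|/(_ d)//]; exact: isdim_uniq h' h.
Qed.

(** Maximality: an unspanned [z] could be appended to [b], because in a relation of the longer
    family the coefficient of [z] must vanish; otherwise one could solve for [z]. *)
Lemma isdim_span V W m (b : 'I_m -> F) : subspace W -> free_bound V W m ->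
  (forall i, V (b i)) -> free_mod iota W b ->
  forall z, V z -> exists c : 'I_m -> K, W (z - \sum_(i < m) iota (c i) * b i).
Proof.
move=> sW bd Vb fb z Vz; apply: contrapT => nz.
pose b' (i : 'I_m.+1) := if unlift ord_max i is Some j then b j else z.
have : (m.+1 <= m)%N; last by rewrite ltnn.
apply: (bd _ b') => [i|c]; first by rewrite /b'; case: unliftP.
rewrite big_ord_recr /= {2}/b' unlift_none => Wc.
have {}Wc : W (\sum_(i < m) iota (c (widen_ord (leqnSn m) i)) * b i + iota (c ord_max) * z).
  suff -> : \sum_(i < m) iota (c (widen_ord (leqnSn m) i)) * b i =
     \sum_(i < m) iota (c (widen_ord (leqnSn m) i)) * b' (widen_ord (leqnSn m) i) by [].
  apply: eq_bigr => i _; rewrite /b'; congr (_ * _).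
  have -> : widen_ord (leqnSn m) i = lift ord_max i by apply/val_inj; rewrite /= /bump leqNgt ltn_ord.
  by rewrite liftK.
have c0 : c ord_max = 0.
  apply/eqP/negPn/negP => cn0; apply: nz.
  exists (fun i => - (c ord_max)^-1 * c (widen_ord (leqnSn m) i)).
  case: sW => _ _ /(_ (c ord_max)^-1 _ Wc); congr W.
  rewrite mulrDr mulrA -rmorphM mulVf // rmorph1 mul1r addrC; congr (_ + _).
  rewrite mulr_sumr -sumrN; apply: eq_bigr => i _.
  by rewrite mulrA -rmorphM mulNr rmorphN mulNr opprK.
move=> i; case: (unliftP ord_max i) => [j|] -> //.
have := fb (fun j => c (widen_ord (leqnSn m) j)).
rewrite c0 rmorph0 mul0r addr0 in Wc => /(_ Wc j) <-.
by congr c; apply/val_inj; rewrite /= /bump leqNgt ltn_ord.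
Qed.

(** Induction on the bound: either it can be lowered, or some free family attains it and spans by
    [isdim_span]. *)
Lemma free_bound_isdim V W m :
  subspace W -> free_bound V W m -> exists2 d, (d <= m)%N & isdim V W d.
Proof.
move=> sW; elim: m => [|m IHm] bd.
  exists 0%N => //; exists (fun _ => 0); split=> [[]//|c _ []//|z Vz].
  apply: (@isdim_span V W 0%N (fun=> 0)) => // [[]//|c _ []//].
case: (pselect (free_bound V W m)) => [/IHm[d dm hd]|nb].
  by exists d => //; rewrite leqW.
exists m.+1 => //.
have [d [b [Vb fb nd]]] : exists d (b : 'I_d -> F),
    [/\ forall i, V (b i), free_mod iota W b & ~~ (d <= m)%N].
  apply: contrapT => H; apply: nb => d b Vb fb.
  by apply: contrapT => /negP nd; apply: H; exists d, b.
have ed : d = m.+1 by apply/eqP; rewrite eqn_leq (bd _ _ Vb fb) ltnNge nd.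
by subst d; exists b; split=> //; apply: isdim_span.
Qed.

Lemma isdim_add U V W d e : subspace U -> subspace W -> U `<=` W -> W `<=` V ->
  isdim V W d -> isdim W U e -> isdim V U (d + e).
Proof.
move=> sU sW UW WV [b [Vb fb spb]] [b' [Wb' fb' spb']].
pose B (i : 'I_(d + e)) := match fintype.split i with inl i => b i | inr j => b' j end.
have Bl i : B (lshift e i) = b i by rewrite /B; have := @unsplitK d e (inl i) => /= ->.
have Br i : B (rshift d i) = b' i by rewrite /B; have := @unsplitK d e (inr i) => /= ->.
exists B; split=> [i|c|z Vz].
- by rewrite /B; case: fintype.split => // j; exact/WV.
- rewrite big_split_ord /=; under eq_bigr do rewrite Bl; under [X in _ + X]eq_bigr do rewrite Br.
  move=> Uc.
  have W2 : W (\sum_(i < e) iota (c (rshift d i)) * b' i) by apply: subspace_lin.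
  have W1 : W (\sum_(i < d) iota (c (lshift e i)) * b i).
    by rewrite -[X in W X](addrK (\sum_(i < e) iota (c (rshift d i)) * b' i));
      apply: subspaceB => //; apply: UW.
  have c1 := fb (fun i => c (lshift e i)) W1.
  rewrite big1 ?add0r in Uc => [|i _]; last by rewrite c1 rmorph0 mul0r.
  have c2 := fb' (fun i => c (rshift d i)) Uc.
  by move=> i; case: (splitP i) => j ij; [rewrite -(c1 j)|rewrite -(c2 j)]; congr c; exact/val_inj.
- have [c hc] := spb z Vz; have [c' hc'] := spb' _ hc.
  pose C (i : 'I_(d + e)) := match fintype.split i with inl i => c i | inr j => c' j end.
  have Cl i : C (lshift e i) = c i by rewrite /C; have := @unsplitK d e (inl i) => /= ->.
  have Cr i : C (rshift d i) = c' i by rewrite /C; have := @unsplitK d e (inr i) => /= ->.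
  exists C; rewrite big_split_ord /= opprD addrA.
  under eq_bigr do rewrite Bl Cl.
  by under [X in _ - _ - X]eq_bigr do rewrite Br Cr.
Qed.

Lemma isdim_refl V : subspace V -> isdim V V 0.
Proof.
move=> sV; exists (fun _ => 0); split=> [[]//|c _ []//|z Vz].
by exists (fun=> 0); rewrite big_ord0 subr0.
Qed.

Lemma isdim_line V W e : V e -> ~ W e ->
    subspace W -> (forall z, V z -> exists c, W (z - iota c * e)) ->
  isdim V W 1.
Proof.
move=> Ve nWe sW sp; exists (fun=> e); split=> // [c|z /sp[c hc]]; last first.
  by exists (fun=> c); rewrite big_ord1.
rewrite big_ord1 => Wc i; rewrite ord1; apply/eqP/negPn/negP => cn0; apply: nWe.
case: sW => _ _ /(_ (c ord0)^-1 _ Wc).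
by rewrite mulrA -rmorphM mulVf // rmorph1 mul1r.
Qed.

Lemma isdim_codim V W U d e : subspace U -> subspace W -> U `<=` W -> W `<=` V ->
  isdim V U d -> free_bound V W e -> exists2 d', (d <= d' + e)%N & isdim W U d'.
Proof.
move=> sU sW UW WV hd be.
have [e' le hVW] := free_bound_isdim sW be.
have bd : free_bound W U d.
  by move=> k b Wb; apply: (isdim_bound sU hd) => i; exact/WV.
have [d' _ hWU] := free_bound_isdim sU bd.
exists d' => //; rewrite (isdim_uniq sU hd (isdim_add sU sW UW WV hVW hWU)).
by rewrite addnC leq_add2l.
Qed.

Lemma isdim_scale V d h : h != 0 ->
  isdim V [set 0] d -> isdim [set h * x | x in V] [set 0] d.
Proof.
move=> h0 [b [Vb fb sp]]; exists (fun i => h * b i); split.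
- by move=> i; exists (b i).
- move=> c /= hc; apply: fb => /=; apply: (mulfI h0); rewrite mulr0 -[RHS]hc mulr_sumr.
  by apply: eq_bigr => i _; rewrite mulrCA.
- move=> _ [z Vz <-]; have [c hc] := sp z Vz; exists c => /=.
  rewrite /= in hc; transitivity (h * (z - \sum_(i < d) iota (c i) * b i)).
    rewrite mulrBr mulr_sumr; congr (_ - _).
    by apply: eq_bigr => i _; rewrite mulrCA.
  by rewrite hc mulr0.
Qed.

End LinearAlgebra.

(** * Places *)

Section PlaceTheory.
Variables (K F : fieldType) (iota : {rmorphism K -> F}).
Implicit Types (v : F -> int).

(* Zero lies in every [vge v n], although [v 0 = 0] by convention. *)
Definition vge v (n : int) : set F := [set x | x = 0 \/ n <= v x].

Section OnePlace.
Variables (v : F -> int) (pv : places iota v).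

Lemma pl0 : v 0 = 0. Proof. by case: pv. Qed.

Lemma plM x y : x != 0 -> y != 0 -> v (x * y) = v x + v y.
Proof. by case: pv => _ + _ _ _; apply. Qed.

Lemma plC c : v (iota c) = 0.
Proof.
have [->|c0] := eqVneq c 0; first by rewrite rmorph0 pl0.
by case: pv => _ _ _ + _; apply.
Qed.

Lemma pl1 : v 1 = 0. Proof. by rewrite -(rmorph1 iota) plC. Qed.

Lemma plN x : v (- x) = v x.
Proof.
have [->|x0] := eqVneq x 0; first by rewrite oppr0.
by rewrite -mulN1r plM ?oppr_eq0 ?oner_eq0 // -(rmorphN1 iota) plC add0r.
Qed.

Lemma plV x : v x^-1 = - v x.
Proof.
have [->|x0] := eqVneq x 0; first by rewrite invr0 pl0 oppr0.
by apply/eqP; rewrite -addr_eq0 -plM ?invr_eq0 // mulVf // pl1.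
Qed.

Lemma plX x n : v (x ^+ n) = v x * n%:Z.
Proof.
have [->|x0] := eqVneq x 0; first by rewrite expr0n pl0 mul0r; case: n => [|n]; rewrite ?pl1 ?pl0.
elim: n => [|n IHn]; first by rewrite expr0 pl1 mulr0.
by rewrite exprS plM ?expf_neq0 // IHn -[n.+1]add1n PoszD mulrDr mulr1.
Qed.

Lemma plXz x (n : int) : v (x ^ n) = v x * n.
Proof.
case: n => n; first exact: plX.
by rewrite NegzE -exprnN plV plX mulrN.
Qed.

Lemma vge0 n : vge v n 0. Proof. by left. Qed.

Lemma vge_le n m x : n <= m -> vge v m x -> vge v n x.
Proof. by move=> nm [->|h]; [left|right; exact: le_trans h]. Qed.

Lemma vgeD n x y : vge v n x -> vge v n y -> vge v n (x + y).
Proof.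
move=> [->|hx] [->|hy]; rewrite ?addr0 ?add0r; [by left|by right|by right|].
have [x0|xn0] := eqVneq x 0; first by rewrite x0 add0r; right.
have [y0|yn0] := eqVneq y 0; first by rewrite y0 addr0; right.
have [->|xy0] := eqVneq (x + y) 0; first by left.
right; case: pv => _ _ /(_ x y xn0 yn0 xy0) + _ _; apply: le_trans.
by rewrite le_min hx hy.
Qed.

Lemma vgeM n m x y : vge v n x -> vge v m y -> vge v (n + m) (x * y).
Proof.
move=> [->|hx] [->|hy]; rewrite ?mulr0 ?mul0r; try by left.
have [->|xn0] := eqVneq x 0; first by rewrite mul0r; left.
have [->|yn0] := eqVneq y 0; first by rewrite mulr0; left.
by right; rewrite plM // lerD.
Qed.

Lemma vgeC c : vge v 0 (iota c). Proof. by right; rewrite plC. Qed.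

Lemma subspace_vge n : subspace iota (vge v n).
Proof.
split=> [|x y|c x]; [exact: vge0|exact: vgeD|].
by move=> /(vgeM (vgeC c)); rewrite add0r.
Qed.

Lemma vgeN n x : vge v n x -> vge v n (- x).
Proof. exact: (subspaceN (subspace_vge n)). Qed.

Lemma vgeB n x y : vge v n x -> vge v n y -> vge v n (x - y).
Proof. exact: (subspaceB (subspace_vge n)). Qed.

Lemma vge_sum n I (r : seq I) (P : pred I) (f : I -> F) :
  (forall i, P i -> vge v n (f i)) -> vge v n (\sum_(i <- r | P i) f i).
Proof. exact: (subspace_sum _ (subspace_vge n)). Qed.

Lemma vgeX x n : vge v 0 x -> vge v 0 (x ^+ n).
Proof.
move=> vx; elim: n => [|n IHn]; first by rewrite expr0; right; rewrite pl1.
by rewrite exprS -[0]addr0; apply: vgeM.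
Qed.

Lemma vgeP n x : x != 0 -> vge v n x -> n <= v x.
Proof. by move=> x0 [x0'|//]; rewrite x0' eqxx in x0. Qed.

Lemma vge_val x : vge v (v x) x. Proof. by right. Qed.

Lemma vge1P x : vge v 1 x <-> (x = 0 \/ 0 < v x).
Proof. by rewrite /vge /= gtz0_ge1. Qed.

(** If the sum had a larger value, so would x = (x + y) - y. Phrasing the hypothesis with [vge]
    includes the case y = 0. *)
Lemma plD_dom x y : x != 0 -> vge v (v x + 1) y -> x + y != 0 /\ v (x + y) = v x.
Proof.
move=> x0 hy.
have xy0 : x + y != 0.
  apply/eqP => /eqP; rewrite addr_eq0 => /eqP xy.
  have : vge v (v x + 1) x by rewrite {2}xy; exact: vgeN.
  by move/(vgeP x0); lia.
split=> //; apply/eqP; rewrite eq_le; apply/andP; split; last first.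
  apply: vgeP => //; apply: vgeD; first exact: vge_val.
  by apply: vge_le hy; lia.
rewrite leNgt; apply/negP => h.
have : vge v (v x + 1) (x + y - y) by apply: vgeB => //; right; lia.
by rewrite addrK => /(vgeP x0); lia.
Qed.

Lemma pl_sum_dom (I : finType) (f : I -> F) :
    (forall i j, f i != 0 -> f j != 0 -> v (f i) = v (f j) -> i = j) ->
    (exists i, f i != 0) ->
  exists i, [/\ f i != 0, \sum_i f i != 0, v (\sum_i f i) = v (f i) &
                forall j, f j != 0 -> v (f i) <= v (f j)].
Proof.
move=> inj_f [i0 fi0].
case: (@arg_minP _ _ _ i0 (fun i => f i != 0) (fun i => v (f i)) fi0) => i fi mini.
exists i; rewrite (bigD1 i) //=.
have [|-> ->] // := @plD_dom (f i) (\sum_(j | j != i) f j) fi.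
apply: vge_sum => j ji; have [->|fj] := eqVneq (f j) 0; first exact: vge0.
right; have := mini _ fj; rewrite le_eqVlt => /orP[/eqP e|]; last by lia.
by rewrite (inj_f _ _ fi fj e) eqxx in ji.
Qed.

Lemma place_idealE : place_ideal v = vge v 1.
Proof. by apply/seteqP; split=> x /vge1P. Qed.

Lemma place_isdim d : isdim iota (vge v 0) (vge v 1) d -> place_degree iota v = d.
Proof.
move=> h; rewrite /place_degree place_idealE; apply: isdim_dim h.
exact: subspace_vge.
Qed.

Lemma pl_param : exists2 x, x != 0 & v x = 1.
Proof.
case: pv => v0 _ _ _ [x vx]; exists x => //; apply/eqP => x0.
by rewrite x0 v0 in vx.
Qed.

(** Division by x^n, for [x] of value 1, embeds the quotient into the residue field, which has
    dimension [d]. *)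
Lemma free_bound_step (W : set F) n d : subspace iota W ->
    isdim iota (vge v 0) (vge v 1) d ->
  W `<=` vge v n -> free_bound iota W [set y | W y /\ vge v (n + 1) y] d.
Proof.
move=> sW hd hW k b Wb fb; have [x x0 vx] := pl_param.
apply: (isdim_bound (subspace_vge 1) hd (b := fun i => x ^ (- n) * b i)) => [i|c hc].
  rewrite -[0](addNr n); apply: vgeM; last exact/hW.
  by right; rewrite plXz vx mul1r.
apply: fb; split; first exact: subspace_lin.
have -> : \sum_(i < k) iota (c i) * b i = (\sum_(i < k) iota (c i) * (x ^ (- n) * b i)) * x ^ n.
  rewrite mulr_suml; apply: eq_bigr => i _.
  by rewrite -mulrA (mulrAC (x ^ _)) -expfzDr // addNr expr0z mul1r.
rewrite addrC; apply: vgeM => //.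
by right; rewrite plXz vx mul1r.
Qed.

(** Each further order of vanishing loses at most [d] dimensions, by [free_bound_step]. Lower bounds
    of this kind are all that the Riemann inequality needs. *)
Lemma isdim_step (W : set F) n d m : subspace iota W ->
    isdim iota (vge v 0) (vge v 1) d -> W `<=` vge v n -> isdim iota W [set 0] m ->
  forall k : nat, exists2 m', (m <= m' + k * d)%N &
    isdim iota [set y | W y /\ vge v (n + k%:Z) y] [set 0] m'.
Proof.
move=> sW hd hW hm; elim=> [|k [m' le' hm']].
  exists m; first by rewrite mul0n addn0.
  by congr isdim : hm; apply/seteqP; split=> [y Wy|y []//]; split=> //; rewrite addr0; exact: hW.
set W' := [set y | _ /\ _] in hm'.
have sI j : subspace iota [set y | W y /\ vge v j y].
  case: (sW) (subspace_vge j) => a1 a2 a3 [b1 b2 b3].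
  by split=> [//|x y [? ?] [? ?]|c x [? ?]]; split; auto.
have hW' : W' `<=` vge v (n + k%:Z) by move=> y [].
have fbd := free_bound_step (sI _) hd hW'.
have [|||m'' le'' hm''] := isdim_codim (subspace0 iota) _ _ _ hm' fbd.
- case: (sI (n + k%:Z)) (subspace_vge (n + k%:Z + 1)) => a1 a2 a3 [b1 b2 b3].
  by split=> [//|x y [? ?] [? ?]|c x [? ?]]; split; auto.
- by move=> _ ->; split; [case: (sI (n + k%:Z))|exact: vge0].
- by move=> y [].
exists m''; first by apply: leq_trans le' _; rewrite mulSn addnA leq_add2r.
congr isdim: hm''; apply/seteqP; split=> y.
  by move=> [[Wy _] vy]; split=> //; congr vge: vy; lia.
move=> [Wy vy]; split; last by congr vge: vy; lia.
by split=> //; apply: vge_le vy; lia.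
Qed.

End OnePlace.

(** * Localizations inside F that are discrete valuation rings *)

(** Ring and ideal are subsets of [F], and [pi_frac] makes [F] the fraction field of [R], so the
    localization needs no separate construction: its elements are quotients in [F]. *)
Record prime_ideal_of (R M : set F) : Prop := PrimeIdealOf {
  pi_1 : R 1;
  pi_B : forall x y, R x -> R y -> R (x - y);
  pi_M : forall x y, R x -> R y -> R (x * y);
  pi_frac : forall z, exists x y, [/\ R x, R y, y != 0 & z = x / y];
  pi_sub : M `<=` R;
  pi_D : forall x y, M x -> M y -> M (x + y);
  pi_I : forall x y, R x -> M y -> M (x * y);
  pi_n1 : ~ M 1;
  pi_prime : forall x y, R x -> R y -> M (x * y) -> M x \/ M y }.

Definition outside (R M : set F) : set F := [set x | R x /\ ~ M x].

(* The localization of R at M is a discrete valuation ring with uniformizer u. *)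
Definition local_param (R M : set F) (u : F) :=
  [/\ M u, u != 0 & forall x, R x -> x != 0 ->
    exists (k : nat) s y, [/\ outside R M s, outside R M y & s * x = u ^+ k * y]].

Section Local.
Variables (R M : set F) (u : F) (pRM : prime_ideal_of R M).

Lemma pi_R0 : R 0. Proof. by rewrite -(subrr 1); apply: (pi_B pRM); exact: pi_1 pRM. Qed.

Lemma pi_RN x : R x -> R (- x).
Proof. by move=> Rx; rewrite -sub0r; apply: (pi_B pRM) => //; exact: pi_R0. Qed.

Lemma pi_RD x y : R x -> R y -> R (x + y).
Proof. by move=> Rx Ry; rewrite -[y]opprK; apply: (pi_B pRM) => //; exact: pi_RN. Qed.

Lemma pi_RX x n : R x -> R (x ^+ n).
Proof.
move=> Rx; elim: n => [|n IHn]; first by rewrite expr0; exact: pi_1 pRM.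
by rewrite exprS; apply: (pi_M pRM).
Qed.

Lemma outsideM x y : outside R M x -> outside R M y -> outside R M (x * y).
Proof.
move=> [Rx Mx] [Ry My]; split; first exact: pi_M pRM _ _ _ _.
by case/(pi_prime pRM).
Qed.

Lemma outside1 : outside R M 1.
Proof. by split; [exact: pi_1 pRM|exact: pi_n1 pRM]. Qed.

Lemma outsideX x n : outside R M x -> outside R M (x ^+ n).
Proof.
move=> Dx; elim: n => [|n IHn]; first by rewrite expr0; exact: outside1.
by rewrite exprS; apply: outsideM.
Qed.

Lemma pi_M0 m : M m -> M 0.
Proof. by move=> Mm; rewrite -(mul0r m); apply: (pi_I pRM) => //; exact: pi_R0. Qed.

Lemma outside_neq0 m x : M m -> outside R M x -> x != 0.
Proof. by move=> /pi_M0 M0 [_ nMx]; apply/eqP => x0; rewrite x0 in nMx. Qed.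

(** The third hypothesis says that [u] generates [M] locally, the last one that each nonzero [x]
    divides a power of [u] up to factors outside [M]. The induction is on that power: if [x] lies in
    [M], a factor [u] is taken out of it and the power drops by one. *)
Lemma local_param_intro :
    M u -> u != 0 ->
    (forall m, M m -> exists s r, [/\ outside R M s, R r & s * m = u * r]) ->
    (forall x, R x -> x != 0 -> exists x' (k : nat) s0 s1,
       [/\ R x', outside R M s0, outside R M s1 & s0 * (x * x') = u ^+ k * s1]) ->
  local_param R M u.
Proof.
move=> Mu u0 hm hx; split=> // x Rx x0; have [x' [k [s0 [s1 [Rx' D0 D1]]]]] := hx x Rx x0.
elim: k x Rx {x0} s0 s1 D0 D1 => [|k IHk] x Rx s0 s1 D0 D1 e.
  exists 0%N, 1, x; split; [exact: outside1| |by rewrite expr0].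
  split=> // Mx; case: (D1) => _; apply.
  rewrite expr0 mul1r in e; have -> : s1 = (s0 * x') * x by rewrite -e; ring.
  by apply: (pi_I pRM) => //; case: D0 => R0 _; apply: (pi_M pRM).
case: (pselect (M x)) => [Mx|nMx]; last first.
  exists 0%N, 1, x; split; [exact: outside1|by split|by rewrite expr0].
have [s [r [Ds Rr esr]]] := hm _ Mx.
have [|k' [s' [y [Ds' Dy e']]]] := IHk r Rr s0 (s * s1) D0 (outsideM Ds D1).
  apply: (mulfI u0); transitivity (s0 * x' * (u * r)); first by ring.
  rewrite -esr.
  transitivity (s * (s0 * (x * x'))); first by ring.
  by rewrite e exprS; ring.
exists k'.+1, (s' * s), y; split=> //; first exact: outsideM.
by rewrite -mulrA esr mulrCA e' exprS mulrA.
Qed.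

Hypothesis lp : local_param R M u.

Let u0 : u != 0. Proof. by case: lp. Qed.
Let Mu : M u. Proof. by case: lp. Qed.

Lemma out0 x : outside R M x -> x != 0.
Proof. exact: outside_neq0 Mu. Qed.

Lemma local_decomp z : z != 0 ->
  exists (k : int) x y, [/\ outside R M x, outside R M y & z = u ^ k * x / y].
Proof.
move=> z0; have [x [y [Rx Ry y0 e]]] := pi_frac pRM z.
have x0 : x != 0 by apply: contra z0 => /eqP x0; rewrite e x0 mul0r.
case: lp => _ _ h.
have [k [s [x1 [Ds Dx1 e1]]]] := h x Rx x0.
have [l [s' [y1 [Ds' Dy1 e2]]]] := h y Ry y0.
exists (k%:Z - l%:Z), (s' * x1), (s * y1); split; try exact: outsideM.
have [s0 s'0 y10] := And3 (out0 Ds) (out0 Ds') (out0 Dy1).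
rewrite expfzDr // -invr_expz -!exprnP e.
have -> : x = u ^+ k * x1 / s by rewrite -e1 mulrAC mulfV // mul1r.
have -> : y = u ^+ l * y1 / s' by rewrite -e2 mulrAC mulfV // mul1r.
by field; rewrite s0 s'0 y10 expf_neq0.
Qed.

Lemma local_decomp_nat x : R x -> x != 0 ->
  exists (k : nat) y s, [/\ outside R M y, outside R M s & x = u ^ k%:Z * y / s].
Proof.
case: lp => _ _ h Rx x0; have [k [s [y [Ds Dy e]]]] := h x Rx x0.
by exists k, y, s; split=> //; rewrite -exprnP -e mulrAC mulfV ?mul1r ?out0.
Qed.

Lemma local_uniq_le (k l : int) x y x' y' :
    outside R M x -> outside R M y -> outside R M x' -> outside R M y' ->
  u ^ k * x / y = u ^ l * x' / y' -> l <= k.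
Proof.
move=> Dx Dy Dx' Dy' e; rewrite leNgt; apply/negP => lt.
have [y0 y'0] := conj (out0 Dy) (out0 Dy').
have [j hj] : exists j : nat, l = k + j.+1%:Z.
  by exists (absz (l - k - 1)%R); lia.
have : x * y' = u * (u ^+ j * (x' * y)).
  apply: (mulfI (expfz_neq0 k u0)).
  transitivity (u ^ k * x / y * (y * y')); first by field.
  rewrite e hj expfzDr // -exprnP exprS; field; by rewrite y'0.
move=> exy; have [_] := outsideM Dx Dy'; apply; rewrite exy mulrC; apply: (pi_I pRM) => //.
case: Dx' Dy => [Rx' _] [Ry _].
by apply: (pi_M pRM); [exact/pi_RX/(pi_sub pRM)|apply: (pi_M pRM)].
Qed.

Lemma local_uniq (k l : int) x y x' y' :
    outside R M x -> outside R M y -> outside R M x' -> outside R M y' ->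
  u ^ k * x / y = u ^ l * x' / y' -> k = l.
Proof.
move=> Dx Dy Dx' Dy' e; apply/eqP; rewrite eq_le.
rewrite (local_uniq_le Dx Dy Dx' Dy' e).
by rewrite (local_uniq_le Dx' Dy' Dx Dy (esym e)).
Qed.

Lemma local_place : (forall c, R (iota c)) ->
  exists v, [/\ places iota v, v u = 1, forall x, outside R M x -> v x = 0
    & forall x, M x -> vge v 1 x].
Proof.
move=> Rc.
pose dec z k := exists x y, [/\ outside R M x, outside R M y & z = u ^ k * x / y].
(* The exponent of [u], unique by [local_uniq]; zero gets the value 0, as [places] requires. *)
pose v z := if z == 0 then 0 else xget (0 : int) (dec z).
have vE z k : z != 0 -> dec z k -> v z = k.
  move=> z0 h; rewrite /v (negPf z0); case: xgetP => [k' -> h'|/(_ k)//].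
  case: h h' => [x [y [Dx Dy e]]] [x' [y' [Dx' Dy' e']]].
  by apply: (local_uniq Dx' Dy' Dx Dy); rewrite -e.
have vO x : outside R M x -> v x = 0.
  move=> Dx; apply: vE; first exact: out0.
  by exists x, 1; split=> //; [exact: outside1|rewrite expr0z mul1r divr1].
have v0 : v 0 = 0 by rewrite /v eqxx.
have vR x : R x -> vge v 0 x.
  move=> Rx; have [->|x0] := eqVneq x 0; first by left.
  have [k [y [s [Dy Ds e]]]] := local_decomp_nat Rx x0; right.
  by rewrite (vE _ k%:Z) //; exists y, s.
have vu : v u = 1.
  by apply: vE => //; exists 1, 1; split; try exact: outside1; rewrite expr1z mulr1 divr1.
have vM x y : x != 0 -> y != 0 -> v (x * y) = v x + v y.
  move=> x0 y0; have [k [a [b [Da Db e]]]] := local_decomp x0.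
  have [l [c [d [Dc Dd f]]]] := local_decomp y0.
  rewrite (vE x k) // ?(vE y l) //; last 2 first.
  - by exists c, d.
  - by exists a, b.
  apply: vE; first exact: mulf_neq0.
  exists (a * c), (b * d); split; try exact: outsideM.
  by rewrite e f expfzDr //; field; rewrite (out0 Db) (out0 Dd).
exists v; split=> //; last first.
  move=> x Mx; have [->|x0] := eqVneq x 0; first by left.
  have [[|k] [y [s [Dy Ds e]]]] := local_decomp_nat (pi_sub pRM Mx) x0; last first.
    by right; rewrite (vE _ k.+1%:Z) //; exists y, s.
  exfalso; case: (Dy) => _; apply.
  have -> : y = s * x by rewrite e expr0z mul1r mulrC divfK // out0.
  by case: Ds => Rs _; apply: (pi_I pRM).
split=> //; last by exists u.
- move=> x y x0 y0 xy0.
  wlog lexy : x y x0 y0 xy0 / v x <= v y.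
    move=> H; case: (leP (v x) (v y)) => [h|/ltW h].
      by have := H x y x0 y0 xy0 h; rewrite min_l.
    have := H y x y0 x0; rewrite addrC => /(_ xy0 h).
    by rewrite min_l.
  rewrite min_l //.
  have [k [a [b [Da Db e]]]] := local_decomp x0.
  have [l [c [d [Dc Dd f]]]] := local_decomp y0.
  have vx : v x = k by apply: vE => //; exists a, b.
  have vy : v y = l by apply: vE => //; exists c, d.
  rewrite vx vy in lexy *.
  have [j hj] : exists j : nat, l = k + j%:Z by exists (absz (l - k)%R); lia.
  pose n := a * d + u ^+ j * c * b.
  have exy : x + y = u ^ k * (n / (b * d)).
    rewrite e f /n hj expfzDr // -exprnP; field.
    by rewrite (out0 Db) (out0 Dd).
  have Rn : R n.
    case: Da Db Dc Dd => [Ra _] [Rb _] [Rc' _] [Rd _].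
    apply: pi_RD; first exact: (pi_M pRM).
    by apply: (pi_M pRM) => //; apply: (pi_M pRM) => //; apply/pi_RX/(pi_sub pRM).
  have n0 : n != 0 by apply: contra xy0 => /eqP n0; rewrite exy n0 mul0r mulr0.
  have bd0 : b * d != 0 by rewrite mulf_neq0 ?out0.
  rewrite exy vM ?expfz_neq0 ?mulf_neq0 ?invr_eq0 //.
  rewrite vM ?invr_eq0 // (vE (u ^ k) k) ?expfz_neq0 //; last first.
    by exists 1, 1; split; try exact: outside1; rewrite mulr1 divr1.
  rewrite (vE (b * d)^-1 0) ?invr_eq0 //; last first.
    exists 1, (b * d); split; [exact: outside1|exact: outsideM|].
    by rewrite expr0z !mul1r.
  by rewrite addr0 lerDl; case: (vR _ Rn) => // n0'; rewrite n0' eqxx in n0.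
- move=> c c0; apply: vO; split=> // Mc; case: (outside1) => _; apply.
  by rewrite -(rmorph1 iota) -(mulVf c0) rmorphM; apply: (pi_I pRM).
Qed.

Lemma local_place_val v (k : int) x y : places iota v ->
    (forall x, outside R M x -> v x = 0) -> outside R M x -> outside R M y ->
  v (u ^ k * x / y) = k * v u.
Proof.
move=> pv vO Dx Dy; have [x0 y0] := conj (out0 Dx) (out0 Dy).
have uk0 : u ^ k != 0 by exact: expfz_neq0.
rewrite (plM pv) ?invr_eq0 ?mulf_neq0 // (plM pv) // (plV pv) (plXz pv) (vO x) // (vO y) //.
by rewrite subr0 addr0 mulrC.
Qed.

(** [v] multiplies the exponent of [u] by [v u], and some element has value 1, so [v u] divides
    1. *)
Lemma local_place_param v : places iota v ->
  (forall x, outside R M x -> v x = 0) -> 0 < v u -> v u = 1.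
Proof.
move=> pv vO vu; have [x x0 vx] := pl_param pv.
have [k [a [b [Da Db e]]]] := local_decomp x0.
have := vx; rewrite e (local_place_val _ pv) // => h.
have k0 : 0 < k by rewrite -(pmulr_lgt0 _ vu) h.
by move: (v u) vu h => z; case: (intP k) k0 => // j _; nia.
Qed.

Lemma local_place_uniq v v' : places iota v -> places iota v' ->
    (forall x, outside R M x -> v x = 0) -> (forall x, outside R M x -> v' x = 0) ->
  0 < v u -> 0 < v' u -> v = v'.
Proof.
move=> pv pv' vO vO' vu vu'; apply/funext => z.
have [->|z0] := eqVneq z 0; first by rewrite (pl0 pv) (pl0 pv').
have [k [a [b [Da Db ->]]]] := local_decomp z0.
rewrite (local_place_val _ pv) // (local_place_val _ pv') //.
by rewrite (local_place_param pv vO vu) (local_place_param pv' vO' vu').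
Qed.

End Local.

End PlaceTheory.

(** * Evaluation of polynomials at t and at (t, w) *)

HB.lock Definition peval (K F : fieldType) (iota : {rmorphism K -> F}) (t : F)
  (f : {poly K}) : F := (map_poly iota f).[t].

Section PevalMorphism.
Variables (K F : fieldType) (iota : {rmorphism K -> F}) (t : F).

Fact peval_zmod : zmod_morphism (peval iota t).
Proof. by move=> f g; rewrite peval.unlock rmorphB hornerD hornerN. Qed.
HB.instance Definition _ := GRing.isZmodMorphism.Build _ _ (peval iota t) peval_zmod.

Fact peval_monoid : monoid_morphism (peval iota t).
Proof. by rewrite peval.unlock; split=> [|f g]; rewrite ?rmorph1 ?hornerC // rmorphM hornerM. Qed.
HB.instance Definition _ := GRing.isMonoidMorphism.Build _ _ (peval iota t) peval_monoid.

End PevalMorphism.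

HB.lock Definition peval2 (K F : fieldType) (iota : {rmorphism K -> F}) (t w : F)
  (P : {poly {poly K}}) : F := (map_poly (peval iota t) P).[w].

Section Peval2Morphism.
Variables (K F : fieldType) (iota : {rmorphism K -> F}) (t w : F).

Fact peval2_zmod : zmod_morphism (peval2 iota t w).
Proof. by move=> f g; rewrite peval2.unlock rmorphB hornerD hornerN. Qed.
HB.instance Definition _ := GRing.isZmodMorphism.Build _ _ (peval2 iota t w) peval2_zmod.

Fact peval2_monoid : monoid_morphism (peval2 iota t w).
Proof. by rewrite peval2.unlock; split=> [|f g]; rewrite ?rmorph1 ?hornerC // rmorphM hornerM. Qed.
HB.instance Definition _ := GRing.isMonoidMorphism.Build _ _ (peval2 iota t w) peval2_monoid.

End Peval2Morphism.

Section Evaluation.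
Variables (K F : fieldType) (iota : {rmorphism K -> F}).
Implicit Types (f g : {poly K}) (P : {poly {poly K}}).
Local Notation evp := (peval iota).
Local Notation ev2 := (peval2 iota).

Definition transcendental (t : F) := forall f, evp t f = 0 -> f = 0.

Lemma evpE t f : evp t f = (map_poly iota f).[t]. Proof. by rewrite peval.unlock. Qed.

Lemma ev2E t w P : ev2 t w P = (map_poly (evp t) P).[w]. Proof. by rewrite peval2.unlock. Qed.

Lemma evp0 t : evp t 0 = 0. Proof. exact: rmorph0. Qed.
Lemma evp1 t : evp t 1 = 1. Proof. exact: rmorph1. Qed.
Lemma evpD t f g : evp t (f + g) = evp t f + evp t g. Proof. exact: rmorphD. Qed.
Lemma evpB t f g : evp t (f - g) = evp t f - evp t g. Proof. exact: rmorphB. Qed.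
Lemma evpM t f g : evp t (f * g) = evp t f * evp t g. Proof. exact: rmorphM. Qed.
Lemma evpXn t f n : evp t (f ^+ n) = evp t f ^+ n. Proof. exact: rmorphXn. Qed.

Lemma ev2B t w P P' : ev2 t w (P - P') = ev2 t w P - ev2 t w P'.
Proof. exact: peval2_zmod. Qed.
Lemma ev20 t w : ev2 t w 0 = 0. Proof. by rewrite -(subrr 0) ev2B subrr. Qed.
Lemma ev21 t w : ev2 t w 1 = 1. Proof. by have [] := peval2_monoid iota t w. Qed.
Lemma ev2N t w P : ev2 t w (- P) = - ev2 t w P.
Proof. by rewrite -sub0r ev2B ev20 sub0r. Qed.
Lemma ev2D t w P P' : ev2 t w (P + P') = ev2 t w P + ev2 t w P'.
Proof. by rewrite -{1}[P']opprK ev2B ev2N opprK. Qed.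
Lemma ev2M t w P P' : ev2 t w (P * P') = ev2 t w P * ev2 t w P'.
Proof. by have [] := peval2_monoid iota t w. Qed.
Lemma ev2Xn t w P n : ev2 t w (P ^+ n) = ev2 t w P ^+ n.
Proof. by elim: n => [|n IHn]; rewrite ?expr0 ?ev21 // !exprS ev2M IHn. Qed.

Lemma evpX t : evp t 'X = t.
Proof. by rewrite evpE map_polyX hornerX. Qed.

Lemma evpC t c : evp t c%:P = iota c.
Proof. by rewrite evpE map_polyC hornerC. Qed.

Lemma ev2X t w : ev2 t w 'X = w.
Proof. by rewrite ev2E map_polyX hornerX. Qed.

Lemma ev2C t w f : ev2 t w f%:P = evp t f.
Proof. by rewrite ev2E map_polyC hornerC. Qed.

Lemma evpZ t c f : evp t (c *: f) = iota c * evp t f.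
Proof. by rewrite -mul_polyC evpM evpC. Qed.

Lemma ev2Z t w f P : ev2 t w (f *: P) = evp t f * ev2 t w P.
Proof. by rewrite -mul_polyC ev2M ev2C. Qed.

Lemma evp_sum t f n : (size f <= n)%N -> evp t f = \sum_(i < n) iota f`_i * t ^+ i.
Proof.
move=> szf; rewrite evpE (horner_coef_wide t (n := n)).
  by apply: eq_bigr => i _; rewrite coef_map.
by rewrite (leq_trans (size_poly _ _)).
Qed.

Lemma ev2_sum t w P n : (size P <= n)%N ->
  ev2 t w P = \sum_(i < n) evp t P`_i * w ^+ i.
Proof.
move=> szP; rewrite ev2E (horner_coef_wide w (n := n)).
  by apply: eq_bigr => i _; rewrite coef_map.
by rewrite (leq_trans (size_poly _ _)).
Qed.

Lemma ev2_poly t w n (f : nat -> {poly K}) :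
  ev2 t w (\poly_(i < n) f i) = \sum_(i < n) evp t (f i) * w ^+ i.
Proof.
rewrite (ev2_sum t w (size_poly n f)); apply: eq_bigr => i _.
by rewrite coef_poly ltn_ord.
Qed.

Lemma not_algebraic_transc t : ~ algebraicOver iota t <-> transcendental t.
Proof.
split=> [nt f ft|tr [f f0 /rootP]]; last rewrite -evpE => ft; last by rewrite (tr f) ?eqxx in f0.
by apply/eqP/negPn/negP => f0; apply: nt; exists f => //; apply/rootP; rewrite -evpE.
Qed.

(* The determinant of multiplication by [w] on K(t)[w], of degree d over K(t),
   satisfies det ^ Q = G ^ d; comparing orders at 0 gives Q %| d. *)
Lemma indep_powers t w Q (G : {poly K}) : prime Q -> transcendental t ->
    w ^+ Q = evp t G -> G != 0 -> ~~ (Q %| mup 0%R G)%N ->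
  forall P : {poly {poly K}}, (size P <= Q)%N -> ev2 t w P = 0 -> P = 0.
Proof.
move=> prQ tr wQ G0 muG.
pose bad d := exists P : {poly {poly K}}, [/\ P != 0, size P = d & ev2 t w P = 0].
move=> P szP evP; apply/eqP/negPn/negP => P0.
have [d bd mind] : exists2 d, bad d & forall d', bad d' -> (d <= d')%N.
  have ex : exists d, `[< bad d >] by exists (size P); apply/asboolP; exists P.
  exists (ex_minn ex); first by case: ex_minnP => d /asboolP.
  by case: ex_minnP => d _ h d' /asboolP; exact: h.
have dQ : (d <= Q)%N by apply: leq_trans szP; apply: mind; exists P.
case: bd => {P szP evP P0} P [P0 szP evP].
case: d mind dQ szP => [|[|d]] mind dQ szP.
- by move/eqP: szP; rewrite size_poly_eq0 (negPf P0).
- have [c Pc] : exists c, P = c%:P by exists P`_0; apply: size1_polyC; rewrite szP.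
  by move: P0; rewrite Pc polyC_eq0 (tr c) ?eqxx // -(ev2C t w) -Pc.
pose a := lead_coef P.
have a0 : a != 0 by rewrite lead_coef_eq0.
have indep (P' : {poly {poly K}}) : (size P' <= d.+1)%N -> ev2 t w P' = 0 -> P' = 0.
  move=> sz ev; apply/eqP/negPn/negP => P'0.
  by have := mind _ (ex_intro _ P' (And3 P'0 erefl ev)); rewrite ltnNge sz.
(* Row i of [M] is to hold the coordinates of a w^(i+1) on 1, ..., w^d. The factor [a], the leading
   coefficient of [P], lets the top power be reduced by [P] without denominators. *)
pose r i : {poly {poly K}} := a *: 'X^(i.+1) - (if i == d then P else 0).
have szr i : (i <= d)%N -> (size (r i) <= d.+1)%N.
  rewrite /r leq_eqVlt; case: eqVneq => [-> _|_ /= ltid]; last first.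
    rewrite subr0 (leq_trans (size_scale_leq _ _)) // size_polyXn //.
  apply/leq_sizeP => j; rewrite leq_eqVlt => /orP[/eqP<-|ltj].
    rewrite coefB coefZ coefXn eqxx mulr1 /a lead_coefE szP /= subrr //.
  rewrite coefB coefZ coefXn gtn_eqF // mulr0 nth_default ?subr0 //.
  by rewrite szP.
have evr i : ev2 t w (r i) = evp t a * w ^+ i.+1.
  rewrite /r ev2B ev2Z ev2Xn ev2X; case: eqP => _; first by rewrite evP subr0.
  by rewrite ev20 subr0.
pose M : 'M[{poly K}]_d.+1 := \matrix_(i, j) (r i)`_j.
pose b : 'cV[F]_d.+1 := \col_i w ^+ i.
have bE i j : b i j = w ^+ i by rewrite mxE.
have ME i j : M i j = (r i)`_j by rewrite mxE.
have Mb : map_mx (evp t) M *m b = (evp t a * w) *: b.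
  apply/colP => i; rewrite mxE [RHS]mxE bE.
  transitivity (ev2 t w (r i)); last by rewrite evr exprS mulrA.
  rewrite (ev2_sum _ _ (szr i _)); last by rewrite -ltnS.
  by apply: eq_bigr => j _; rewrite bE mxE ME.
have Mkb k : map_mx (evp t) (M ^+ k) *m b = (evp t a * w) ^+ k *: b.
  elim: k => [|k IHk]; first by rewrite !expr0 map_mx1 mul1mx scale1r.
  rewrite exprS map_mxM -mulmxA IHk -scalemxAr Mb scalerA.
  by rewrite exprSr.
(* [M] acts on the column of powers as a w, so each row of M^Q - a^Q G is a relation on 1, ..., w^d,
   which is zero by the minimality of [P]. *)
have MQ : M ^+ Q = (a ^+ Q * G)%:M.
  apply/eqP; rewrite -subr_eq0; apply/eqP.
  set N := _ - _; have Nb : map_mx (evp t) N *m b = 0.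
    rewrite /N map_mxB mulmxBl Mkb map_scalar_mx /= mul_scalar_mx evpM evpXn.
    by rewrite exprMn wQ subrr.
  apply/matrixP => i j; rewrite [RHS]mxE.
  have /(congr1 (fun p : {poly {poly K}} => p`_j)) : \poly_(k < d.+1) N i (inord k) = 0.
    apply: indep; first exact: size_poly.
    rewrite ev2_poly; transitivity ((map_mx (evp t) N *m b) i 0); last by rewrite Nb mxE.
    by rewrite mxE; apply: eq_bigr => k _; rewrite bE inord_val [map_mx _ _ _ _]mxE.
  by rewrite coef_poly ltn_ord inord_val coef0.
have : (\det M) ^+ Q = (a ^+ Q * G) ^+ d.+1.
  rewrite -(det_scalar d.+1 (a ^+ Q * G)) -MQ; elim: (Q) => [|k IHk]; first by rewrite !expr0 det1.
  by rewrite !exprS IHk -det_mulmx.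
have detM0 : \det M != 0.
  apply/eqP => detM0; move: (mulf_neq0 (expf_neq0 Q a0) G0) => /(expf_neq0 d.+1)/eqP.
  apply; rewrite -(det_scalar d.+1 (a ^+ Q * G)) -MQ.
  case: Q prQ {wQ muG dQ MQ} => // k _; elim: k => [|k IHk]; first by rewrite expr1.
  by rewrite exprS det_mulmx IHk mulr0.
move=> /(congr1 (mup 0)); have mupX (f : {poly K}) k : f != 0 -> mup 0 (f ^+ k) = (k * mup 0%R f)%N.
  move=> f0; elim: k => [|k IHk]; first by rewrite expr0 mupNroot ?mul0n ?root1.
  by rewrite exprS mupM ?expf_neq0 // IHk mulSn.
rewrite !mupX ?mulf_neq0 ?expf_neq0 // mupM ?expf_neq0 // mupX // => e.
have : (Q %| d.+1 * mup 0%R G)%N.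
  by rewrite -(dvdn_addr _ (dvdn_mull d.+1 (dvdn_mulr (mup 0%R a) (dvdnn Q)))) -mulnDr -e dvdn_mulr.
rewrite Euclid_dvdM // (negPf muG) orbF => /dvdn_leq => /(_ isT).
by rewrite leqNgt dQ.
Qed.

End Evaluation.

Lemma mulz_neg_ltn (T : int) (k d : nat) : T < 0 -> (k < d)%N -> T * d%:Z + 1 <= T * k%:Z.
Proof.
move=> T0 kd; have [j ->] : exists j : nat, d = (k + j.+1)%N by exists (d - k.+1)%N; lia.
by rewrite PoszD mulrDr; nia.
Qed.

Definition subfield_set (K F : fieldType) (iota : {rmorphism K -> F}) (S : set F) :=
  [/\ forall c, S (iota c), forall x y, S x -> S y -> S (x + y),
      forall x y, S x -> S y -> S (x * y) & forall x, S x -> S x^-1].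

(* F = K(t, w) is the function field of a cyclic cover of degree Q of the
   projective line, branched at most at 0, 1 and oo. *)
Record kummer (K F : fieldType) (iota : {rmorphism K -> F}) (Q : nat) (t w : F)
    (e : K) (a b : nat) : Prop := Kummer {
  ku_tr : transcendental iota t;
  ku_eq : w ^+ Q = iota e * t ^+ a * (1 - t) ^+ b;
  ku_e : e != 0;
  ku_gen : forall S, subfield_set iota S -> S t -> S w -> forall z, S z }.

(** * Cyclic covers of the line *)

Section KummerBasics.
Variables (K F : fieldType) (iota : {rmorphism K -> F}).
Local Notation evp := (peval iota).
Local Notation ev2 := (peval2 iota).
Variables (Q : nat) (t w : F) (e : K) (a b : nat).
Hypotheses (prQ : prime Q) (Qa : ~~ (Q %| a)%N) (ku : kummer iota Q t w e a b).

Let tr : transcendental iota t := ku_tr ku.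

Definition kG : {poly K} := e *: ('X ^+ a * (1 - 'X) ^+ b).

Lemma ev_kG : evp t kG = w ^+ Q.
Proof. by rewrite evpZ evpM !evpXn evpB evp1 evpX (ku_eq ku) mulrA. Qed.

Lemma oneX_neq0 : 1 - 'X != 0 :> {poly K}.
Proof. by rewrite -opprB oppr_eq0 polyXsubC_eq0. Qed.

Lemma kG_neq0 : kG != 0.
Proof. by rewrite scaler_eq0 negb_or (ku_e ku) mulf_neq0 ?expf_neq0 ?polyX_eq0 ?oneX_neq0. Qed.

Lemma mup_kG : mup 0 kG = a.
Proof.
rewrite /kG -mul_polyC mupMr ?rootC ?(ku_e ku) // mupMl.
  by rewrite -['X]subr0 -polyC0 mup_XsubCX eqxx.
by rewrite rootE horner_exp !hornerE ?subr0 ?expr1n oner_eq0.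
Qed.

Lemma evp_neq0 f : f != 0 -> evp t f != 0.
Proof. by apply: contra => /eqP/tr->. Qed.

Lemma t_neq0 : t != 0.
Proof. by rewrite -(evpX iota t) evp_neq0 ?polyX_eq0. Qed.

Lemma s_neq0 : 1 - t != 0.
Proof. by rewrite -(evpX iota t) -(evp1 iota t) -evpB evp_neq0 ?oneX_neq0. Qed.

Lemma w_neq0 : w != 0.
Proof.
have: w ^+ Q != 0 by rewrite -ev_kG evp_neq0 ?kG_neq0.
by apply: contra => /eqP->; rewrite expr0n; case: Q prQ.
Qed.

Lemma ku_indep (P : {poly {poly K}}) : (size P <= Q)%N -> ev2 t w P = 0 -> P = 0.
Proof.
by apply: (indep_powers prQ tr (esym ev_kG) kG_neq0); rewrite mup_kG.
Qed.

Definition kPhi : {poly {poly K}} := 'X^Q - kG%:P.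

Let Q_gt0 : (0 < Q)%N := prime_gt0 prQ.

Lemma kPhi_monic : kPhi \is monic. Proof. exact: monicXnsubC. Qed.

Lemma size_kPhi : size kPhi = Q.+1. Proof. exact: size_XnsubC. Qed.

Lemma ev2_kPhi : ev2 t w kPhi = 0.
Proof. by rewrite ev2B ev2Xn ev2X ev2C ev_kG subrr. Qed.

Lemma ku_divide (P : {poly {poly K}}) :
  exists S P' : {poly {poly K}}, (size P' <= Q)%N /\ P = S * kPhi + P'.
Proof.
exists (Pdiv.Ring.rdivp P kPhi), (Pdiv.Ring.rmodp P kPhi).
split; last exact: Pdiv.RingMonic.rdivp_eq kPhi_monic _.
by rewrite -ltnS -size_kPhi Pdiv.Ring.ltn_rmodpN0 ?monic_neq0 ?kPhi_monic.
Qed.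

Lemma ku_reduce (P : {poly {poly K}}) :
  exists2 P' : {poly {poly K}}, (size P' <= Q)%N & ev2 t w P = ev2 t w P'.
Proof.
have [S [P' [sz ->]]] := ku_divide P; exists P' => //.
by rewrite ev2D ev2M ev2_kPhi mulr0 add0r.
Qed.

Lemma ku_ker (P : {poly {poly K}}) : ev2 t w P = 0 -> exists S, P = S * kPhi.
Proof.
have [S [P' [sz ->]]] := ku_divide P.
rewrite ev2D ev2M ev2_kPhi mulr0 add0r => /(ku_indep sz) ->.
by exists S; rewrite addr0.
Qed.

(** Apart from constants in W, [h] is the resultant of [P] with W^Q - G, which lies in the ideal
    generated by both. It is nonzero: a common factor would split W^Q - G into factors of lower
    degree, one of which vanishes at [w], against [ku_indep]. *)
Lemma ku_norm (P : {poly {poly K}}) : ev2 t w P != 0 ->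
  exists (P' : {poly {poly K}}) (h : {poly K}), h != 0 /\ ev2 t w P * ev2 t w P' = evp t h.
Proof.
have [P1 sz ->] := ku_reduce P => {P}; move: P1 sz => P sz P0.
have Pn0 : P != 0 by apply: contra P0 => /eqP ->; rewrite ev20.
have [szP|szP] := leqP (size P) 1%N.
  have [c Pc] : exists c, P = c%:P by exists P`_0; apply: size1_polyC.
  exists 1, c; rewrite ev21 mulr1 Pc ev2C; split=> //.
  by rewrite Pc polyC_eq0 in Pn0.
have szPhi : (1 < size kPhi)%N by rewrite size_kPhi ltnS.
have [uv _ res] := resultant_in_ideal szP szPhi.
exists uv.1, (resultant P kPhi); split; last first.
  by rewrite -(ev2C iota t w) res ev2D !ev2M ev2_kPhi mulr0 addr0 mulrC.
rewrite resultant_eq0 -leqNgt leqNgt; apply/negP => sz_gcd.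
set d := gcdp P kPhi in sz_gcd.
have szd : (size d <= Q)%N by apply: leq_trans sz; apply: dvdp_leq => //; exact: dvdp_gcdl.
have /Pdiv.Idomain.dvdpP[[c qq] /= c0 eq_qq] : d %| kPhi by exact: dvdp_gcdr.
have d0 : d != 0 by rewrite gcdp_eq0 (negPf Pn0).
have cPhi0 : c *: kPhi != 0 by rewrite scale_poly_eq0 negb_or c0 monic_neq0 ?kPhi_monic.
have qq0 : qq != 0 by apply: contra cPhi0 => /eqP qq0; rewrite eq_qq qq0 mul0r.
have szqq : (size qq <= Q)%N.
  have := congr1 (fun p : {poly {poly K}} => size p) eq_qq.
  rewrite size_scale // size_kPhi size_mul // => h.
  by move: sz_gcd h; case: (size d) => [|[|k]] // _; rewrite !addnS /= => -[->]; rewrite leq_addr.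
have : ev2 t w qq * ev2 t w d = 0 by rewrite -ev2M -eq_qq ev2Z ev2_kPhi mulr0.
move/eqP; rewrite mulf_eq0 => /orP[] /eqP; move/ku_indep.
  by move=> /(_ szqq)/eqP; rewrite (negPf qq0).
by move=> /(_ szd)/eqP; rewrite (negPf d0).
Qed.

(** Such elements form a subfield containing [t] and [w]; closure under inverses is [ku_norm]. *)
Lemma ku_frac z : exists (h : {poly K}) (P : {poly {poly K}}),
  [/\ h != 0, (size P <= Q)%N & evp t h * z = ev2 t w P].
Proof.
pose S : set F := [set z | exists (h : {poly K}) (P : {poly {poly K}}),
  h != 0 /\ evp t h * z = ev2 t w P].
suff [h [P [h0 e1]]] : S z.
  by have [P' sz e2] := ku_reduce P; exists h, P'; rewrite -e2.
apply: (ku_gen ku); last 2 first.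
- by exists 1, 'X%:P; rewrite oner_eq0 evp1 mul1r ev2C evpX.
- by exists 1, 'X; rewrite oner_eq0 evp1 mul1r ev2X.
split=> [c|x y [h [P [h0 eP]]] [h' [P' [h'0 eP']]]|x y [h [P [h0 eP]]] [h' [P' [h'0 eP']]]|x [h [P
  [h0 eP]]]].
- by exists 1, c%:P%:P; rewrite oner_eq0 evp1 mul1r ev2C evpC.
- exists (h * h'), (h' *: P + h *: P'); rewrite mulf_neq0 //; split=> //.
  by rewrite evpM ev2D !ev2Z -eP -eP'; ring.
- exists (h * h'), (P * P'); rewrite mulf_neq0 //; split=> //.
  by rewrite evpM ev2M -eP -eP'; ring.
- have [->|x0] := eqVneq x 0.
    by exists 1, 0; rewrite oner_eq0 invr0 mulr0 ev20.
  have P0 : ev2 t w P != 0 by rewrite -eP mulf_neq0 ?evp_neq0.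
  have [P' [k [k0 ePk]]] := ku_norm P0.
  exists k, (h *: P'); split=> //; rewrite ev2Z -ePk -eP.
  by rewrite mulrAC mulfK.
Qed.

(** The coordinate ring K[t, w] of the affine curve. It may be singular over t = 0 and t = 1, which
    is why the places there are treated apart. *)
Definition kR : set F := [set z | exists P, z = ev2 t w P].

Lemma kR_ev P : kR (ev2 t w P). Proof. by exists P. Qed.
Lemma kR_evp f : kR (evp t f). Proof. by exists f%:P; rewrite ev2C. Qed.
Lemma kR_C c : kR (iota c). Proof. by rewrite -(evpC iota t); exact: kR_evp. Qed.
Lemma kR_w : kR w. Proof. by exists 'X; rewrite ev2X. Qed.
Lemma kR_1 : kR 1. Proof. by rewrite -(rmorph1 iota); exact: kR_C. Qed.
Lemma kR_B x y : kR x -> kR y -> kR (x - y).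
Proof. by move=> [P ->] [P' ->]; exists (P - P'); rewrite ev2B. Qed.
Lemma kR_D x y : kR x -> kR y -> kR (x + y).
Proof. by move=> [P ->] [P' ->]; exists (P + P'); rewrite ev2D. Qed.
Lemma kR_M x y : kR x -> kR y -> kR (x * y).
Proof. by move=> [P ->] [P' ->]; exists (P * P'); rewrite ev2M. Qed.
Lemma kR_X x n : kR x -> kR (x ^+ n).
Proof. by move=> [P ->]; exists (P ^+ n); rewrite ev2Xn. Qed.

Lemma kR_frac z : exists x y, [/\ kR x, kR y, y != 0 & z = x / y].
Proof.
have [h [P [h0 _ eP]]] := ku_frac z.
exists (ev2 t w P), (evp t h); split; [exact: kR_ev|exact: kR_evp|exact: evp_neq0|].
by rewrite -eP mulrAC mulfV ?mul1r ?evp_neq0.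
Qed.

Lemma kummer_function_field : is_function_field iota.
Proof.
exists t; split; first exact/not_algebraic_transc.
exists Q, (fun i => w ^+ i) => z; have [h [P [h0 sz eP]]] := ku_frac z.
exists h, (fun i => P`_i); split=> //; rewrite -evpE eP (ev2_sum _ _ _ sz).
by apply: eq_bigr => i _; rewrite -evpE.
Qed.

(** [w] is integral over K[t]: Q v(w) is the value of a polynomial in [t]. *)
Lemma kR_vge v : places iota v -> 0 <= v t -> kR `<=` vge v 0.
Proof.
move=> pv vt; have vevp f : vge v 0 (evp t f).
  rewrite (evp_sum _ _ (leqnn _)); apply: (vge_sum pv) => i _.
  rewrite -[0]addr0; apply: (vgeM pv); first exact: (vgeC pv).
  by apply: (vgeX pv); right.
have vw : vge v 0 w.
  right; have : vge v 0 (w ^+ Q) by rewrite -ev_kG; apply: vevp.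
  move/(vgeP (expf_neq0 Q w_neq0)); rewrite (plX pv).
  by rewrite pmulr_lge0 // ltz_nat.
move=> _ [P ->]; rewrite (ev2_sum _ _ _ (leqnn _)); apply: (vge_sum pv) => i _.
by rewrite -[0]addr0; apply: (vgeM pv); [exact: vevp|apply: (vgeX pv)].
Qed.

Lemma evp_val_neg v f : places iota v -> v t < 0 -> f != 0 ->
  v (evp t f) = v t * (size f).-1%:Z.
Proof.
move=> pv vt f0; have t0 := t_neq0.
have lead0 : iota (lead_coef f) * t ^+ (size f).-1 != 0.
  by rewrite mulf_neq0 ?fmorph_eq0 ?lead_coef_eq0 ?expf_neq0.
have vlead : v (iota (lead_coef f) * t ^+ (size f).-1) = v t * (size f).-1%:Z.
  by rewrite (plM pv) ?fmorph_eq0 ?lead_coef_eq0 ?expf_neq0 // (plC pv) (plX pv) add0r.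
have szf : (0 < size f)%N by rewrite size_poly_gt0.
rewrite (evp_sum _ _ (leqnn _)) -(prednK szf) big_ord_recr /= addrC -vlead.
apply: (proj2 (plD_dom pv lead0 _)); rewrite vlead; apply: (vge_sum pv) => i _.
have [->|ci0] := eqVneq f`_i 0; first by rewrite (rmorph0 iota) mul0r; left.
right; rewrite (plM pv) ?fmorph_eq0 ?expf_neq0 // (plC pv) (plX pv) add0r.
exact: (mulz_neg_ltn vt (ltn_ord i)).
Qed.

Lemma evp_vge v f : places iota v -> 0 <= v t -> vge v 0 (evp t f).
Proof. by move=> pv vt; apply: kR_vge => //; exact: kR_evp. Qed.

End KummerBasics.

(** * Points of the affine curve *)

(** An element of value 0 is x / y with [x] and [y] outside [M]; both are constants modulo [M], so
    their quotient is one modulo the ideal of the place. *)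
Lemma local_degree1 (K F : fieldType) (iota : {rmorphism K -> F}) (R M : set F)
    (u : F) (v : F -> int) :
    prime_ideal_of R M -> local_param R M u -> places iota v ->
    (forall x, outside R M x -> v x = 0) -> M `<=` vge v 1 ->
    (forall x, R x -> exists c, M (x - iota c)) ->
  isdim iota (vge v 0) (vge v 1) 1.
Proof.
move=> pRM lp pv vO vM hc; have Mu : M u by case: lp.
have u0 : u != 0 by case: lp.
have vu : 0 < v u by have := vgeP u0 (vM _ Mu); lia.
apply: (@isdim_line _ _ _ _ _ 1).
- by right; rewrite (pl1 pv).
- by move=> /(vgeP (oner_neq0 F)); rewrite (pl1 pv).
- exact: subspace_vge pv 1.
move=> z vz; suff [c1 ?] : exists c, vge v 1 (z - iota c) by exists c1; rewrite mulr1.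
have [->|z0] := eqVneq z 0; first by exists 0; left; rewrite (rmorph0 iota) subrr.
have [k [x [y [Dx Dy ez]]]] := local_decomp pRM lp z0.
have vzk : v z = k.
  by rewrite ez (local_place_val pRM lp _ pv) // (local_place_param pRM lp pv vO vu) mulr1.
have k0 : 0 <= k by rewrite -vzk (vgeP z0 vz).
have [k1|k1] := ltP 0 k.
  by exists 0; rewrite (rmorph0 iota) subr0; right; rewrite vzk; lia.
have {k0 k1} k0 : k = 0 by lia.
have [cx hx] := hc x (proj1 Dx); have [cy hy] := hc y (proj1 Dy).
have cy0 : cy != 0.
  by apply/eqP => cy0; case: Dy => _; apply; move: hy; rewrite cy0 (rmorph0 iota) subr0.
have y0 : y != 0 := outside_neq0 pRM Mu Dy.
exists (cx / cy); have icy0 : iota cy != 0 by rewrite fmorph_eq0.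
have -> : z - iota (cx / cy) = ((x - iota cx) + iota (- (cx / cy)) * (y - iota cy)) / y.
  rewrite ez k0 expr0z mul1r !(rmorphM, rmorphN) /= fmorphV.
  by field; rewrite y0 icy0.
rewrite -[1]addr0; apply: (vgeM pv); last by right; rewrite (plV pv) vO.
apply: (vgeD pv); first exact: vM.
by rewrite -[1]add0r; apply: (vgeM pv); [exact: (vgeC pv)|exact: vM].
Qed.

Section KummerPoint.
Variables (K F : fieldType) (iota : {rmorphism K -> F}).
Local Notation evp := (peval iota).
Local Notation ev2 := (peval2 iota).
Variables (Q : nat) (t w : F) (e : K) (a b : nat).
Hypotheses (prQ : prime Q) (Qa : ~~ (Q %| a)%N) (ku : kummer iota Q t w e a b).

Local Notation kR := (kR iota t w).

Definition ptval (tau om : K) (P : {poly {poly K}}) : K := P.[om%:P].[tau].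

Lemma ptvalB tau om P P' : ptval tau om (P - P') = ptval tau om P - ptval tau om P'.
Proof. by rewrite /ptval hornerD hornerN hornerD hornerN. Qed.
Lemma ptvalD tau om P P' : ptval tau om (P + P') = ptval tau om P + ptval tau om P'.
Proof. by rewrite /ptval !hornerD. Qed.
Lemma ptvalM tau om P P' : ptval tau om (P * P') = ptval tau om P * ptval tau om P'.
Proof. by rewrite /ptval !hornerM. Qed.
Lemma ptvalC tau om f : ptval tau om f%:P = f.[tau].
Proof. by rewrite /ptval hornerC. Qed.
Lemma ptvalX tau om : ptval tau om 'X = om.
Proof. by rewrite /ptval hornerX hornerC. Qed.

(* The ideal of K[t, w] of the affine point (tau, om). *)
Definition kM (tau om : K) : set F := [set z | exists P, z = ev2 t w P /\ ptval tau om P = 0].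

Section Point.
Variables (tau om : K).
Hypothesis on_curve : om ^+ Q = (kG e a b).[tau].

Lemma ptval_kPhi : ptval tau om (kPhi Q e a b) = 0.
Proof.
rewrite ptvalB ptvalC -on_curve /ptval hornerXn -rmorphXn hornerC.
by rewrite subrr.
Qed.

Lemma ptval_ker P : ev2 t w P = 0 -> ptval tau om P = 0.
Proof. by move=> /(ku_ker prQ Qa ku)[S ->]; rewrite ptvalM ptval_kPhi mulr0. Qed.

(** Independence of the representative: two of them differ by a multiple of W^Q - G, which vanishes
    at a point of the curve. *)
Lemma kM_ptval P : kM tau om (ev2 t w P) -> ptval tau om P = 0.
Proof.
move=> [P' [e1 pt0]]; have : ptval tau om (P - P') = 0.
  by apply: ptval_ker; rewrite ev2B e1 subrr.
by rewrite ptvalB pt0 subr0.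
Qed.

Lemma kM_prime : prime_ideal_of kR (kM tau om).
Proof.
split.
- exact: kR_1.
- exact: kR_B.
- exact: kR_M.
- exact: kR_frac prQ Qa ku.
- by move=> _ [P [-> _]]; exact: kR_ev.
- move=> _ _ [P [-> pt]] [P' [-> pt']]; exists (P + P').
  by rewrite ev2D ptvalD pt pt' addr0.
- move=> _ _ [P ->] [P' [-> pt']]; exists (P * P').
  by rewrite ev2M ptvalM pt' mulr0.
- rewrite -(ev21 iota t w) => /kM_ptval/eqP.
  by rewrite /ptval !hornerC oner_eq0.
- move=> _ _ [P ->] [P' ->]; rewrite -ev2M => /kM_ptval/eqP.
  by rewrite ptvalM mulf_eq0 => /orP[]/eqP pt; [left; exists P|right; exists P'].
Qed.

Lemma kM_outside P : ptval tau om P != 0 -> outside kR (kM tau om) (ev2 t w P).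
Proof. by move=> pt0; split; [exact: kR_ev|move/kM_ptval/eqP; rewrite (negPf pt0)]. Qed.

Lemma kM_C x : kR x -> exists c, kM tau om (x - iota c).
Proof.
move=> [P ->]; exists (ptval tau om P), (P - (ptval tau om P)%:P%:P).
by rewrite ev2B ev2C evpC ptvalB ptvalC hornerC subrr.
Qed.

Lemma kM_val0 v : places iota v -> kM tau om `<=` vge v 1 ->
  forall x, outside kR (kM tau om) x -> v x = 0.
Proof.
move=> pv vM x [Rx nMx]; have [c Mc] := kM_C Rx.
have c0 : c != 0 by apply/eqP => c0; apply: nMx; move: Mc; rewrite c0 (rmorph0 iota) subr0.
have [||_] := @plD_dom _ _ _ v pv (iota c) (x - iota c); first by rewrite fmorph_eq0.
  by rewrite (plC pv) add0r; apply: vM.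
by rewrite addrC subrK (plC pv).
Qed.

End Point.

Lemma poly_split_at tau (h : {poly K}) : h != 0 ->
  exists k g, g.[tau] != 0 /\ h = ('X - tau%:P) ^+ k * g.
Proof.
move=> h0; have [k [g + ->]] := multiplicity_XsubC h tau.
by rewrite h0 => rg; exists k, g; rewrite mulrC.
Qed.

End KummerPoint.

(** * The totally ramified places *)

Section KummerOrigin.
Variables (K F : fieldType) (iota : {rmorphism K -> F}).
Local Notation evp := (peval iota).
Local Notation ev2 := (peval2 iota).

Section LinearExponent.
Variables (Q : nat) (t w : F) (e : K) (b : nat).
Hypotheses (prQ : prime Q) (ku : kummer iota Q t w e 1 b).

Local Notation kR := (kR iota t w).
Local Notation M := (kM iota t w 0 0).

Let Q1 : ~~ (Q %| 1)%N.
Proof. by rewrite dvdn1; case: Q prQ => [|[|]]. Qed.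

Let Q_gt0 : (0 < Q)%N := prime_gt0 prQ.

Let on_curve0 : 0 ^+ Q = (kG e 1 b).[0].
Proof. by rewrite /kG expr1 hornerZ hornerM hornerX mul0r mulr0 expr0n gtn_eqF. Qed.

Let pRM := kM_prime prQ Q1 ku on_curve0.

Let s := iota e * (1 - t) ^+ b.

Let st : s * t = w ^+ Q.
Proof. by rewrite (ku_eq ku) expr1 /s mulrAC. Qed.

Let Ds : outside kR M s.
Proof.
have -> : s = ev2 t w (e *: (1 - 'X) ^+ b)%:P.
  by rewrite ev2C evpZ evpXn evpB evp1 evpX.
apply: (kM_outside prQ Q1 ku on_curve0).
by rewrite ptvalC hornerZ horner_exp !hornerE subr0 expr1n mulr1 (ku_e ku).
Qed.

Lemma origin_split P : ptval 0 0 P = 0 ->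
  exists (f : {poly K}) P1, P = ('X * f)%:P + 'X * P1.
Proof.
rewrite /ptval => pt0.
have [P1 eP] : exists P1, P - (P`_0)%:P = P1 * 'X.
  have /factor_theorem[P1 ->] : root (P - (P`_0)%:P) 0.
    by rewrite rootE hornerD hornerN hornerC horner_coef0 subrr.
  by exists P1; rewrite polyC0 subr0.
have [f ef] : exists f, P`_0 = f * 'X.
  have /factor_theorem[f ->] : root (P`_0) 0 by rewrite rootE -horner_coef0 -[X in P.[X]]polyC0 pt0.
  by exists f; rewrite polyC0 subr0.
by exists f, P1; rewrite [_ * f]mulrC -ef ['X * P1]mulrC -eP addrC subrK.
Qed.

Let Mw : M w. Proof. by exists 'X; rewrite ev2X ptvalX. Qed.

(** For a = 1 the origin is a smooth point: [s * t = w ^+ Q] with [s] a unit there, so [t] can be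
    traded for w^Q, both in elements of [M] and in the norm t^k g of an element. *)
Lemma origin_param : local_param kR M w.
Proof.
apply: (local_param_intro pRM) => //; first exact: w_neq0 prQ ku.
  move=> _ [P [-> /origin_split[f [P1 ->]]]].
  exists s, (w ^+ Q.-1 * evp t f + s * ev2 t w P1); split=> //.
    apply: kR_D; last by apply: kR_M; [case: Ds|exact: kR_ev].
    by apply: kR_M; [apply: kR_X; exact: kR_w|exact: kR_evp].
  have e1 : w * w ^+ Q.-1 = s * t by rewrite -exprS prednK // st.
  rewrite ev2D ev2M ev2X ev2C evpM evpX.
  transitivity ((s * t) * evp t f + w * s * ev2 t w P1); first by ring.
  by rewrite -e1; ring.
move=> _ [P ->] /(ku_norm prQ Q1 ku)[P' [h [h0 eh]]].
have [k [g [g0 hg]]] := poly_split_at 0 h0.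
exists (ev2 t w P'), (Q * k)%N, (s ^+ k), (evp t g); split.
- exact: kR_ev.
- exact: outsideX pRM _ _ Ds.
- by rewrite -(ev2C iota t w); apply: (kM_outside prQ Q1 ku on_curve0); rewrite ptvalC.
- rewrite eh hg evpM evpXn evpB evpX evpC rmorph0 subr0 mulrA -exprMn st.
  by rewrite -exprM.
Qed.

Let vge_M v : places iota v -> 0 < v t -> M `<=` vge v 1.
Proof.
move=> pv vt _ [P [-> /origin_split[f [P1 ->]]]].
have vt0 : 0 <= v t by lia.
have vs : v (1 - t) = 0.
  have [||_ ->] := @plD_dom _ _ _ v pv 1 (- t); rewrite ?oner_eq0 ?(pl1 pv) //.
  by right; rewrite (plN pv); lia.
have vw : 0 < v w.
  have := congr1 v (ku_eq ku); rewrite (plX pv).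
  have t0 := t_neq0 ku; have s0 := s_neq0 ku; have e0 : iota e != 0 by rewrite fmorph_eq0 (ku_e ku).
  rewrite !(plM pv) ?mulf_neq0 ?expf_neq0 // (plC pv) !(plX pv) vs mul0r addr0 add0r mulr1 => h.
  have : 0 < v w * Q%:Z by rewrite h.
  by rewrite pmulr_lgt0 ?ltz_nat.
rewrite ev2D ev2M ev2X ev2C evpM evpX.
apply: (vgeD pv); rewrite -[1]addr0; apply: (vgeM pv).
- by right; lia.
- exact: (evp_vge prQ ku).
- by right; lia.
- by apply: (kR_vge prQ ku pv vt0); exact: kR_ev.
Qed.

Lemma origin_uniq1 v v' : places iota v -> places iota v' ->
  0 < v t -> 0 < v' t -> v = v'.
Proof.
move=> pv pv' vt vt'; have w0 : w != 0 by apply: w_neq0 prQ ku.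
apply: (local_place_uniq pRM origin_param pv pv').
- exact: (kM_val0 pv (vge_M pv vt)).
- exact: (kM_val0 pv' (vge_M pv' vt')).
- by have := vgeP w0 (vge_M pv vt Mw); lia.
- by have := vgeP w0 (vge_M pv' vt' Mw); lia.
Qed.

Lemma origin_exists1 : exists v,
  [/\ places iota v, 0 < v t, v w = 1 & isdim iota (vge v 0) (vge v 1) 1].
Proof.
have [v [pv vw vO vM]] := local_place pRM origin_param (kR_C iota t w).
exists v; split=> //.
  suff : M t by move=> /vM/(vgeP (t_neq0 ku)); lia.
  by exists 'X%:P; rewrite ev2C evpX ptvalC hornerX.
exact: (local_degree1 pRM origin_param pv vO vM (kM_C _ _)).
Qed.

End LinearExponent.

Lemma subfieldX S x n : subfield_set iota S -> S x -> S (x ^+ n).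
Proof.
move=> [Sc SD SM SV] Sx; elim: n => [|n IHn]; first by rewrite expr0 -(rmorph1 iota).
by rewrite exprS; apply: SM.
Qed.

(** For a > 1 the origin is singular. With i a = j Q + 1, the function w' = w^i / t^j satisfies an
    equation with exponent 1 at [t], and it generates the same field, since w = w'^a t^(j a) / w^(Q
    j). *)
Lemma kummer_origin_change Q t w e a b : prime Q -> ~~ (Q %| a)%N ->
  kummer iota Q t w e a b -> exists w' e' b', kummer iota Q t w' e' 1 b'.
Proof.
move=> prQ Qa ku; have t0 := t_neq0 ku; have s0 := s_neq0 ku.
have w0 := w_neq0 prQ ku.
have ie0 : iota e != 0 by rewrite fmorph_eq0 (ku_e ku).
have a0 : (0 < a)%N by case: a Qa {ku} => //; rewrite dvdn0.
have [i [j eij]] : exists i j, (i * a = j * Q + 1)%N.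
  have [km kn hk _] := egcdnP Q a0; exists km, kn.
  by rewrite hk; congr (_ + _)%N; apply/eqP; rewrite gcdnC -/(coprime Q a) prime_coprime.
exists (w ^+ i / t ^+ j), (e ^+ i), (b * i)%N; split.
- exact: ku_tr ku.
- rewrite expr_div_n -!exprM [(i * Q)%N]mulnC exprM (ku_eq ku) !exprMn -!exprM.
  rewrite [(a * i)%N]mulnC eij addn1 exprS expr1 rmorphXn.
  by field; rewrite expf_neq0.
- by rewrite expf_neq0 // (ku_e ku).
move=> S sS St Su; apply: (ku_gen ku) => //.
have -> : w = (w ^+ i / t ^+ j) ^+ a * t ^+ (j * a) / (iota e * t ^+ a * (1 - t) ^+ b) ^+ j.
  rewrite -(ku_eq ku) expr_div_n -!exprM eij exprD expr1 [(j * Q)%N]mulnC.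
  by field; rewrite !expf_neq0.
case: (sS) => [Sc SD SM SV].
apply: (SM); last first.
  apply: SV; apply: subfieldX => //; apply: (SM); last first.
    apply: subfieldX => //; apply: (SD); first by rewrite -(rmorph1 iota).
    by rewrite -mulN1r -(rmorphN1 iota); apply: SM.
  by apply: (SM) => //; apply: subfieldX.
by apply: (SM); apply: subfieldX.
Qed.

(** The changed function has value 1 and exponent 1 at [t], so its equation gives v(t) = Q; the
    original equation then gives v(w). *)
Lemma kummer_origin Q t w e a b : prime Q -> ~~ (Q %| a)%N ->
    kummer iota Q t w e a b ->
  exists v, [/\ places iota v, isdim iota (vge v 0) (vge v 1) 1, v t = Q%:Z, v w = a%:Z
    & forall v', places iota v' -> 0 < v' t -> v' = v].
Proof.
move=> prQ Qa ku; have [w' [e' [b' ku']]] := kummer_origin_change prQ Qa ku.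
have [v [pv vt vw dv]] := origin_exists1 prQ ku'.
have vs : v (1 - t) = 0.
  have [||_ ->] := @plD_dom _ _ _ v pv 1 (- t); rewrite ?oner_eq0 ?(pl1 pv) //.
  by right; rewrite (plN pv); lia.
have t0 := t_neq0 ku; have s0 := s_neq0 ku; have w0 := w_neq0 prQ ku.
have vQ w1 e1 a1 b1 : kummer iota Q t w1 e1 a1 b1 -> v w1 * Q%:Z = v t * a1%:Z.
  move=> ku1; have := congr1 v (ku_eq ku1); rewrite (plX pv).
  have e0 : iota e1 != 0 by rewrite fmorph_eq0 (ku_e ku1).
  by rewrite !(plM pv) ?mulf_neq0 ?expf_neq0 // (plC pv) !(plX pv) vs mul0r addr0 add0r.
have vtQ : v t = Q%:Z by have := vQ _ _ _ _ ku'; rewrite vw; lia.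
exists v; split=> //.
  have Qn0 : Q%:Z != 0 by rewrite eqz_nat -lt0n prime_gt0.
  by apply: (mulIf Qn0); rewrite (vQ _ _ _ _ ku) vtQ mulrC.
by move=> v' pv' vt'; apply: (origin_uniq1 prQ ku').
Qed.

End KummerOrigin.

Section KummerChange.
Variables (K F : fieldType) (iota : {rmorphism K -> F}).
Variables (Q : nat) (t w : F) (e : K) (a b : nat).
Hypotheses (prQ : prime Q) (ku : kummer iota Q t w e a b).

Lemma kummer_flip : kummer iota Q (1 - t) w e b a.
Proof.
split.
- apply/not_algebraic_transc => alg; apply: ((not_algebraic_transc iota t).2 (ku_tr ku)).
  rewrite -[t](subKr 1); apply: algebraic_sub => //; exact: algebraic1.
- by rewrite (subKr 1) (ku_eq ku) mulrAC.
- exact: ku_e ku.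
- move=> S sS S1t Sw; apply: (ku_gen ku) => //; case: sS => Sc SD SM _.
  rewrite -[t](subKr 1); apply: SD; first by rewrite -(rmorph1 iota).
  by rewrite -mulN1r -(rmorphN1 iota); apply: SM.
Qed.

(** By 1 - t = - t (1 - 1/t), the Q-th power of [w] contains t^(a+b). Dividing [w] by t^(a+b) leaves
    1/t with exponent Q (a+b) - (a+b), a natural number. *)
Lemma kummer_inv :
  kummer iota Q t^-1 (w / t ^+ (a + b)) ((-1) ^+ b * e) (Q.-1 * (a + b)) b.
Proof.
have t0 := t_neq0 ku; split.
- apply/not_algebraic_transc => alg; apply: ((not_algebraic_transc iota t).2 (ku_tr ku)).
  by rewrite -[t]invrK; apply: algebraic_inv.
- rewrite expr_div_n (ku_eq ku) rmorphM rmorphXn rmorphN1.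
  have -> : 1 - t^-1 = (-1) * ((1 - t) / t) by field.
  rewrite exprMn expr_div_n -exprM -[in LHS](prednK (prime_gt0 prQ)).
  rewrite [((a + b) * _)%N]mulnC mulSn exprD exprD exprVn.
  have s1 : (-1) ^+ b * (-1) ^+ b = 1 :> F by rewrite -expr2 sqrr_sign.
  transitivity (((-1) ^+ b * (-1) ^+ b) * (iota e * (1 - t) ^+ b) / (t ^+ b * t ^+ (Q.-1 * (a + b)))).
    by rewrite s1; field; rewrite !expf_neq0.
  by field; rewrite !expf_neq0.
- by rewrite mulf_neq0 ?signr_eq0 ?(ku_e ku).
- move=> S sS St Sw; have SX := fun x n => @subfieldX _ _ iota S x n sS.
  case: (sS) => Sc SD SM SV.
  have St' : S t by rewrite -[t]invrK; apply: SV.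
  apply: (ku_gen ku) => //.
  have -> : w = w / t ^+ (a + b) * t ^+ (a + b) by rewrite divfK ?expf_neq0.
  by apply: SM => //; apply: SX.
Qed.

Lemma kummer_one : ~~ (Q %| b)%N ->
  exists v, [/\ places iota v, isdim iota (vge v 0) (vge v 1) 1, v (1 - t) = Q%:Z, v w = b%:Z
    & forall v', places iota v' -> 0 < v' (1 - t) -> v' = v].
Proof. by move=> Qb; apply: kummer_origin kummer_flip. Qed.

Lemma kummer_infinity : ~~ (Q %| a + b)%N ->
  exists v, [/\ places iota v, isdim iota (vge v 0) (vge v 1) 1, v t = - Q%:Z,
    v w = - (a + b)%:Z & forall v', places iota v' -> v' t < 0 -> v' = v].
Proof.
move=> Qab.
have Qab' : ~~ (Q %| Q.-1 * (a + b))%N.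
  rewrite Euclid_dvdM // (negPf Qab) orbF gtnNdvd //; first by case: Q prQ => [|[]].
  by rewrite ltn_predL prime_gt0.
have [v [pv dv vt vw uniq]] := kummer_origin prQ Qab' kummer_inv.
have t0 := t_neq0 ku; have w0 := w_neq0 prQ ku.
have {}vt : v t = - Q%:Z by rewrite -[t]invrK (plV pv) vt.
exists v; split=> //.
  move: vw; rewrite (plM pv) ?invr_eq0 ?expf_neq0 // (plV pv) (plX pv) vt.
  by rewrite -{2}(prednK (prime_gt0 prQ)); lia.
by move=> v' pv' vt'; apply: uniq => //; rewrite (plV pv'); lia.
Qed.

End KummerChange.

(** * Places over an irreducible polynomial *)

Section IrreduciblePolynomials.
Variable K : fieldType.

Lemma irredp_dvdM (pi f g : {poly K}) : irreducible_poly pi ->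
  pi %| f * g -> (pi %| f) || (pi %| g).
Proof.
move=> irr h; have [//|nf] := boolP (pi %| f) => /=.
suff co : coprimep pi f by rewrite Gauss_dvdpr in h.
rewrite /coprimep; apply/negPn/negP => sz.
have := irr.2 _ sz (dvdp_gcdl _ _) => eqg.
by move: nf; rewrite -(eqp_dvdl _ eqg) dvdp_gcdr.
Qed.

Lemma irredp_coprime (pi f : {poly K}) : irreducible_poly pi -> ~~ (pi %| f) -> coprimep pi f.
Proof.
move=> irr nf; rewrite /coprimep; apply/negPn/negP => sz.
have := irr.2 _ sz (dvdp_gcdl _ _) => eqg.
by move: nf; rewrite -(eqp_dvdl _ eqg) dvdp_gcdr.
Qed.

Lemma irredp_dvdX (pi f : {poly K}) n : irreducible_poly pi -> pi %| f ^+ n -> pi %| f.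
Proof.
move=> irr; elim: n => [|n IHn]; last by rewrite exprS => /(irredp_dvdM irr)/orP[].
by rewrite expr0 dvdp1 => /eqP sz; move: irr.1; rewrite sz.
Qed.

Lemma irredp_split (pi h : {poly K}) : irreducible_poly pi -> h != 0 ->
  exists k g, ~~ (pi %| g) /\ h = pi ^+ k * g.
Proof.
move=> irr; have [n] := ubnP (size h); elim: n h => // n IHn h; rewrite ltnS => szh h0.
have [/dvdpP[g eh]|nd] := boolP (pi %| h); last by exists 0%N, h; rewrite expr0 mul1r.
have g0 : g != 0 by apply: contra h0 => /eqP g0; rewrite eh g0 mul0r.
have szg : (size g < n)%N.
  have pi0 := irredp_neq0 irr; apply: leq_trans szh; rewrite eh size_mul //.
  by have := irr.1; case: (size pi) => [|[|k]] // _; rewrite !addnS ltnS leq_addr.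
have [k [g' [ng' eg]]] := IHn g szg g0.
by exists k.+1, g'; split=> //; rewrite eh eg exprSr mulrAC.
Qed.

Lemma irreducible_factor (h : {poly K}) : (1 < size h)%N ->
  exists2 pi : {poly K}, irreducible_poly pi & pi %| h.
Proof.
have [n] := ubnP (size h); elim: n h => // n IHn h; rewrite ltnS => szh h1.
case: (pselect (irreducible_poly h)) => [irr|nirr]; first by exists h.
have [g [g1 gh ngh]] : exists g : {poly K}, [/\ size g != 1, g %| h & ~~ (g %= h)].
  apply: contrapT => H; apply: nirr; split=> // g g1 gh; apply/negPn/negP => ngh.
  by apply: H; exists g.
have h0 : h != 0 by rewrite -size_poly_gt0 ltnW.
have g0 : g != 0 by apply: contraTneq gh => ->; rewrite dvd0p.
have [|//|pi irr pig] := IHn g.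
- apply: leq_trans szh; rewrite ltn_neqAle dvdp_leq // andbT.
  by apply: contra ngh => /eqP sz; rewrite -dvdp_size_eqp // sz.
- by move: g1 g0; rewrite -size_poly_gt0; case: (size g) => [|[]].
by exists pi => //; apply: dvdp_trans gh.
Qed.

End IrreduciblePolynomials.

(** * Periodicity of Frobenius modulo a polynomial *)

Section Frobenius.
Variables (K : finFieldType).
Local Notation q := #|K|.

(** Pigeonhole: there are finitely many remainders modulo [p]. *)
Lemma poly_frob_period (p : {poly K}) : p != 0 ->
  exists i j : nat, (i < j)%N /\ (p %| 'X^(q ^ j) - 'X^(q ^ i)).
Proof.
move=> p0; pose n := #|{ffun 'I_(size p) -> K}|.
pose f (i : 'I_n.+1) : {ffun 'I_(size p) -> K} := [ffun j : 'I__ => ('X^(q ^ i) %% p)`_j].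
have : ~~ injectiveb f.
  by apply/injectiveP => /leq_card; rewrite card_ord ltnn.
case/injectivePn => i [j ij eij].
wlog lt_ij : i j ij eij / (i < j)%N.
  move=> H; have : (i != j :> nat) by [].
  by rewrite neq_ltn => /orP[] h; [apply: (H i j)|apply: (H j i) => //; rewrite eq_sym].
exists i, j; split=> //; rewrite /dvdp modpD modpN subr_eq0; apply/eqP/polyP => k.
have [lt_k|le_k] := ltnP k (size p).
  by have /ffunP/(_ (Ordinal lt_k)) := eij; rewrite !ffunE.
by rewrite !nth_default // (leq_trans _ le_k) // ltnW // ltn_modpN0.
Qed.

Lemma pchar_poly_nat n : [pchar K].-nat n -> [pchar {poly K}].-nat n.
Proof. by apply: sub_in_pnat => p _; rewrite pchar_poly. Qed.

Section Period.
Hypothesis pcK : [pchar K].-nat q.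

Let pcX k : [pchar {poly K}].-nat (q ^ k)%N.
Proof. by apply: pchar_poly_nat; rewrite pnatX pcK. Qed.

(** X^(q^j) - X^(q^i) is the q^i-th power of X^(q^(j-i)) - X in this characteristic, so the
    irreducible [pi] divides the latter; additivity and the Frobenius-fixed constants extend this
    from X to every [f]. *)
Lemma frob_period_irr (pi : {poly K}) : irreducible_poly pi ->
  exists k : nat, (0 < k)%N /\ forall f, pi %| f ^+ (q ^ k) - f.
Proof.
move=> irr; have [i [j [lt_ij h]]] := poly_frob_period (irredp_neq0 irr).
exists (j - i)%N; rewrite subn_gt0; split=> //.
have hX : pi %| 'X ^+ (q ^ (j - i)) - 'X.
  apply: (irredp_dvdX (n := (q ^ i)%N) irr).
  rewrite exprDn_pchar // exprNn_pchar //.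
  by rewrite -exprM -expnD subnK // ltnW.
have pC c : (c%:P : {poly K}) ^+ (q ^ (j - i)) = c%:P.
  rewrite -rmorphXn; congr (_%:P).
  by elim: (j - i)%N => [|k IHk]; rewrite ?expn0 ?expr1 // expnSr exprM IHk expf_card.
move=> f; elim/poly_ind: f => [|f c IHf].
  by rewrite subr0 expr0n expn_eq0 -[_ == 0%N]negbK -lt0n (ltnW (finNzRing_gt1 K)) dvdp0.
rewrite exprDn_pchar // pC exprMn.
have -> : f ^+ (q ^ (j - i)) * 'X ^+ (q ^ (j - i)) + c%:P - (f * 'X + c%:P) =
  (f ^+ (q ^ (j - i)) - f) * 'X ^+ (q ^ (j - i)) + f * ('X ^+ (q ^ (j - i)) - 'X) by ring.
by apply: dvdp_add; [exact: dvdp_mulr|exact: dvdp_mull].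
Qed.

End Period.
End Frobenius.

Section PlacesOverPi.
Variables (K : finFieldType) (F : fieldType) (iota : {rmorphism K -> F}).
Local Notation evp := (peval iota).
Local Notation ev2 := (peval2 iota).
Local Notation q := #|K|.
Variables (Q : nat) (t w : F) (e : K) (a b : nat).
Hypotheses (prQ : prime Q) (Qa : ~~ (Q %| a)%N) (ku : kummer iota Q t w e a b).
Hypotheses (pcK : [pchar K].-nat q) (coQq : coprime q Q).

Local Notation kR := (kR iota t w).
Local Notation G := (kG e a b).

Section Pi.
Variables (pi : {poly K}).
Hypotheses (irr : irreducible_poly pi) (piG : ~~ (pi %| G)).

Definition kpiR : set F := [set x | exists2 y, kR y & x = evp t pi * y].

Let pi0 : evp t pi != 0. Proof. by apply: (evp_neq0 ku); exact: irredp_neq0. Qed.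

Lemma kpiR_sub : kpiR `<=` kR.
Proof. by move=> _ [y Ry ->]; apply: kR_M => //; exact: kR_evp. Qed.
Lemma kpiR_D x y : kpiR x -> kpiR y -> kpiR (x + y).
Proof. by move=> [x' Rx ->] [y' Ry ->]; exists (x' + y'); rewrite ?mulrDr //; exact: kR_D. Qed.
Lemma kpiR_M x y : kR x -> kpiR y -> kpiR (x * y).
Proof. by move=> Rx [y' Ry ->]; exists (x * y'); [exact: kR_M|rewrite mulrCA]. Qed.
Lemma kpiR_Mr x y : kpiR x -> kR y -> kpiR (x * y).
Proof. by move=> *; rewrite mulrC; exact: kpiR_M. Qed.
Lemma kpiR_dvd f : pi %| f -> kpiR (evp t f).
Proof. by move=> /dvdpP[g ->]; exists (evp t g); [exact: kR_evp|rewrite evpM mulrC]. Qed.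
Lemma kpiR_pi : kpiR (evp t pi). Proof. exact: kpiR_dvd. Qed.

Let Q_gt0 : (0 < Q)%N := prime_gt0 prQ.
Let q_gt1 : (1 < q)%N := finNzRing_gt1 K.

(* K[t, w] is reduced and finite modulo pi, so a Frobenius power acts trivially. *)
Lemma kR_frob : exists2 N : nat, (1 < N)%N & forall x, kR x -> kpiR (x ^+ N - x).
Proof.
have [k [k0 hk]] := frob_period_irr pcK irr; set r := (q ^ k)%N in hk.
have r1 : (1 < r)%N by rewrite -(exp1n k) ltn_exp2r.
(* By Euler, Q (r - 1) divides r^m - 1, so w^(r^m - 1) is a power of G^(r-1), which is 1 modulo [pi]
   since [pi] does not divide G. *)
pose m := totient (Q * r.-1); have cop : coprime r (Q * r.-1).
  by rewrite coprimeMr /r coprimeXl //= coprimenP // ltnW.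
have m0 : (0 < m)%N by rewrite totient_gt0 muln_gt0 Q_gt0 -subn1 subn_gt0.
have dvN : (Q * r.-1 %| (r ^ m).-1)%N.
  have := Euler_exp_totient cop => /eqP; rewrite eqn_mod_dvd ?subn1 //.
  by rewrite expn_gt0 ltnW.
have frk f j : pi %| f ^+ (r ^ j) - f.
  elim: j => [|j IHj]; first by rewrite expn0 expr1 subrr dvdp0.
  have -> : f ^+ (r ^ j.+1) - f = ((f ^+ (r ^ j)) ^+ r - f ^+ (r ^ j)) + (f ^+ (r ^ j) - f).
    by rewrite expnSr exprM addrA subrK.
  by apply: dvdp_add.
have pcF n : [pchar F].-nat (q ^ n)%N.
  by rewrite pnatX; apply/orP; left; apply: sub_in_pnat pcK => p _; exact: rmorph_pchar.
have rm : (r ^ m = q ^ (k * m))%N by rewrite /r expnM.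
have Gr : pi %| G ^+ r.-1 - 1.
  have : pi %| G * (G ^+ r.-1 - 1) by rewrite mulrBr mulr1 -exprS prednK // ltnW.
  by move/(irredp_dvdM irr); rewrite (negPf piG).
exists (r ^ m)%N; first by rewrite -(exp1n m) ltn_exp2r.
have hD x y : kpiR (x ^+ (r ^ m) - x) -> kpiR (y ^+ (r ^ m) - y) ->
    kpiR ((x + y) ^+ (r ^ m) - (x + y)).
  move=> hx hy; rewrite exprDn_pchar ?rm // -rm.
  have -> : x ^+ (r ^ m) + y ^+ (r ^ m) - (x + y) = (x ^+ (r ^ m) - x) + (y ^+ (r ^ m) - y) by ring.
  exact: kpiR_D.
have hM x y : kR x -> kR y -> kpiR (x ^+ (r ^ m) - x) -> kpiR (y ^+ (r ^ m) - y) ->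
    kpiR ((x * y) ^+ (r ^ m) - (x * y)).
  move=> Rx Ry hx hy; rewrite exprMn.
  have -> : x ^+ (r ^ m) * y ^+ (r ^ m) - x * y =
     (x ^+ (r ^ m) - x) * y ^+ (r ^ m) + x * (y ^+ (r ^ m) - y) by ring.
  by apply: kpiR_D; [apply: kpiR_Mr => //; exact: kR_X|exact: kpiR_M].
have hf f : kpiR (evp t f ^+ (r ^ m) - evp t f).
  by rewrite -evpXn -evpB; apply: kpiR_dvd.
have hw : kpiR (w ^+ (r ^ m) - w).
  have rm0 : (0 < r ^ m)%N by rewrite expn_gt0 ltnW.
  have /dvdnP[d ed] := dvN.
  rewrite -(prednK rm0) exprS ed mulrC; have -> : (d * (Q * r.-1) = Q * (r.-1 * d))%N by lia.
  rewrite exprM -(ev_kG ku) -evpXn -{2}[w]mul1r -mulrBl -(evp1 iota t) -evpB.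
  apply: kpiR_Mr; last exact: kR_w.
  apply: kpiR_dvd; rewrite exprM -[X in _ - X](expr1n _ d) subrXX.
  by rewrite dvdp_mulr.
move=> _ [P ->]; elim/poly_ind: P => [|P c IHP].
  by rewrite -evpC0 || rewrite ev20 -(evp0 iota t).
rewrite ev2D ev2M ev2X ev2C; apply: hD => //; apply: hM => //; [exact: kR_ev|exact: kR_w].
Qed.

Lemma kR_prime_out M x : prime_ideal_of kR M -> M (evp t pi) -> kR x -> kpiR x -> M x.
Proof. by move=> pRM Mpi _ [y Ry ->]; rewrite mulrC; apply: (pi_I pRM). Qed.

Lemma evp_outside M f : prime_ideal_of kR M -> M (evp t pi) -> ~~ (pi %| f) ->
  outside kR M (evp t f).
Proof.
move=> pRM Mpi nf; split; [exact: kR_evp|move=> Mf].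
have [[u1 u2] /= /eqpP[[c1 c2] /= /andP[c10 c20] eu]] := Bezout_coprimepP _ _ (irredp_coprime irr nf).
apply: (pi_n1 pRM).
have -> : 1 = evp t (c2^-1 *: (c1 *: (u1 * pi + u2 * f))).
  by rewrite eu scalerA mulVf // scale1r evp1.
rewrite !evpZ evpD !evpM; apply: (pi_I pRM); first exact: kR_C.
apply: (pi_I pRM); first exact: kR_C.
by apply: (pi_D pRM); apply: (pi_I pRM) => //; exact: kR_evp.
Qed.

(** For [m] in [M], the product (m^(N-1) - 1) m is a multiple of [pi] and its first factor lies
    outside [M]: there is no ramification over [pi]. *)
Lemma over_pi_param M : prime_ideal_of kR M -> M (evp t pi) -> local_param kR M (evp t pi).
Proof.
move=> pRM Mpi; have [N N1 hN] := kR_frob.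
apply: (local_param_intro pRM) => //.
  move=> m Mm; have Rm := pi_sub pRM Mm.
  have [y Ry ey] := hN _ Rm; exists (m ^+ N.-1 - 1), y; split=> //.
    split=> [|h]; first by apply: kR_B; [exact: kR_X|exact: kR_1].
    apply: (pi_n1 pRM); have -> : 1 = m ^+ N.-1 + (-1) * (m ^+ N.-1 - 1) by ring.
    apply: (pi_D pRM).
      move: N1 {hN ey h}; case: N => [|[|N]] //= _; rewrite exprS mulrC.
      by apply: (pi_I pRM) => //; exact: kR_X.
    by apply: (pi_I pRM) => //; rewrite -(rmorphN1 iota); exact: kR_C.
  by rewrite -ey mulrBl mul1r -exprSr prednK // ltnW.
move=> _ [P ->] /(ku_norm prQ Qa ku)[P' [h [h0 eh]]].
have [k [g [ng eg]]] := irredp_split irr h0.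
exists (ev2 t w P'), k, 1, (evp t g); split.
- exact: kR_ev.
- exact: outside1 pRM.
- exact: evp_outside.
- by rewrite mul1r eh eg evpM evpXn.
Qed.

Section Over.
Variables (v : F -> int) (pv : places iota v) (vpi : 0 < v (evp t pi)).

Lemma over_pi_vt : 0 <= v t.
Proof.
rewrite leNgt; apply/negP => vt; have := vpi.
by rewrite (evp_val_neg ku pv vt (irredp_neq0 irr)) ltNge mulr_le0_ge0 // ltW.
Qed.

Let vR : kR `<=` vge v 0.
Proof. by move=> x; apply: (kR_vge prQ ku pv); exact: over_pi_vt. Qed.

Definition centre : set F := [set x | kR x /\ vge v 1 x].

Lemma centre_prime : prime_ideal_of kR centre.
Proof.
split.
- exact: kR_1.
- exact: kR_B.
- exact: kR_M.
- exact: kR_frac prQ Qa ku.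
- by move=> x [].
- by move=> x y [Rx vx] [Ry vy]; split; [exact: kR_D|exact: (vgeD pv)].
- move=> x y Rx [Ry vy]; split; first exact: kR_M.
  by rewrite -[1]add0r; apply: (vgeM pv) => //; exact: vR.
- by move=> [_ /(vgeP (oner_neq0 F))]; rewrite (pl1 pv).
- move=> x y Rx Ry [_ vxy].
  have [->|x0] := eqVneq x 0; first by left; split; [rewrite -(evp0 iota t); exact: kR_evp|left].
  have [->|y0] := eqVneq y 0; first by right; split; [rewrite -(evp0 iota t); exact: kR_evp|left].
  have := vgeP (mulf_neq0 x0 y0) vxy; rewrite (plM pv) // => h.
  have := vgeP x0 (vR Rx); have := vgeP y0 (vR Ry) => h1 h2.
  have [hx|hx] := ltP 0 (v x); [left|right]; split=> //; right; lia.
Qed.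

Lemma centre_pi : centre (evp t pi).
Proof. by split; [exact: kR_evp|right; lia]. Qed.

Lemma centre_out x : outside kR centre x -> v x = 0.
Proof.
move=> [Rx nx]; have [x0|x0] := eqVneq x 0; first by rewrite x0 (pl0 pv).
have := vgeP x0 (vR Rx) => h; apply/eqP/negPn/negP => vx; apply: nx; split=> //; right; lia.
Qed.

Lemma over_pi_val : v (evp t pi) = 1.
Proof. exact: (local_place_param centre_prime (over_pi_param centre_prime centre_pi) pv centre_out). Qed.

(** x / y is congruent to x y^(N-2), because y^N - y is divisible by [pi]; so K[t, w] already maps
    onto the residue field. *)
Lemma over_pi_residue z : vge v 0 z -> exists2 r, kR r & vge v 1 (z - r).
Proof.
move=> vz; have [z0|z0] := eqVneq z 0.
  by exists 0; [rewrite -(evp0 iota t); exact: kR_evp|rewrite z0 subr0; left].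
have pRM := centre_prime; have lp := over_pi_param pRM centre_pi.
have [k [x [y [Dx Dy ez]]]] := local_decomp pRM lp z0.
have vzk : v z = k.
  by rewrite ez (local_place_val pRM lp _ pv) ?over_pi_val ?mulr1 //; exact: centre_out.
have k0 : 0 <= k by rewrite -vzk (vgeP z0 vz).
have [k1|k1] := ltP 0 k.
  exists 0; [rewrite -(evp0 iota t); exact: kR_evp|rewrite subr0; right; lia].
have {k0 k1} k0 : k = 0 by lia.
have [N N1 hN] := kR_frob; have y0 : y != 0 := outside_neq0 pRM centre_pi Dy.
case: (Dx) (Dy) => [Rx _] [Ry _].
exists (x * y ^+ N.-2); first by apply: kR_M => //; exact: kR_X.
have -> : z - x * y ^+ N.-2 = - (x * (y ^+ N - y)) / y ^+ 2.
  rewrite ez k0 expr0z mul1r; move: N1; case: N {hN} => [|[|N]] //= _; rewrite !exprS.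
  by field.
rewrite -[1]addr0; apply: (vgeM pv).
  apply: (vgeN pv); rewrite -[1]add0r; apply: (vgeM pv); first exact: vR.
  have [r Rr ->] := hN _ Ry; rewrite -[1]addr0; apply: (vgeM pv); last exact: vR.
  by right; rewrite over_pi_val.
by right; rewrite (plV pv) (plX pv) (centre_out Dy).
Qed.

End Over.

(** Primes over [pi] are maximal: each contains x (x^(N-1) - 1), so an [x] in the larger centre but
    not in the smaller would put both x^(N-1) and x^(N-1) - 1 into the larger one. *)
Lemma centre_sub v v' : places iota v -> places iota v' ->
    0 < v (evp t pi) -> 0 < v' (evp t pi) -> centre v `<=` centre v' -> v = v'.
Proof.
move=> pv pv' vpi vpi' sub.
have pRM := centre_prime pv vpi; have pRM' := centre_prime pv' vpi'.
have [N N1 hN] := kR_frob.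
have sub' : centre v' `<=` centre v.
  move=> x [Rx vx]; apply: contrapT => nx.
  have := kR_prime_out pRM (centre_pi vpi) _ (hN _ Rx).
  have -> : x ^+ N - x = x * (x ^+ N.-1 - 1).
    by rewrite mulrBr mulr1 -exprS prednK // ltnW.
  have Rx1 : kR (x ^+ N.-1 - 1) by apply: kR_B; [exact: kR_X|exact: kR_1].
  move=> /(_ (kR_M Rx Rx1)) /(pi_prime pRM Rx Rx1)[//|/sub hx].
  apply: (pi_n1 pRM').
  have -> : 1 = x ^+ N.-1 + (-1) * (x ^+ N.-1 - 1) by ring.
  apply: (pi_D pRM').
    move: N1 {hN hx Rx1}; case: N => [|[|N]] //= _; rewrite exprS mulrC.
    by apply: (pi_I pRM') => //; exact: kR_X.
  by apply: (pi_I pRM') => //; rewrite -(rmorphN1 iota); exact: kR_C.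
apply: (local_place_uniq pRM (over_pi_param pRM (centre_pi vpi)) pv pv') => //.
  exact: centre_out.
move=> x [Rx nx]; apply: centre_out => //; split=> // /sub'//.
Qed.

End Pi.
End PlacesOverPi.

(** * Degrees of the places over an irreducible polynomial *)

Section PlacesOverPiDegrees.
Variables (K : finFieldType) (F : fieldType) (iota : {rmorphism K -> F}).
Local Notation evp := (peval iota).
Local Notation ev2 := (peval2 iota).
Local Notation q := #|K|.
Variables (Q : nat) (t w : F) (e : K) (a b : nat).
Hypotheses (prQ : prime Q) (Qa : ~~ (Q %| a)%N) (ku : kummer iota Q t w e a b).
Hypotheses (pcK : [pchar K].-nat q) (coQq : coprime q Q).
Variables (pi : {poly K}).
Hypotheses (irr : irreducible_poly pi) (piG : ~~ (pi %| kG e a b)).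

Local Notation kR := (kR iota t w).
Local Notation kpiR := (kpiR iota t w pi).

Let frob := kR_frob prQ Qa ku pcK coQq irr piG.

(** Modulo [pi], [x] equals its powers of exponent N^k, and N^n is at least n. *)
Lemma kpiR_radical x n : kR x -> kpiR (x ^+ n) -> kpiR x.
Proof.
move=> Rx; have [N N1 hN] := frob.
have hk k : kpiR (x ^+ (N ^ k) - x).
  elim: k => [|k IHk].
    by rewrite expn0 expr1 subrr; exists 0; rewrite ?mulr0 // -(evp0 iota t); exact: kR_evp.
  have -> : x ^+ (N ^ k.+1) - x = ((x ^+ (N ^ k)) ^+ N - x ^+ (N ^ k)) + (x ^+ (N ^ k) - x).
    by rewrite expnSr exprM addrA subrK.
  by apply: kpiR_D => //; apply: hN; exact: kR_X.
move=> hn; have ltn : (n <= N ^ n)%N by apply: ltnW; exact: ltn_expl.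
have -> : x = x ^+ (N ^ n) + (-1) * (x ^+ (N ^ n) - x) by ring.
apply: kpiR_D; last by apply: kpiR_M => //; rewrite -(rmorphN1 iota); exact: kR_C.
by rewrite -(subnK ltn) exprD; apply: kpiR_M => //; exact: kR_X.
Qed.

Lemma prime_avoiding z : kR z -> ~ kpiR z ->
  exists M, [/\ prime_ideal_of kR M, M (evp t pi) & ~ M z].
Proof.
move=> Rz nz.
(* Zorn on ideals containing [pi] and no power of [z]. Membership of [pi] is asked only of nonempty
   [J], so that the union of the empty chain satisfies [P]; a maximal set does contain [pi], since
   otherwise it would be empty and [kpiR] larger. *)
pose P (J : set F) := [/\ J `<=` kR, forall x y, J x -> J y -> J (x + y),
  forall x y, kR x -> J y -> J (x * y), forall x, J x -> J (evp t pi) & forall n, ~ J (z ^+ n)].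
have [|A [[AR AD AM Api Az] Amax]] := @Zorn_bigcup F P.
  move=> C CP tot; split.
  - by move=> x [J /CP[JR _ _ _ _]]; exact: JR.
  - move=> x y [J CJ Jx] [J' CJ' J'y].
    have [sub|sub] := tot _ _ CJ CJ'.
      by exists J' => //; have [_ + _ _ _] := CP _ CJ'; apply => //; apply: sub.
    by exists J => //; have [_ + _ _ _] := CP _ CJ; apply => //; apply: sub.
  - move=> x y Rx [J CJ Jy]; exists J => //.
    by have [_ _ + _ _] := CP _ CJ; apply.
  - move=> x [J CJ Jx]; exists J => //.
    by have [_ _ _ + _] := CP _ CJ; apply; exact: Jx.
  - move=> n [J CJ Jz]; have [_ _ _ _] := CP _ CJ; apply; exact: Jz.
have PpiR : P kpiR.
  split; [exact: kpiR_sub|exact: kpiR_D|exact: kpiR_M|by move=> *; exact: kpiR_pi|].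
  by move=> n /(kpiR_radical Rz).
have Ap : A (evp t pi).
  apply: contrapT => nA; apply: (Amax _ _ PpiR); split.
    by move=> x /Api.
  by move=> h; apply: nA; apply: h; exact: kpiR_pi.
have A0 : A 0 by rewrite -(mul0r (evp t pi)); apply: AM => //; rewrite -(evp0 iota t); exact: kR_evp.
have R0 : kR 0 by exact: AR.
have ext x : kR x -> ~ A x -> exists n r, kR r /\ A (z ^+ n - r * x).
  move=> Rx nAx; apply: contrapT => H.
  pose B : set F := [set y | exists u r, [/\ A u, kR r & y = u + r * x]].
  apply: (Amax B); last split.
  - split.
    + move=> y Ay; exists y, 0; split=> //; first by rewrite mul0r addr0.
    + move=> BA; apply: nAx; apply: BA; exists 0, 1; split=> //; first exact: kR_1.
      by rewrite mul1r add0r.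
  - by move=> _ [u [r [Au Rr ->]]]; apply: kR_D; [exact: AR|exact: kR_M].
  - move=> _ _ [u [r [Au Rr ->]]] [u' [r' [Au' Rr' ->]]]; exists (u + u'), (r + r').
    by split; [exact: AD|exact: kR_D|ring].
  - move=> y _ Ry [u [r [Au Rr ->]]]; exists (y * u), (y * r).
    by split; [exact: AM|exact: kR_M|ring].
  - move=> _ _; exists (evp t pi), 0; split=> //; by rewrite mul0r addr0.
  - move=> n [u [r [Au Rr ez]]]; apply: H; exists n, r; split=> //.
    by rewrite ez addrK.
exists A; split=> //; last by have := Az 1%N; rewrite expr1.
split=> //.
- exact: kR_1.
- exact: kR_B.
- exact: kR_M.
- exact: kR_frac prQ Qa ku.
- by have := Az 0%N; rewrite expr0.
move=> x y Rx Ry Axy; apply: contrapT => /not_orP[nx ny].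
have [n [r [Rr Ar]]] := ext x Rx nx; have [m [s [Rs As]]] := ext y Ry ny.
apply: (Az (n + m)%N).
have -> : z ^+ (n + m) = z ^+ m * (z ^+ n - r * x) + (r * x) * (z ^+ m - s * y) + (r * s) * (x * y).
  by rewrite exprD; ring.
apply: (AD); [apply: (AD)|]; apply: AM => //; [exact: kR_X|exact: kR_M|exact: kR_M].
Qed.

Lemma place_avoiding z : kR z -> ~ kpiR z ->
  exists v, [/\ places iota v, 0 < v (evp t pi) & v z = 0].
Proof.
move=> Rz nz; have [M [pRM Mpi nMz]] := prime_avoiding Rz nz.
have lp := over_pi_param prQ Qa ku pcK coQq irr piG pRM Mpi.
have [v [pv vpi vO vM]] := local_place pRM lp (kR_C iota t w).
by exists v; split=> //; [rewrite vpi|exact: vO].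
Qed.

Let over v := places iota v /\ 0 < v (evp t pi).

Let Q_gt0 : (0 < Q)%N := prime_gt0 prQ.

(** The family is t^j w^i with j < deg pi and i < Q: higher powers of [w] reduce by the equation,
    and the coefficients reduce modulo [pi]. *)
Lemma kR_mod_span : exists bb : 'I_(Q * (size pi).-1) -> F,
  forall z, kR z -> exists c : 'I_(Q * (size pi).-1) -> K,
    kpiR (z - \sum_(i < Q * (size pi).-1) iota (c i) * bb i).
Proof.
set d := (size pi).-1.
pose B : 'M[F]_(Q, d) := \matrix_(i, j) (t ^+ j * w ^+ i).
exists (fun k => mxvec B 0 k) => _ [P ->]; have [P' sz ->] := ku_reduce prQ ku P.
have d0 : (0 < d)%N by rewrite /d; have := irr.1; case: (size pi) => [|[]].
pose C : 'M[K]_(Q, d) := \matrix_(i, j) (P'`_i %% pi)`_j.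
exists (fun k => mxvec C 0 k).
have -> : \sum_(k < Q * d) iota (mxvec C 0 k) * mxvec B 0 k =
   \sum_(i < Q) evp t (P'`_i %% pi) * w ^+ i.
  transitivity (\sum_i \sum_j iota (mxvec C 0 (mxvec_index i j)) * mxvec B 0 (mxvec_index i j)).
    by rewrite pair_bigA /= (reindex _ (curry_mxvec_bij Q d)) /=; apply: eq_bigr => -[].
  apply: eq_bigr => i _; rewrite (evp_sum iota t (n := d)); last first.
    by rewrite -ltnS prednK ?ltn_modpN0 ?irredp_neq0 // ltnW // irr.1.
  rewrite mulr_suml; apply: eq_bigr => j _.
  by rewrite !mxvecE [C _ _]mxE [B _ _]mxE mulrA.
rewrite (ev2_sum _ _ _ sz) -sumrB; elim/big_ind: _ => [|x y|i _].
- by exists 0; rewrite ?mulr0 // -(evp0 iota t); exact: kR_evp.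
- exact: kpiR_D.
rewrite -mulrBl -evpB; apply: kpiR_Mr; last by apply: kR_X; exact: kR_w.
by apply: kpiR_dvd; rewrite {1}(divp_eq P'`_i pi) addrK dvdp_mull.
Qed.

(** Finiteness holds because the residue field is a quotient of K[t, w] / pi. Positivity has content
    too, [place_degree] being 0 for an infinite residue extension. *)
Lemma over_isdim v : over v ->
  isdim iota (vge v 0) (vge v 1) (place_degree iota v) /\ (0 < place_degree iota v)%N.
Proof.
move=> [pv vpi]; have [bb hbb] := kR_mod_span.
have vpiR : kpiR `<=` vge v 1.
  move=> _ [y Ry ->]; rewrite -[1]addr0; apply: (vgeM pv); first by right; lia.
  by apply: (kR_vge prQ ku pv _ Ry); exact: (over_pi_vt ku irr pv vpi).
have [d _ hd] : exists2 d, (d <= Q * (size pi).-1)%N & isdim iota (vge v 0) (vge v 1) d.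
  apply: free_bound_isdim; first exact: subspace_vge.
  move=> d bv Vb fb; apply: (free_le_span _ Vb fb (b' := bb)); first exact: subspace_vge.
  move=> z /(over_pi_residue prQ Qa ku pcK coQq irr piG pv vpi)[r Rr zr].
  have [c hc] := hbb _ Rr; exists c.
  by rewrite -(subrK r z) -addrA; apply: (vgeD pv) => //; exact: vpiR.
rewrite (place_isdim pv hd); split=> //.
case: d hd => // -[bv [_ _ /(_ 1)]].
have : vge v 0 1 by right; rewrite (pl1 pv).
move=> h /(_ h)[c]; rewrite big_ord0 subr0 => /(vgeP (oner_neq0 F)).
by rewrite (pl1 pv).
Qed.

Lemma over_separate v (S : seq (F -> int)) : over v -> (forall v', v' \in S -> over v') ->
    v \notin S ->
  exists x, [/\ kR x, vge v 1 (x - 1) & forall v', v' \in S -> vge v' 1 x].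
Proof.
move=> ov; have [pv vpi] := ov; elim: S => [|v' S IHS] oS vS.
  by exists 1; split=> //; [exact: kR_1|rewrite subrr; left].
have [||x [Rx vx Sx]] := IHS.
- by move=> v'' h; apply: oS; rewrite inE h orbT.
- by apply: contra vS; rewrite inE orbC => ->.
have [pv' vpi'] : over v' by apply: oS; rewrite mem_head.
have [y cy ny] : exists2 y, centre iota t w v' y & ~ centre iota t w v y.
  apply: contrapT => H; move: vS; rewrite inE => /norP[/eqP + _]; apply.
  apply/esym/(centre_sub prQ Qa ku pcK coQq irr piG pv' pv vpi' vpi) => y cy.
  by apply: contrapT => ny; apply: H; exists y.
have [N N1 hN] := frob; have [Ry vy] := cy.
have vR' := kR_vge prQ ku pv' (over_pi_vt ku irr pv' vpi').
have vR := kR_vge prQ ku pv (over_pi_vt ku irr pv vpi).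
have yN : vge v' 1 (y ^+ N.-1).
  move: N1 {hN}; case: N => [|[|N]] //= _; rewrite exprS -[1]addr0; apply: (vgeM pv') => //.
  by apply: vR'; exact: kR_X.
have RyN : kR (y ^+ N.-1) by exact: kR_X.
have yN1 : vge v 1 (y ^+ N.-1 - 1).
  have pRM := centre_prime prQ Qa ku pcK coQq irr piG pv vpi.
  have RyN1 : kR (y ^+ N.-1 - 1) by apply: kR_B => //; exact: kR_1.
  have : centre iota t w v (y * (y ^+ N.-1 - 1)).
    rewrite mulrBr mulr1 -exprS prednK; last exact: ltnW.
    by apply: (kR_prime_out pRM (centre_pi prQ Qa ku pcK coQq irr piG vpi)); [apply: kR_B => //;
      exact: kR_X|exact: hN].
  by case/(pi_prime pRM Ry RyN1) => [//|[]].
exists (x * y ^+ N.-1); split; first exact: kR_M.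
  have -> : x * y ^+ N.-1 - 1 = (x - 1) * y ^+ N.-1 + (y ^+ N.-1 - 1) by ring.
  by apply: (vgeD pv) => //; rewrite -[1]addr0; apply: (vgeM pv) => //; exact: vR.
move=> v''; rewrite inE => /orP[/eqP->|v''S].
  by rewrite -[1]add0r; apply: (vgeM pv') => //; exact: vR'.
have [pv'' vpi''] : over v'' by apply: oS; rewrite inE v''S orbT.
rewrite -[1]addr0; apply: (vgeM pv''); first exact: Sx.
exact: (kR_vge prQ ku pv'' (over_pi_vt ku irr pv'' vpi'')).
Qed.

(** Chinese remainder: the vectors added for a new place are representatives of its residues,
    multiplied by a function that is 1 there and 0 at the places already treated. *)
Lemma over_isdim_seq (S : seq (F -> int)) : uniq S -> (forall v, v \in S -> over v) ->
  isdim iota kR [set x | kR x /\ forall v, v \in S -> vge v 1 x]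
    (\sum_(v <- S) place_degree iota v).
Proof.
have sR : subspace iota kR.
  split; first by rewrite -(evp0 iota t); exact: kR_evp.
    exact: kR_D.
  by move=> c x Rx; apply: kR_M => //; exact: kR_C.
have sS S' : (forall v, v \in S' -> over v) ->
    subspace iota [set x | kR x /\ forall v, v \in S' -> vge v 1 x].
  move=> oS; case: sR => r0 rD rZ; split.
  - by split=> // v _; left.
  - move=> x y [Rx Sx] [Ry Sy]; split=> [|v vS]; first exact: rD.
    by have [pv _] := oS v vS; apply: (vgeD pv); [exact: Sx|exact: Sy].
  - move=> c x [Rx Sx]; split=> [|v vS]; first exact: rZ.
    have [pv _] := oS v vS; rewrite -[1]add0r.
    by apply: (vgeM pv); [exact: (vgeC pv)|exact: Sx].
elim: S => [|v S IHS] /=.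
  move=> _ _; rewrite big_nil.
  have -> : [set x | kR x /\ forall v, v \in [::] -> vge v 1 x] = kR.
    by apply/seteqP; split=> [x []//|x Rx]; split.
  exact: isdim_refl.
move=> /andP[vS uS] oS.
have oS' v' : v' \in S -> over v' by move=> h; apply: oS; rewrite inE h orbT.
have ov : over v by apply: oS; rewrite mem_head.
have [pv vpi] := ov; have [[bv [Vb fb spb]] _] := over_isdim ov.
have [x [Rx vx Sx]] := over_separate ov oS' vS.
have /choice[r hr] i : exists r, kR r /\ vge v 1 (bv i - r).
  have [r Rr br] := over_pi_residue prQ Qa ku pcK coQq irr piG pv vpi (Vb i).
  by exists r.
have Rr i : kR (r i) by case: (hr i).
have vR := kR_vge prQ ku pv (over_pi_vt ku irr pv vpi).
have v1x y : vge v 0 y -> vge v 1 (x * y - y).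
  move=> vy; have -> : x * y - y = (x - 1) * y by ring.
  by rewrite -[1]addr0; apply: (vgeM pv).
rewrite big_cons addnC.
apply: (isdim_add _ _ _ _ (IHS uS oS')); [exact: sS|exact: sS| |by move=> y []|].
  by move=> y [Ry Sy]; split=> // v' v'S; apply: Sy; rewrite inE v'S orbT.
have diff (c : 'I_(place_degree iota v) -> K) :
    vge v 1 (\sum_i iota (c i) * bv i - \sum_i iota (c i) * (x * r i)).
  rewrite -sumrB; apply: (vge_sum pv) => i _; rewrite -mulrBr -[1]add0r.
  apply: (vgeM pv); first exact: (vgeC pv).
  have -> : bv i - x * r i = (bv i - r i) - (x * r i - r i) by ring.
  by apply: (vgeB pv); [case: (hr i)|apply: v1x; exact: vR].
have Rsum (c : 'I_(place_degree iota v) -> K) : kR (\sum_i iota (c i) * (x * r i)).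
  by apply: subspace_lin => // i; exact: kR_M.
have Ssum (c : 'I_(place_degree iota v) -> K) v' : v' \in S ->
    vge v' 1 (\sum_i iota (c i) * (x * r i)).
  move=> v'S; have [pv' vpi'] := oS' _ v'S; apply: (subspace_lin _ (subspace_vge pv' 1)) => i.
  rewrite -[1]addr0; apply: (vgeM pv'); first exact: Sx.
  exact: (kR_vge prQ ku pv' (over_pi_vt ku irr pv' vpi') (Rr i)).
exists (fun i => x * r i); split=> [i|c [_ /(_ v (mem_head v S)) hc]|z [Rz Sz]].
- split=> [|v' v'S]; first exact: kR_M.
  have [pv' vpi'] := oS' _ v'S; rewrite -[1]addr0; apply: (vgeM pv'); first exact: Sx.
  exact: (kR_vge prQ ku pv' (over_pi_vt ku irr pv' vpi') (Rr i)).
- by apply: fb; have := vgeD pv (diff c) hc; rewrite subrK.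
- have [c hc] := spb z (vR _ Rz); exists c; split.
    by apply: kR_B.
  move=> v'; rewrite inE => /orP[/eqP->|v'S].
    by have := vgeD pv hc (diff c); rewrite addrA subrK.
  by have [pv' _] := oS' _ v'S; apply: (vgeB pv'); [exact: Sz|exact: Ssum].
Qed.

(** Multiples of [pi] vanish on [S], so the space measured by [over_isdim_seq] is a quotient of
    K[t, w] / pi, which [kR_mod_span] bounds. *)
Lemma over_degree_bound (S : seq (F -> int)) : uniq S -> (forall v, v \in S -> over v) ->
  (\sum_(v <- S) place_degree iota v <= Q * (size pi).-1)%N.
Proof.
move=> uS oS; have [bv [Vb fb _]] := over_isdim_seq uS oS; have [bb hbb] := kR_mod_span.
have sub : kpiR `<=` [set x | kR x /\ forall v, v \in S -> vge v 1 x].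
  move=> x hx; split=> [|v vS]; first exact: kpiR_sub hx.
  case: hx => y Ry ->; have [pv vpi] := oS v vS.
  rewrite -[1]addr0; apply: (vgeM pv); first by right; lia.
  exact: (kR_vge prQ ku pv (over_pi_vt ku irr pv vpi) Ry).
apply: (free_le_span _ Vb fb (b' := bb)).
  split.
  - by split=> [|v _]; [rewrite -(evp0 iota t); exact: kR_evp|left].
  - move=> x y [Rx Sx] [Ry Sy]; split=> [|v vS]; first exact: kR_D.
    by have [pv _] := oS v vS; apply: (vgeD pv); [exact: Sx|exact: Sy].
  - move=> c x [Rx Sx]; split=> [|v vS]; first by apply: kR_M => //; exact: kR_C.
    have [pv _] := oS v vS; rewrite -[1]add0r.
    by apply: (vgeM pv); [exact: (vgeC pv)|exact: Sx].
by move=> z /hbb[c hc]; exists c; exact: sub.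
Qed.

End PlacesOverPiDegrees.

(** * The genus *)

Section Gaps.
Variables (Q a b : nat).

(* The pole order at infinity of w^i / (t^(a i / Q) (1 - t)^(b i / Q)), which is
   regular elsewhere. *)
Definition cgap (i : nat) : nat := ((a * i) %% Q + (b * i) %% Q)%N.

(** The pole numbers at infinity. [cgap i] is the smallest in its class modulo Q; the others arise
    by multiplication with [t], whose pole has order Q. *)
Definition nongap (m : nat) : bool :=
  [exists i : 'I_Q, (cgap i <= m)%N && (Q %| m - cgap i)%N].

Hypotheses (prQ : prime Q) (Qa : ~~ (Q %| a)%N) (Qb : ~~ (Q %| b)%N) (Qab : ~~ (Q %| a + b)%N).

Let Q_gt0 : (0 < Q)%N := prime_gt0 prQ.

Lemma cgap_mod i : (cgap i = (a + b) * i %[mod Q])%N.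
Proof. by rewrite /cgap modnDm mulnDl. Qed.

Lemma mulab_inj i j : (i < Q)%N -> (j < Q)%N ->
  ((a + b) * i = (a + b) * j %[mod Q])%N -> i = j.
Proof.
move=> iQ jQ; wlog le_ij : i j iQ jQ / (j <= i)%N.
  by move=> H; case: (leqP j i) => [|/ltnW] le e; [|apply: esym]; apply: H.
move/eqP; rewrite eqn_mod_dvd ?leq_mul2l ?le_ij ?orbT // -mulnBr Euclid_dvdM //.
rewrite (negPf Qab) /= => h; apply/eqP; rewrite eqn_leq le_ij andbT -subn_eq0.
by move: h; rewrite /dvdn modn_small // (leq_ltn_trans (leq_subr _ _)).
Qed.

Lemma mulab_surj k : exists2 i, (i < Q)%N & (k = (a + b) * i %[mod Q])%N.
Proof.
pose f (i : 'I_Q) : 'I_Q := Ordinal (ltn_pmod ((a + b) * i) Q_gt0).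
have inj_f : injective f.
  move=> i j /(congr1 val) /= h; apply/val_inj; exact: (mulab_inj (ltn_ord i) (ltn_ord j) h).
have [g _ gK] := injF_bij inj_f.
exists (g (Ordinal (ltn_pmod k Q_gt0))) => //.
by have := congr1 val (gK (Ordinal (ltn_pmod k Q_gt0))).
Qed.

Lemma cgap_inj i j : (i < Q)%N -> (j < Q)%N -> (cgap i = cgap j %[mod Q])%N -> i = j.
Proof. by move=> iQ jQ; rewrite !cgap_mod; exact: mulab_inj. Qed.

Lemma cgap_lt i : (cgap i < 2 * Q)%N.
Proof. by rewrite /cgap mul2n -addnn -addnS leq_add // ?ltn_pmod // ltnW // ltn_pmod. Qed.

(** Multiplication by a + b permutes the classes modulo Q, and every [cgap i] is below 2 Q; so a
    class contains at most one gap, namely cgap i - Q. *)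
Lemma gap_char m : ~~ nongap m <->
  exists2 i, (i < Q)%N & (Q <= cgap i)%N && (m == cgap i - Q)%N.
Proof.
split=> [ng|[i iQ /andP[le /eqP em]]].
  have [i iQ ei] := mulab_surj m; exists i => //; rewrite -cgap_mod in ei.
  have lt : (m < cgap i)%N.
    rewrite ltnNge; apply: contra ng => le; apply/existsP; exists (Ordinal iQ) => /=.
    by rewrite le -eqn_mod_dvd // ei eqxx.
  have /eqP := ei; rewrite eq_sym eqn_mod_dvd ?(ltnW lt) // => /dvdnP[[|[|k]] ek].
  - by move: ek; lia.
  - by apply/andP; split; [lia|apply/eqP; lia].
  - by have := cgap_lt i; rewrite !mulSn in ek; move: (k * Q)%N ek => kQ; lia.
apply/existsP => -[j /andP[le1 dv]].
have : (cgap i = cgap j %[mod Q])%N.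
  apply/eqP; rewrite eqn_mod_dvd; last by lia.
  by have := dvdn_add dv (dvdnn Q); rewrite em; congr (_ %| _)%N; lia.
by move/(cgap_inj iQ (ltn_ord j)) => eij; move: le1; rewrite -eij em; lia.
Qed.

Lemma mulmod_opp c i : ~~ (Q %| c)%N -> (0 < i)%N -> (i < Q)%N ->
  ((c * (Q - i)) %% Q + (c * i) %% Q = Q)%N.
Proof.
move=> Qc i0 iQ.
have ri : (0 < (c * i) %% Q)%N.
  by rewrite lt0n -/(_ %| _)%N Euclid_dvdM // (negPf Qc) /= gtnNdvd.
have lt : ((c * i) %% Q < Q)%N by rewrite ltn_pmod.
have lt' : ((c * (Q - i)) %% Q < Q)%N by rewrite ltn_pmod.
have : (Q %| (c * (Q - i)) %% Q + (c * i) %% Q)%N.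
  by rewrite /dvdn modnDm -mulnDr subnK ?(ltnW iQ) // modnMl.
move: ri lt lt'; move: ((c * i) %% Q)%N ((c * (Q - i)) %% Q)%N => x y x0 xQ yQ.
by case/dvdnP=> [[|[|k]] ek]; rewrite ?mulSn in ek; lia.
Qed.

Lemma cgap_opp i : (0 < i)%N -> (i < Q)%N -> (cgap (Q - i) + cgap i = 2 * Q)%N.
Proof.
move=> i0 iQ; have := mulmod_opp Qa i0 iQ; have := mulmod_opp Qb i0 iQ.
rewrite /cgap; move: (_ %% _)%N (_ %% _)%N (_ %% _)%N (_ %% _)%N => x y z u; lia.
Qed.

Lemma cgap_neq i : (0 < i)%N -> (i < Q)%N -> cgap i != Q.
Proof.
move=> i0 iQ; apply/eqP => h; have := cgap_mod i; rewrite h modnn => /esym/eqP.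
by rewrite -/(_ %| _)%N Euclid_dvdM // (negPf Qab) /= gtnNdvd.
Qed.

(** For 0 < i < Q the values at i and Q - i add up to 2 Q and neither equals Q, so exactly one of
    them is large. *)
Lemma count_large_cgap : (2 * count (fun i => Q <= cgap i)%N (iota 0 Q) = Q.-1)%N.
Proof.
rewrite -[X in iota 0 X](prednK Q_gt0) /= {1}/cgap !muln0 mod0n addn0 leqNgt Q_gt0 add0n.
have -> : count (fun i => Q <= cgap i)%N (iota 1 Q.-1) = (\sum_(1 <= i < Q) (Q <= cgap i))%N.
  by rewrite -sum1_count big_mkcond /index_iota subn1.
rewrite mul2n -addnn {1}big_nat_rev /= -big_split /=.
rewrite (eq_big_nat _ _ (F2 := fun=> 1%N)) ?sum_nat_const_nat ?muln1 ?subn1 // => i /andP[i0 iQ].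
have := cgap_opp i0 iQ; have := cgap_neq i0 iQ; rewrite add1n subSS.
by case: (leqP Q (cgap i)); case: (leqP Q (cgap (Q - i))); lia.
Qed.

(* Half of the Q - 1 nonzero residues contribute a gap: the genus is (Q - 1) / 2. *)
Lemma count_nongap m : (Q <= m)%N ->
  (2 * count nongap (iota 0 m.+1) + Q.-1 = 2 * m.+1)%N.
Proof.
move=> Qm; rewrite -count_large_cgap -mulnDr.
have -> : count (fun i => Q <= cgap i)%N (iota 0 Q) = count (predC nongap) (iota 0 m.+1).
  rewrite -!size_filter -(size_map (fun i => cgap i - Q)%N); apply: perm_size.
  apply: uniq_perm; last 1 first.
  - move=> k; rewrite mem_filter mem_iota add0n /= ; apply/mapP/andP.
      move=> [i]; rewrite mem_filter mem_iota add0n /= => /andP[le iQ] ->.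
      split; last by have := cgap_lt i; lia.
      by apply/gap_char; exists i => //; rewrite le eqxx.
    move=> [/gap_char[i iQ /andP[le /eqP ->]] _]; exists i => //.
    by rewrite mem_filter le mem_iota.
  - rewrite map_inj_in_uniq ?filter_uniq ?iota_uniq // => i j.
    rewrite !mem_filter !mem_iota !add0n /= => /andP[lei iQ] /andP[lej jQ] e1.
    by apply: cgap_inj => //; congr (_ %% _)%N; lia.
  - by rewrite filter_uniq ?iota_uniq.
by rewrite count_predC size_iota.
Qed.

End Gaps.

(** The basis vector need not be 1, so the coordinate of [z] is divided by that of 1. *)
Lemma isdim1_residue (K F : fieldType) (iota : {rmorphism K -> F}) (v : F -> int) :
    places iota v -> isdim iota (vge v 0) (vge v 1) 1 ->
  forall z, vge v 0 z -> exists c, vge v 1 (z - iota c).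
Proof.
move=> pv [bv [_ _ sp]] z vz; have v1 : vge v 0 1 by right; rewrite (pl1 pv).
have [c1 h1] := sp 1 v1; have [c hz] := sp z vz.
rewrite big_ord1 in h1; rewrite big_ord1 in hz.
have c10 : c1 ord0 != 0.
  apply/eqP => c10; move: h1; rewrite c10 (rmorph0 iota) mul0r subr0.
  by move=> /(vgeP (oner_neq0 F)); rewrite (pl1 pv).
exists (c ord0 / c1 ord0).
have -> : z - iota (c ord0 / c1 ord0) =
   (z - iota (c ord0) * bv ord0) - iota (c ord0 / c1 ord0) * (1 - iota (c1 ord0) * bv ord0).
  rewrite rmorphM fmorphV; field; by rewrite fmorph_eq0.
have := vgeM pv (vgeC pv (c ord0 / c1 ord0)) h1; rewrite add0r => h2. exact: (vgeB pv hz h2).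
Qed.

Lemma signed_mul_mod_inj (Q al : nat) (sg m : int) (i j : nat) :
    prime Q -> ~~ (Q %| al)%N -> `|sg| = 1 -> (i < Q)%N -> (j < Q)%N ->
  sg * al%:Z * i%:Z - sg * al%:Z * j%:Z = Q%:Z * m -> i = j.
Proof.
move=> prQ Qal sg1 iQ jQ h.
have : (Q%:Z %| sg * (al%:Z * (i%:Z - j%:Z)))%Z.
  by apply/dvdzP; exists m; rewrite [RHS]mulrC -h; ring.
rewrite dvdzE /= !abszM; have -> : `|sg|%N = 1%N by lia.
rewrite mul1n Euclid_dvdM // (negPf Qal) /= => /dvdn_leq hle.
apply/eqP; rewrite -[_ == _]negbK; apply/negP => nij.
have : (0 < `|i%:Z - j%:Z|)%N by rewrite absz_gt0 subr_eq0 eqz_nat.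
by move/hle; lia.
Qed.

(** * Functions with poles only at infinity *)

Section KummerGlobal.
Variables (K : finFieldType) (F : fieldType) (iota : {rmorphism K -> F}).
Local Notation evp := (peval iota).
Local Notation ev2 := (peval2 iota).
Local Notation q := #|K|.
Variables (Q : nat) (t w : F) (e : K) (a b : nat).
Hypotheses (prQ : prime Q) (Qa : ~~ (Q %| a)%N) (Qb : ~~ (Q %| b)%N) (Qab : ~~ (Q %| a + b)%N).
Hypothesis (ku : kummer iota Q t w e a b).
Hypotheses (pcK : [pchar K].-nat q) (coQq : coprime q Q).
Variables (v0 v1 voo : F -> int).
Hypotheses (pv0 : places iota v0) (pv1 : places iota v1) (pvoo : places iota voo).
Hypotheses (v0t : v0 t = Q%:Z) (v0w : v0 w = a%:Z).
Hypotheses (v1s : v1 (1 - t) = Q%:Z) (v1w : v1 w = b%:Z).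
Hypotheses (voot : voo t = - Q%:Z) (voow : voo w = - (a + b)%:Z).
Hypotheses (u0 : forall v, places iota v -> 0 < v t -> v = v0)
  (u1 : forall v, places iota v -> 0 < v (1 - t) -> v = v1)
  (uoo : forall v, places iota v -> v t < 0 -> v = voo).
Hypothesis doo : isdim iota (vge voo 0) (vge voo 1) 1.

Local Notation kR := (kR iota t w).
Local Notation s := (1 - t).
Local Notation cgap := (cgap Q a b).
Local Notation nongap := (nongap Q a b).

Let Q_gt0 : (0 < Q)%N := prime_gt0 prQ.
Let t0 : t != 0 := t_neq0 ku.
Let s0 : s != 0 := s_neq0 ku.
Let w0 : w != 0 := w_neq0 prQ ku.

Lemma val_t_pos v : places iota v -> 0 < v t -> v s = 0.
Proof.
move=> pv vt; have [||_ ->] := @plD_dom _ _ _ v pv 1 (- t); rewrite ?oner_eq0 ?(pl1 pv) //.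
by right; rewrite (plN pv) add0r -gtz0_ge1.
Qed.

Lemma val_s_pos v : places iota v -> 0 < v s -> v t = 0.
Proof.
move=> pv vs; rewrite -[t](subKr 1).
have [||_ ->] := @plD_dom _ _ _ v pv 1 (- s); rewrite ?oner_eq0 ?(pl1 pv) //.
by right; rewrite (plN pv) add0r -gtz0_ge1.
Qed.

Lemma val_t_neg v : places iota v -> v t < 0 -> v s = v t.
Proof.
move=> pv vt; rewrite addrC.
have [||_ ->] := @plD_dom _ _ _ v pv (- t) 1; rewrite ?oppr_eq0 ?(plN pv) //.
by right; rewrite (pl1 pv) lezD1.
Qed.

Lemma val_ts0_w v : places iota v -> v t = 0 -> v s = 0 -> v w = 0.
Proof.
move=> pv vt vs; have := congr1 v (ku_eq ku).
have e0 : iota e != 0 by rewrite fmorph_eq0 (ku_e ku).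
rewrite (plX pv) !(plM pv) ?mulf_neq0 ?expf_neq0 // (plC pv) !(plX pv) vt vs !mul0r !addr0.
by move/eqP; rewrite mulf_eq0 => /orP[/eqP //|]; rewrite eqz_nat gtn_eqF.
Qed.

Lemma place_cases v : places iota v ->
  [\/ v = voo, v = v0, v = v1 | [/\ v t = 0, v s = 0 & v w = 0]].
Proof.
move=> pv; have [vt|vt|vt] := ltrgt0P (v t).
- by constructor 2; exact: u0.
- by constructor 1; exact: uoo.
have [vs|vs|vs] := ltrgt0P (v s).
- by constructor 3; exact: u1.
- have : vge v 0 s by apply: (vgeB pv); right; rewrite ?(pl1 pv) ?vt.
  by move=> /(vgeP s0); rewrite leNgt vs.
- by constructor 4; split=> //; exact: val_ts0_w.
Qed.

Let Qz : 0 < Q%:Z :> int. Proof. by rewrite ltz_nat. Qed.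
Let v0s : v0 s = 0. Proof. by apply: val_t_pos pv0 _; rewrite v0t. Qed.
Let v1t : v1 t = 0. Proof. by apply: val_s_pos pv1 _; rewrite v1s. Qed.
Let voos : voo s = - Q%:Z. Proof. by rewrite (val_t_neg pvoo) voot // oppr_lt0. Qed.

Let v0_voo : v0 <> voo.
Proof. by move=> h; move: v0t; rewrite h voot; move: Q_gt0; clear; lia. Qed.
Let v1_voo : v1 <> voo.
Proof. by move=> h; move: v1t; rewrite h voot; move: Q_gt0; clear; lia. Qed.

Lemma evp_val_at v tau f : places iota v -> v (t - iota tau) = Q%:Z -> f != 0 ->
  v (evp t f) = Q%:Z * (mup tau f)%:Z.
Proof.
move=> pv vtau f0; have [k [g [g0 ef]]] := poly_split_at tau f0.
have -> : mup tau f = k.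
  by rewrite ef mupMl // mup_XsubCX eqxx.
have vt : 0 <= v t.
  have : vge v 0 (t - iota tau + iota tau).
    by apply: (vgeD pv); [right; rewrite vtau ltW|exact: (vgeC pv)].
  by rewrite subrK => /(vgeP t0).
have tau0 : t - iota tau != 0 by apply/eqP => h; have := Qz; rewrite -vtau h (pl0 pv).
have vg : v (evp t g) = 0.
  have /factor_theorem[g1 eg] : root (g - (g.[tau])%:P) tau.
    by rewrite rootE hornerD hornerN hornerC subrr.
  have -> : g = (g.[tau])%:P + g1 * ('X - tau%:P) by rewrite -eg addrC subrK.
  rewrite evpD evpC evpM evpB evpX evpC.
  have [||_ ->] := @plD_dom _ _ _ v pv (iota g.[tau]) (evp t g1 * (t - iota tau)).
  - by rewrite fmorph_eq0.
  - rewrite (plC pv); apply: (vgeM pv); first exact: (evp_vge prQ ku).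
    by right; rewrite vtau -gtz0_ge1.
  - by rewrite (plC pv).
have evg0 : evp t g != 0 by apply: (evp_neq0 ku); apply: contra g0 => /eqP->; rewrite horner0.
rewrite ef evpM evpXn evpB evpX evpC (plM pv) ?expf_neq0 // (plX pv) vtau vg addr0.
by [].
Qed.

Lemma evp_valoo f : f != 0 -> voo (evp t f) = - (Q%:Z * (size f).-1%:Z).
Proof. by move=> f0; rewrite (evp_val_neg ku pvoo) ?voot ?oppr_lt0 // mulNr. Qed.

(* The values of the nonzero terms [x i * y i] are distinct modulo Q, so that the
   smallest of them cannot be cancelled. *)
Lemma sum_val_dom v (al : nat) (sg : int) (x y : 'I_Q -> F) : places iota v ->
    ~~ (Q %| al)%N -> `|sg| = 1 ->
    (forall i, x i != 0 -> exists m, v (x i) = Q%:Z * m) ->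
    (forall i, y i != 0) ->
    (forall i : 'I_Q, exists m, v (y i) = sg * al%:Z * (i : nat)%:Z + Q%:Z * m) ->
    (exists i, x i != 0) ->
  exists i, [/\ x i != 0, \sum_i x i * y i != 0, v (\sum_i x i * y i) = v (x i) + v (y i)
     & forall j, x j != 0 -> v (\sum_i x i * y i) <= v (x j) + v (y j)].
Proof.
move=> pv Qal sg1 hx y0 hy [i0 xi0].
have vxy i : x i * y i != 0 -> x i != 0 /\ v (x i * y i) = v (x i) + v (y i).
  by rewrite mulf_eq0 negb_or => /andP[xi yi]; rewrite (plM pv).
have [||i [xyi S0 vS mini]] := @pl_sum_dom _ _ _ v pv _ (fun i => x i * y i).
- move=> i j xyi xyj; have [xi ->] := vxy _ xyi; have [xj ->] := vxy _ xyj.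
  have [m ->] := hx _ xi; have [m' ->] := hx _ xj.
  have [n ->] := hy i; have [n' ->] := hy j => h.
  apply/val_inj/(signed_mul_mod_inj prQ Qal sg1 (ltn_ord i) (ltn_ord j) (m := m' + n' - m - n)) => /=.
  have -> : sg * al%:Z * (i : nat)%:Z - sg * al%:Z * (j : nat)%:Z =
    (Q%:Z * m + (sg * al%:Z * (i : nat)%:Z + Q%:Z * n)) -
    (Q%:Z * m' + (sg * al%:Z * (j : nat)%:Z + Q%:Z * n')) + Q%:Z * (m' + n' - m - n) by ring.
  by rewrite h subrr add0r.
- by exists i0; rewrite mulf_neq0.
have [xi e1] := vxy _ xyi; exists i; split=> //; first by rewrite vS.
move=> j xj; rewrite vS -(plM pv) //; apply: mini; exact: mulf_neq0.
Qed.

Lemma dvd_kG_XX pi : irreducible_poly pi -> pi %| kG e a b -> pi %| 'X * (1 - 'X).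
Proof.
move=> irr; rewrite /kG dvdpZr ?(ku_e ku) // => /(irredp_dvdM irr)/orP[] /(irredp_dvdX irr) h.
  exact: dvdp_mulr.
exact: dvdp_mull.
Qed.

Lemma evp_XX : evp t ('X * (1 - 'X)) = t * s.
Proof. by rewrite evpM evpB evp1 evpX. Qed.

Let ts0 : t * s != 0. Proof. exact: mulf_neq0. Qed.

Lemma over_pi_evp_val pi v f : irreducible_poly pi -> ~~ (pi %| kG e a b) ->
  places iota v -> 0 < v (evp t pi) -> ~~ (pi %| f) -> v (evp t f) = 0.
Proof.
move=> irr piG pv vpi nf; apply: (centre_out prQ Qa ku pcK coQq irr piG pv vpi).
apply: (evp_outside irr) => //; first exact: (centre_prime prQ Qa ku pcK coQq irr piG pv vpi).
exact: (centre_pi prQ Qa ku pcK coQq irr piG vpi).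
Qed.

(** Induction on the degree of a denominator h(t). An irreducible factor dividing G divides t (1 -
    t) and is absorbed by a power of that product. For another factor [pi] the numerator must be
    divisible by [pi]: otherwise [place_avoiding] yields a place over [pi] where it has value 0,
    although it is h(t) times a regular function. The bound [M] leaves room for the subtractions in
    [regular_form]. *)
Lemma regular_denominator z M :
    (forall v, places iota v -> v t = 0 -> v s = 0 -> vge v 0 z) ->
  exists N (P : {poly {poly K}}), [/\ (M <= N)%N, (size P <= Q)%N & (t * s) ^+ N * z = ev2 t w P].
Proof.
move=> regz; have [h [P [h0 _ eP]]] := ku_frac prQ Qa ku z.
have {eP}[N [P' eP]] : exists N P', evp t h * ((t * s) ^+ N * z) = ev2 t w P'.
  by exists 0%N, P; rewrite expr0 mul1r.
suff [N' [P1 e1]] : exists N P', (t * s) ^+ N * z = ev2 t w P'.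
  pose P2 := ('X * (1 - 'X)) ^+ M *: P1.
  have [P3 sz3 e3] := ku_reduce prQ ku P2.
  exists (M + N')%N, P3; rewrite leq_addr; split=> //.
  by rewrite -e3 ev2Z evpXn evp_XX -e1 exprD mulrA.
have [n] := ubnP (size h); elim: n h h0 N P' eP => // n IHn h h0 N P1 eP; rewrite ltnS => szh.
have [sz1|sz1] := leqP (size h) 1%N.
  have [c hc] : exists c, h = c%:P by exists h`_0; exact: size1_polyC.
  have c0 : c != 0 by rewrite hc polyC_eq0 in h0.
  exists N, ((c^-1)%:P *: P1); rewrite ev2Z -eP hc !evpC mulrA -rmorphM mulVf //.
  by rewrite rmorph1 mul1r.
have [pi irr /dvdpP[g eh]] := irreducible_factor sz1.
have g0 : g != 0 by apply: contra h0 => /eqP g0; rewrite eh g0 mul0r.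
have szg : (size g < n)%N.
  have pi0 := irredp_neq0 irr; apply: leq_trans szh; rewrite eh size_mul //.
  by have := irr.1; case: (size pi) => [|[|k]] // _; rewrite !addnS ltnS leq_addr.
have [piG|piG] := boolP (pi %| kG e a b).
  have /dvdpP[c ec] := dvd_kG_XX irr piG.
  apply: (IHn g g0 N.+1 (c *: P1)) => //.
  rewrite ev2Z -eP eh exprS evpM -evp_XX ec evpM; ring.
set y := (t * s) ^+ N * z in eP.
have regy v : places iota v -> v t = 0 -> v s = 0 -> vge v 0 y.
  move=> pv vt vs; rewrite -[0]add0r; apply: (vgeM pv); last exact: regz.
  by right; rewrite (plX pv) (plM pv) // vt vs addr0 mul0r.
case: (pselect (kpiR iota t w pi (ev2 t w P1))) => [[_ [P2 ->] e2]|nP1].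
  apply: (IHn g g0 N P2) => //; rewrite -/y.
  apply: (mulfI (evp_neq0 ku (irredp_neq0 irr))).
  by rewrite -e2 -eP eh evpM; ring.
have [v [pv vpi vP1]] := place_avoiding prQ Qa ku pcK coQq irr piG (kR_ev iota t w P1) nP1.
exfalso; have P10 : ev2 t w P1 != 0.
  apply/eqP => P10; apply: nP1; rewrite P10; exists 0; rewrite ?mulr0 //.
  by rewrite -(evp0 iota t); exact: kR_evp.
have nXX : ~~ (pi %| 'X * (1 - 'X)).
  apply: contra piG => /(irredp_dvdM irr)/orP[] hd; rewrite /kG dvdpZr ?(ku_e ku) //.
    by apply: dvdp_mulr; apply: dvdp_trans hd _; rewrite dvdp_exp // lt0n; case: (a) Qa => //;
      rewrite dvdn0.
  by apply: dvdp_mull; apply: dvdp_trans hd _; rewrite dvdp_exp // lt0n; case: (b) Qb => //;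
    rewrite dvdn0.
have vt : v t = 0.
  rewrite -(evpX iota t); apply: over_pi_evp_val irr piG pv vpi _.
  by apply: contra nXX => /dvdp_mulr; apply.
have vs : v s = 0.
  rewrite -(evpX iota t) -(evp1 iota t) -evpB; apply: over_pi_evp_val irr piG pv vpi _.
  by apply: contra nXX => /dvdp_mull; apply.
have : vge v 1 (ev2 t w P1).
  rewrite -eP eh evpM mulrAC -[1]add0r; apply: (vgeM pv); last by right; rewrite -gtz0_ge1.
  rewrite -[0]add0r; apply: (vgeM pv); last exact: regy.
  by apply: (evp_vge prQ ku) => //; rewrite vt.
by move/(vgeP P10); rewrite vP1.
Qed.

Definition ybase (i : nat) : F := w ^+ i / (t ^+ (a * i %/ Q) * s ^+ (b * i %/ Q)).

Lemma ybase_neq0 i : ybase i != 0.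
Proof. by rewrite /ybase mulf_neq0 ?invr_eq0 ?mulf_neq0 ?expf_neq0. Qed.

Lemma ybase_val v i : places iota v ->
  v (ybase i) = v w * i%:Z - (v t * (a * i %/ Q)%:Z + v s * (b * i %/ Q)%:Z).
Proof.
move=> pv; rewrite /ybase (plM pv) ?invr_eq0 ?mulf_neq0 ?expf_neq0 // (plV pv).
by rewrite (plM pv) ?expf_neq0 // !(plX pv).
Qed.

Let divz (c i : nat) : c%:Z * i%:Z = Q%:Z * (c * i %/ Q)%:Z + (c * i %% Q)%:Z.
Proof. by rewrite -!PoszM -PoszD mulnC -[in RHS](mulnC _ Q) -divn_eq mulnC. Qed.

Lemma ybase_val0 i : v0 (ybase i) = (a * i %% Q)%:Z.
Proof. by rewrite (ybase_val _ pv0) v0w v0t v0s mul0r addr0 divz addrAC subrr add0r. Qed.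

Lemma ybase_val1 i : v1 (ybase i) = (b * i %% Q)%:Z.
Proof. by rewrite (ybase_val _ pv1) v1w v1s v1t mul0r add0r divz addrAC subrr add0r. Qed.

Lemma ybase_valoo i : voo (ybase i) = - (cgap i)%:Z.
Proof.
rewrite (ybase_val _ pvoo) voow voot voos /cgap !PoszD mulNr mulrDl (divz a i) (divz b i); ring.
Qed.

Lemma ybase_reg v i : places iota v -> v <> voo -> vge v 0 (ybase i).
Proof.
move=> pv nvoo; right.
have [//|->|->|[vt vs vw]] := place_cases pv; rewrite ?ybase_val0 ?ybase_val1 //.
by rewrite (ybase_val _ pv) vt vs vw !mul0r subr0.
Qed.

Lemma mup_dvd tau (f : {poly K}) k : f != 0 -> (k <= mup tau f)%N -> ('X - tau%:P) ^+ k %| f.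
Proof. by move=> f0; rewrite mup_geq. Qed.

(** Over t = 0 and over t = 1 the terms of the expansion in powers of [w] have values distinct
    modulo Q, so regularity of the sum bounds every coefficient separately. The powers of t and 1 -
    t so obtained are those that turn w^i into [ybase i]. *)
Lemma regular_form z : (forall v, places iota v -> v <> voo -> vge v 0 z) ->
  exists g : 'I_Q -> {poly K}, z = \sum_(i < Q) evp t (g i) * ybase i.
Proof.
move=> regz; have [z0|z0] := eqVneq z 0.
  by exists (fun=> 0); rewrite z0 big1 // => i _; rewrite evp0 mul0r.
(* With [N] at least (a + b) Q, no subtraction of an integer quotient from [N] is truncated. *)
have [|N [P [leN sz eP]]] := @regular_denominator z (a * Q + b * Q)%N.
  move=> v pv vt vs; apply: regz => // voo'; have := voot; rewrite -voo' vt => h.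
  by have := Qz; rewrite -[X in _ < X]opprK -h oppr0.
have P0 : P != 0.
  apply: contra z0 => /eqP P0; move: eP; rewrite P0 ev20 => /eqP.
  by rewrite mulf_eq0 expf_eq0 (negPf ts0) andbF.
(* Term i has value Q times the order of its coefficient at [tau], plus al i. It is at least N Q, so
   that order is at least N minus the integer quotient of al i by Q. *)
have key v tau al : places iota v -> v (t - iota tau) = Q%:Z -> v w = al%:Z ->
    ~~ (Q %| al)%N -> v (t * s) = Q%:Z -> v <> voo ->
    forall i : 'I_Q, ('X - tau%:P) ^+ (N - (al * i %/ Q)) %| P`_i.
  move=> pv vtau vw Qal vts nvoo i; have [->|Pi0] := eqVneq P`_i 0; first exact: dvdp0.
  have [|||||j [_ _ _ /(_ i)]] := @sum_val_dom v al 1 (fun i : 'I_Q => evp t P`_i) (fun i => w ^+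
    i) pv Qal.
  - by rewrite normr1.
  - move=> j Pj; exists (mup tau P`_j)%:Z; apply: evp_val_at => //.
    by apply: contra Pj => /eqP->; rewrite evp0.
  - by move=> j; rewrite expf_neq0.
  - by move=> j; exists 0; rewrite (plX pv) vw mul1r mulr0 addr0.
  - by exists i; exact: (evp_neq0 ku Pi0).
  rewrite /= (evp_neq0 ku Pi0) => /(_ isT); rewrite -(ev2_sum _ _ _ sz) -eP (plX pv) vw.
  rewrite (evp_val_at pv vtau Pi0) => le1.
  have le2 : Q%:Z * N%:Z <= v ((t * s) ^+ N * z).
    rewrite (plM pv) ?expf_neq0 // (plX pv) vts lerDl.
    exact: vgeP z0 (regz v pv nvoo).
  apply: mup_dvd => //; rewrite leq_subLR addnC -leq_subLR leq_divRL //.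
  have := le_trans le2 le1; rewrite -!PoszM -PoszD lez_nat => le3.
  by rewrite mulnBl [(N * Q)%N]mulnC [(_ * Q)%N]mulnC leq_subLR.
have d0 := key v0 0 a pv0.
rewrite (rmorph0 iota) subr0 (plM pv0) // v0s addr0 in d0.
have d1 := key v1 1 b pv1.
rewrite (rmorph1 iota) -opprB (plN pv1) (plM pv1) // v1t add0r in d1.
have /choice[g hg] (i : 'I_Q) : exists g : {poly K},
    P`_i = g * ('X ^+ (N - a * i %/ Q) * (1 - 'X) ^+ (N - b * i %/ Q)).
  have h0 := d0 v0t v0w Qa v0t v0_voo i; have h1 := d1 v1s v1w Qb v1s v1_voo i.
  rewrite polyC0 subr0 in h0.
  apply/dvdpP; rewrite Gauss_dvdp ?h0 /=.
    have eqp1 : (1 - 'X : {poly K}) %= 'X - 1%:P.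
      by rewrite -opprB -scaleN1r eqp_scale // oppr_eq0 oner_eq0.
    by rewrite (eqp_dvdl _ (eqp_exp _ eqp1)).
  apply/coprimep_expl/coprimep_expr; rewrite coprimep_sym.
  by rewrite -[X in coprimep _ X]subr0 -polyC0 coprimep_XsubC rootE !hornerE ?subr0 oner_eq0.
exists g; apply: (mulfI (expf_neq0 N ts0)); rewrite eP (ev2_sum _ _ _ sz) mulr_sumr.
apply: eq_bigr => i _; rewrite hg !evpM !evpXn evpB evp1 evpX /ybase.
have le k c : (k <= c * Q)%N -> (k %/ Q <= c)%N.
  by move=> h; rewrite -(mulnK c Q_gt0) leq_div2r.
have hle c : (c * i %/ Q <= c * Q)%N.
  by apply: leq_trans (leq_div _ _) _; rewrite leq_mul2l (ltnW (ltn_ord i)) orbT.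
have hNa : (a * i %/ Q <= N)%N by apply: leq_trans (hle a) (leq_trans (leq_addr _ _) leN).
have hNb : (b * i %/ Q <= N)%N by apply: leq_trans (hle b) (leq_trans (leq_addl _ _) leN).
have et : t ^+ N = t ^+ (N - a * i %/ Q) * t ^+ (a * i %/ Q) by rewrite -exprD subnK.
have es : s ^+ N = s ^+ (N - b * i %/ Q) * s ^+ (b * i %/ Q) by rewrite -exprD subnK.
by rewrite exprMn et es; field; rewrite !expf_neq0.
Qed.

(** L(m oo), with the condition at infinity kept apart. [m] is an integer so that the induction of
    [isdim_Vpole] can start from -1. *)
Definition Vpole (m : int) : set F :=
  [set z | vge voo (- m) z /\ forall v, places iota v -> v <> voo -> vge v 0 z].

Lemma subspace_Vpole m : subspace iota (Vpole m).
Proof.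
split.
- by split=> [|v _ _]; left.
- by move=> x y [xo xr] [yo yr]; split=> [|v pv nv]; [exact: (vgeD pvoo)|apply: (vgeD pv); auto].
- move=> c x [xo xr]; split=> [|v pv nv].
    by rewrite -[- m]add0r; apply: (vgeM pvoo) => //; exact: (vgeC pvoo).
  by rewrite -[0]add0r; apply: (vgeM pv); [exact: (vgeC pv)|auto].
Qed.

Lemma pole_order z : z != 0 -> (forall v, places iota v -> v <> voo -> vge v 0 z) ->
  exists2 m : nat, nongap m & voo z = - m%:Z.
Proof.
move=> z0 /regular_form[g ez].
have [|||||i [gi0 _ ev _]] := @sum_val_dom voo (a + b) (-1) (fun i => evp t (g i))
   (fun i => ybase i) pvoo Qab.
- by rewrite normrN1.
- move=> i gi; exists (- (size (g i)).-1%:Z); rewrite evp_valoo ?mulrN //.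
  by apply: contra gi => /eqP->; rewrite evp0.
- by move=> i; exact: ybase_neq0.
- move=> i; exists ((a * i %/ Q)%:Z + (b * i %/ Q)%:Z).
  by rewrite (ybase_val _ pvoo) voow voot voos; ring.
- apply: contrapT => H; move: z0; rewrite ez big1 ?eqxx // => i _.
  have [->|gi] := eqVneq (evp t (g i)) 0; first by rewrite mul0r.
  by exfalso; apply: H; exists i.
have gi : g i != 0 by apply: contra gi0 => /eqP->; rewrite evp0.
exists (Q * (size (g i)).-1 + cgap i)%N.
  by apply/existsP; exists i; rewrite leq_addl addnK dvdn_mulr.
by rewrite ez ev evp_valoo // ybase_valoo PoszD PoszM opprD.
Qed.

Lemma nongap_elt (m : nat) : nongap m ->
  exists2 z, z != 0 & voo z = - m%:Z /\ Vpole m z.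
Proof.
move=> /existsP[i /andP[le /dvdnP[j ej]]].
have e0 : t ^+ j * ybase i != 0 by rewrite mulf_neq0 ?expf_neq0 ?ybase_neq0.
have ev : voo (t ^+ j * ybase i) = - m%:Z.
  rewrite (plM pvoo) ?expf_neq0 ?ybase_neq0 // (plX pvoo) voot ybase_valoo.
  by rewrite -[m in RHS](subnK le) ej PoszD PoszM; ring.
exists (t ^+ j * ybase i) => //; split=> //; split=> [|v pv nv]; first by right; rewrite ev.
rewrite -[0]add0r; apply: (vgeM pv); last exact: ybase_reg.
right; rewrite (plX pv); have [//|->|->|[-> _ _]] := place_cases pv.
- by rewrite v0t.
- by rewrite v1t mul0r.
- by rewrite mul0r.
Qed.

(** From m - 1 to m a dimension is added only if some function has pole order exactly m, and then
    just one, since the residue field at infinity is K. *)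
Lemma isdim_Vpole (m : nat) :
  isdim iota (Vpole m) [set 0] (count nongap (seq.iota 0 m.+1)).
Proof.
have step (k : nat) d : isdim iota (Vpole (k%:Z - 1)) [set 0] d ->
    isdim iota (Vpole k) [set 0] (d + nongap k).
  move=> hd; case: (boolP (nongap k)) => [ng|g] /=.
    have [e1 e10 [ev [eoo ereg]]] := nongap_elt ng.
    rewrite addn1 -add1n; apply: (isdim_add _ _ _ _ _ hd).
    - exact: subspace0.
    - exact: subspace_Vpole.
    - by move=> _ ->; case: (subspace_Vpole (k%:Z - 1)).
    - by move=> z [zo zr]; split=> //; apply: vge_le zo; rewrite lerN2 lerBlDr lerDl.
    apply: (@isdim_line _ _ _ _ _ e1).
    - by split.
    - by move=> [/(vgeP e10)]; rewrite ev lerN2; clear; lia.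
    - exact: subspace_Vpole.
    move=> z [zo zr].
    have : vge voo 0 (z / e1).
      rewrite -(addNr k%:Z); apply: (vgeM pvoo) => //.
      by right; rewrite (plV pvoo) ev opprK.
    move=> /(isdim1_residue pvoo doo)[c hc]; exists c; split; last first.
      move=> v pv nv; apply: (vgeB pv); first exact: zr.
      by rewrite -[0]add0r; apply: (vgeM pv); [exact: (vgeC pv)|exact: ereg].
    have -> : z - iota c * e1 = (z / e1 - iota c) * e1 by rewrite mulrBl divfK.
    have -> : - (k%:Z - 1) = 1 + - k%:Z by rewrite opprB.
    by apply: (vgeM pvoo) => //; right; rewrite ev.
  rewrite addn0; congr isdim: hd; apply/seteqP; split=> z [zo zr]; split=> //.
    by apply: vge_le zo; rewrite lerN2 lerBlDr lerDl.
  have [->|z0] := eqVneq z 0; first by left.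
  have [m' ng ev] := pole_order z0 zr; right; rewrite ev lerN2.
  have := vgeP z0 zo; rewrite ev lerN2 lez_nat leq_eqVlt => /orP[/eqP e1|].
    by rewrite e1 (negPf g) in ng.
  by clear; lia.
elim: m => [|m IHm].
  have -> : count nongap (seq.iota 0 1) = (0 + nongap 0)%N by rewrite /= addnC.
  apply: step; have -> : Vpole (0%:Z - 1) = [set 0].
    apply/seteqP; split=> [z [zo zr] /=|_ ->]; last by case: (subspace_Vpole (0 - 1)).
    apply/eqP/negPn/negP => z0; have [m _ ev] := pole_order z0 zr.
    by have := vgeP z0 zo; rewrite ev; clear; lia.
  exact/isdim_refl/subspace0.
rewrite -[m.+2]addn1 iotaD count_cat /= addn0 add0n.
by apply: step; have -> : m.+1%:Z - 1 = m%:Z by clear; lia.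
Qed.

(** * Degrees of zeros and the Riemann inequality *)

Hypotheses (dd0 : isdim iota (vge v0 0) (vge v0 1) 1) (dd1 : isdim iota (vge v1 0) (vge v1 1) 1).

Local Notation deg := (place_degree iota).

Lemma val_t_ge0 v : places iota v -> v <> voo -> 0 <= v t.
Proof. by move=> pv nv; rewrite leNgt; apply/negP => /(uoo pv). Qed.

Lemma evp_val_ge0 v f : places iota v -> v <> voo -> 0 <= v (evp t f).
Proof.
move=> pv nv; have [->|f0] := eqVneq f 0; first by rewrite evp0 (pl0 pv).
apply: (vgeP (evp_neq0 ku f0)); apply: (evp_vge prQ ku) => //; exact: val_t_ge0.
Qed.

(** If all polynomials in [t] had value 0, norms would give value 0 to K[t, w] and hence to its
    fraction field [F], but some element has value 1. *)
Lemma evp_zero_exists v : places iota v -> v <> voo ->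
  exists2 f : {poly K}, f != 0 & 0 < v (evp t f).
Proof.
move=> pv nv; apply: contrapT => H.
have vf f : v (evp t f) = 0.
  have [->|f0] := eqVneq f 0; first by rewrite evp0 (pl0 pv).
  apply/eqP; rewrite eq_le (evp_val_ge0 _ pv nv) andbT leNgt; apply/negP => h.
  by apply: H; exists f.
have vP P : ev2 t w P != 0 -> v (ev2 t w P) = 0.
  move=> P0; have [P' [h [h0 eh]]] := ku_norm prQ Qa ku P0.
  have P'0 : ev2 t w P' != 0.
    by apply: contra (evp_neq0 ku h0) => /eqP P'0; rewrite -eh P'0 mulr0.
  have := congr1 v eh; rewrite (plM pv) // vf.
  have vR := kR_vge prQ ku pv (val_t_ge0 pv nv).
  have := vgeP P0 (vR _ (kR_ev iota t w P)); have := vgeP P'0 (vR _ (kR_ev iota t w P')).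
  by move: (v _) (v _) => x y; clear; lia.
have [x x0 vx] := pl_param pv; have [h [P [h0 _ eP]]] := ku_frac prQ Qa ku x.
have P0 : ev2 t w P != 0 by rewrite -eP mulf_neq0 ?(evp_neq0 ku).
by have := vP P P0; rewrite -eP (plM pv) ?(evp_neq0 ku) // vf vx.
Qed.

Lemma irr_zero_exists v : places iota v -> v <> voo ->
  exists2 pi : {poly K}, irreducible_poly pi & 0 < v (evp t pi).
Proof.
move=> pv nv; have [f f0 vf] := evp_zero_exists pv nv.
have [n] := ubnP (size f); elim: n f f0 vf => // n IHn f f0 vf; rewrite ltnS => szf.
have [sz1|sz1] := leqP (size f) 1%N.
  have [c hc] : exists c, f = c%:P by exists f`_0; exact: size1_polyC.
  by move: vf; rewrite hc evpC (plC pv).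
have [pi irr /dvdpP[g ef]] := irreducible_factor sz1.
have pi0 := irredp_neq0 irr.
have g0 : g != 0 by apply: contra f0 => /eqP g0; rewrite ef g0 mul0r.
have := vf; rewrite ef evpM (plM pv) ?(evp_neq0 ku) // => vs.
have [vpi|vpi] := ltP 0 (v (evp t pi)); first by exists pi.
apply: (IHn g g0); first by apply: lt_le_trans vs _; rewrite gerDl.
apply: leq_trans szf; rewrite ef size_mul //.
by have := irr.1; case: (size pi) => [|[|k]] // _; rewrite !addnS ltnS leq_addr.
Qed.

(** A place other than the three branch places lies over an irreducible [pi] prime to G, where
    [over_isdim] applies. *)
Lemma place_isdim_deg v : places iota v ->
  isdim iota (vge v 0) (vge v 1) (deg v) /\ (0 < deg v)%N.
Proof.
move=> pv; have H1 v' : places iota v' -> isdim iota (vge v' 0) (vge v' 1) 1 ->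
    isdim iota (vge v' 0) (vge v' 1) (deg v') /\ (0 < deg v')%N.
  by move=> pv' d1; rewrite (place_isdim pv' d1).
have [->|->|->|[vt vs vw]] := place_cases pv; [exact: H1|exact: H1|exact: H1|].
have nv : v <> voo by move=> h; have := voot; rewrite -h vt => h'; have := Qz; rewrite -oppr_lt0 -h'.
have [pi irr vpi] := irr_zero_exists pv nv.
have piG : ~~ (pi %| kG e a b).
  apply/negP => /(dvd_kG_XX irr)/dvdpP[c ec].
  have := congr1 v evp_XX; rewrite (plM pv) // vt vs addr0 ec evpM => vc.
  have XX0 : 'X * (1 - 'X) != 0 :> {poly K} by rewrite mulf_neq0 ?polyX_eq0 ?oneX_neq0.
  have c0 : c != 0 by apply: contra XX0 => /eqP c0; rewrite ec c0 mul0r.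
  have pi0 := irredp_neq0 irr; move: vc; rewrite (plM pv) ?(evp_neq0 ku) // => vc.
  have := evp_val_ge0 c pv nv.
  by move: vc vpi; move: (v (evp t c)) (v (evp t pi)) => x y; clear; lia.
exact: (over_isdim prQ Qa ku pcK coQq irr piG (conj pv vpi)).
Qed.

Lemma sum_one_place (S : seq (F -> int)) u (f : (F -> int) -> int) B : uniq S -> 0 <= B ->
  f u <= B -> (forall v, v \in S -> v != u -> f v = 0) -> \sum_(v <- S) f v <= B.
Proof.
move=> uS B0 fu f0; have [uiS|uiS] := boolP (u \in S).
  rewrite (bigD1_seq u) //= big_seq_cond big1 ?addr0 // => v /andP[vS vu].
  exact: f0.
rewrite big_seq_cond big1 // => v /andP[vS _]; apply: f0 => //.
by apply: contra uiS => /eqP<-.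
Qed.

(** If [pi] divides t (1 - t), its only possible zero is a totally ramified place of degree 1, of
    order at most Q. Otherwise the zeros are simple and [over_degree_bound] applies. *)
Lemma zeros_degree_irr (S : seq (F -> int)) pi : irreducible_poly pi -> uniq S ->
    (forall v, v \in S -> places iota v /\ v <> voo) ->
  \sum_(v <- S) v (evp t pi) * (deg v)%:Z <= Q%:Z * (size pi).-1%:Z.
Proof.
move=> irr uS hS; have pi0 := irredp_neq0 irr.
have szpi : (0 < (size pi).-1)%N by have := irr.1; case: (size pi) => [|[]].
have leQ : Q%:Z <= Q%:Z * (size pi).-1%:Z by rewrite ler_pMr ?ler1z ?lez_nat // Qz.
have [piG|piG] := boolP (pi %| kG e a b).
  have XX := dvd_kG_XX irr piG.
  have H u x : places iota u -> x != 0 -> pi %| x -> u (evp t x) = Q%:Z -> u <> voo ->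
      isdim iota (vge u 0) (vge u 1) 1 ->
      (forall v, places iota v -> 0 < v (evp t x) -> v = u) ->
      \sum_(v <- S) v (evp t pi) * (deg v)%:Z <= Q%:Z * (size pi).-1%:Z.
    move=> pu x0 /dvdpP[c ec] ux nu du uu.
    have c0 : c != 0 by apply: contra x0 => /eqP c0; rewrite ec c0 mul0r.
    have vx v : places iota v -> v (evp t x) = v (evp t c) + v (evp t pi).
      by move=> pv; rewrite ec evpM (plM pv) ?(evp_neq0 ku).
    apply: (@sum_one_place S u) => //.
    - rewrite (place_isdim pu du) mulr1; apply: le_trans _ leQ; rewrite -ux (vx _ pu) lerDr.
      exact: evp_val_ge0.
    - move=> v vS /eqP vu; have [pv nv] := hS _ vS.
      suff -> : v (evp t pi) = 0 by rewrite mul0r.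
      apply/eqP; rewrite eq_le evp_val_ge0 // andbT leNgt; apply/negP => vpi; apply: vu.
      apply: uu => //; rewrite (vx _ pv); apply: lt_le_trans vpi _; rewrite lerDr.
      exact: evp_val_ge0.
  have [h|h] := orP (irredp_dvdM irr XX).
    by apply: (H v0 'X) => //; rewrite ?evpX ?polyX_eq0.
  by apply: (H v1 (1 - 'X)) => //; rewrite ?evpB ?evp1 ?evpX ?oneX_neq0.
rewrite (bigID (fun v => 0 < v (evp t pi))) /= [X in _ + X]big_seq_cond [X in _ + X]big1 ?addr0;
  last first.
  move=> v /andP[vS nv]; have [pv nvoo] := hS _ vS.
  suff -> : v (evp t pi) = 0 by rewrite mul0r.
  by apply/eqP; rewrite eq_le evp_val_ge0 // andbT leNgt.
rewrite -big_filter; set S' := [seq v <- S | _].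
have hS' v : v \in S' -> places iota v /\ 0 < v (evp t pi).
  by rewrite mem_filter => /andP[vpi vS]; have [pv _] := hS _ vS.
rewrite big_seq (eq_bigr (fun v => (deg v)%:Z)) => [|v vS']; last first.
  have [pv vpi] := hS' _ vS'.
  by rewrite (over_pi_val prQ Qa ku pcK coQq irr piG pv vpi) mul1r.
rewrite -big_seq -PoszM -(big_morph Posz PoszD (erefl _)) lez_nat.
apply: (over_degree_bound prQ Qa ku pcK coQq irr piG) => //.
exact: filter_uniq.
Qed.

Lemma zeros_degree (S : seq (F -> int)) h : h != 0 -> uniq S ->
    (forall v, v \in S -> places iota v /\ v <> voo) ->
  \sum_(v <- S) v (evp t h) * (deg v)%:Z <= Q%:Z * (size h).-1%:Z.
Proof.
move=> h0 uS hS; have [n] := ubnP (size h); elim: n h h0 => // n IHn h h0; rewrite ltnS => szh.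
have [sz1|sz1] := leqP (size h) 1%N.
  have [c hc] : exists c, h = c%:P by exists h`_0; exact: size1_polyC.
  rewrite big_seq big1 ?mulr_ge0 // => v vS; have [pv _] := hS _ vS.
  by rewrite hc evpC (plC pv) mul0r.
have [pi irr /dvdpP[g eh]] := irreducible_factor sz1.
have pi0 := irredp_neq0 irr.
have g0 : g != 0 by apply: contra h0 => /eqP g0; rewrite eh g0 mul0r.
have szE : (size h).-1 = ((size g).-1 + (size pi).-1)%N.
  rewrite eh size_mul //; have := irr.1; have : (0 < size g)%N by rewrite size_poly_gt0.
  by case: (size g) => // k _; case: (size pi) => // j _; rewrite addSn addnS.
have szg : (size g < n)%N.
  apply: leq_trans szh; rewrite eh size_mul //.
  by have := irr.1; case: (size pi) => [|[|k]] // _; rewrite !addnS ltnS leq_addr.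
rewrite szE PoszD mulrDr.
rewrite big_seq (eq_bigr (fun v => v (evp t g) * (deg v)%:Z + v (evp t pi) * (deg v)%:Z)).
  rewrite -big_seq big_split /=; apply: lerD; first exact: IHn.
  exact: zeros_degree_irr.
by move=> v vS; have [pv _] := hS _ vS; rewrite eh evpM (plM pv) ?(evp_neq0 ku) // mulrDl.
Qed.

(** A longest list of distinct zeros exists: each has order and degree at least 1, so [zeros_degree]
    bounds the length. *)
Lemma zeros_seq h : h != 0 -> exists S : seq (F -> int), [/\ uniq S,
  forall v, v \in S -> [/\ places iota v, v <> voo & 0 < v (evp t h)] &
  forall v, places iota v -> v <> voo -> 0 < v (evp t h) -> v \in S].
Proof.
move=> h0.
pose good (S : seq (F -> int)) := uniq S /\
  forall v, v \in S -> [/\ places iota v, v <> voo & 0 < v (evp t h)].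
pose P n := `[< exists2 S, good S & size S = n >].
have exP : exists n, P n by exists 0%N; apply/asboolP; exists [::].
have bdP n : P n -> (n <= Q * (size h).-1)%N.
  move=> /asboolP[S [uS hS] <-].
  have hS' v : v \in S -> places iota v /\ v <> voo by move=> /hS[].
  rewrite -lez_nat PoszM; apply: le_trans (zeros_degree h0 uS hS').
  rewrite -sum1_size (big_morph Posz PoszD (erefl _)) big_seq [X in _ <= X]big_seq.
  apply: ler_sum => v vS; have [pv _ vh] := hS _ vS; have [_ dv] := place_isdim_deg pv.
  by rewrite -[X in X <= _]mulr1; apply: ler_pM => //; rewrite -?gtz0_ge1 // ltz_nat.
case: (ex_maxnP exP bdP) => n /asboolP[S [uS hS] szS] maxn; exists S; split=> // v pv nv vh.
apply/negPn/negP => vS; have : P n.+1.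
  apply/asboolP; exists (v :: S); last by rewrite /= szS.
  split=> [|v']; first by rewrite /= vS.
  by rewrite inE => /orP[/eqP->|/hS].
by move/maxn; rewrite ltnn.
Qed.

Lemma isdim_conditions (S : seq (F -> int)) (beta : (F -> int) -> nat) (W : set F) d :
    (forall v, v \in S -> places iota v /\ W `<=` vge v 0) ->
    subspace iota W -> isdim iota W [set 0] d ->
  exists2 d', isdim iota [set y | W y /\ forall v, v \in S -> vge v (beta v)%:Z y] [set 0] d'
    & d%:Z <= d'%:Z + \sum_(v <- S) (beta v)%:Z * (deg v)%:Z.
Proof.
elim: S W d => [|v S IHS] W d hS sW hd.
  exists d; last by rewrite big_nil addr0.
  by congr isdim : hd; apply/seteqP; split=> [y Wy|y []//]; split.
have [pv Wv] := hS v (mem_head v S).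
have [dv _] := place_isdim_deg pv.
have [d1 le1 hd1] := isdim_step pv sW dv Wv hd (beta v); rewrite add0r in hd1.
have sW1 : subspace iota [set y | W y /\ vge v (beta v)%:Z y].
  case: sW (subspace_vge pv (beta v)%:Z) => a1 a2 a3 [b1 b2 b3].
  by split=> [//|x y [? ?] [? ?]|c x [? ?]]; split; auto.
have [|d2 hd2 le2] := IHS _ _ _ sW1 hd1.
  move=> v' v'S; have [pv' Wv'] : places iota v' /\ W `<=` vge v' 0.
    by apply: hS; rewrite inE v'S orbT.
  by split=> // y [/Wv'].
exists d2.
  congr isdim: hd2; apply/seteqP; split=> y [].
    by move=> [Wy vy] Sy; split=> // v'; rewrite inE => /orP[/eqP->|/Sy].
  move=> Wy Sy; split; first by split=> //; apply: Sy; rewrite mem_head.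
  by move=> v' v'S; apply: Sy; rewrite inE v'S orbT.
rewrite big_cons; move: le1; rewrite -lez_nat PoszD PoszM => le1.
by apply: le_trans le1 _; rewrite [_ * _ + _]addrC addrA lerD2r.
Qed.

Lemma isdim_rr_Vpole (m : nat) :
  riemann_roch_space iota (fun v => if v == voo then m%:Z else 0) = Vpole m.
Proof.
apply/seteqP; split=> z.
  move=> [->|H]; first by case: (subspace_Vpole m).
  split=> [|v pv /eqP nv]; first by right; have := H _ pvoo; rewrite eqxx.
  by right; have := H _ pv; rewrite (negPf nv) oppr0.
move=> [zo zr]; have [->|z0] := eqVneq z 0; [by left|right=> v pv].
have [->|/eqP nv] := eqVneq v voo; first exact: vgeP z0 zo.
by rewrite oppr0; apply: vgeP z0 (zr _ pv nv).
Qed.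

Lemma divisor_degreeE D (S : seq (F -> int)) : uniq S ->
    (forall v, v \in S -> places iota v) -> (forall v, places iota v -> D v != 0 -> v \in S) ->
  divisor_degree iota D = \sum_(v <- S) D v * (deg v)%:Z.
Proof.
move=> uS hS hD; rewrite /divisor_degree (fsbigE S) //; last first.
  move=> v pv vS; suff /eqP -> : D v == 0 by rewrite mul0r.
  by apply: contraNT vS => /(hD _ pv).
rewrite big_seq_cond [RHS]big_seq_cond; apply: eq_bigl => v.
by case: (boolP (v \in S)) => //= vS; apply/mem_set/hS.
Qed.

Lemma multiple_zero_exists (D : (F -> int) -> int) (s : seq (F -> int)) :
  exists2 h : {poly K}, h != 0 & forall v, v \in s -> places iota v -> v <> voo ->
    `|D v| <= v (evp t h).
Proof.
elim: s => [|u s [h h0 hs]]; first by exists 1; rewrite ?oner_eq0.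
case: (pselect (places iota u /\ u <> voo)) => [[pu nu]|nu]; last first.
  exists h => // v; rewrite inE => /orP[/eqP->|/hs//] pu nu'.
  by case: nu.
have [f f0 uf] := evp_zero_exists pu nu.
exists (f ^+ `|D u| * h); first by rewrite mulf_neq0 ?expf_neq0.
move=> v vs pv nv; rewrite evpM evpXn (plM pv) ?expf_neq0 ?(evp_neq0 ku) // (plX pv).
have vf0 := evp_val_ge0 f pv nv; have vh0 := evp_val_ge0 h pv nv.
move: vs; rewrite inE => /orP[/eqP ev|vs]; last first.
  by apply: le_trans (hs _ vs pv nv) _; rewrite lerDr mulr_ge0.
rewrite ev in vf0 vh0 *; rewrite -[X in X <= _]addr0; apply: lerD => //.
by rewrite abszE -[X in X <= _]mul1r ler_wpM2r // -gtz0_ge1.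
Qed.

(** Multiplication by h(t) identifies L(D) with the functions in L(m oo) that vanish to order v(h) -
    D(v) at each zero v of h(t) and have pole order at infinity at most m - k'. The dimension of L(m
    oo) is known, and [zeros_degree] limits the number of conditions. Doubling avoids the half in (Q
    - 1) / 2. *)
Lemma riemann_inequality D : is_divisor iota D ->
  exists2 d, isdim iota (riemann_roch_space iota D) [set 0] d &
    2 * (divisor_degree iota D + 1) <= 2 * d%:Z + (Q.-1)%:Z.
Proof.
move=> /finite_seqP[sD hsD].
have supp v : places iota v -> D v != 0 -> v \in sD.
  by move=> pv Dv; have : [set v | places iota v /\ D v != 0] v by []; rewrite hsD.
have [h h0 hh] := multiple_zero_exists D sD.
have [S [uS SP SZ]] := zeros_seq h0.
have Soo : voo \notin S by apply/negP => /SP[_ + _]; apply.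
have SS v : places iota v -> v <> voo -> D v != 0 -> v \in S.
  move=> pv nv Dv; apply: SZ => //; apply: lt_le_trans (hh v (supp v pv Dv) pv nv).
  by rewrite normr_gt0.
have hD v : v \in S -> D v <= v (evp t h).
  move=> vS; have [pv nv vh] := SP v vS; have [->|Dv] := eqVneq (D v) 0; first exact: ltW.
  by apply: le_trans (ler_norm _) _; exact: hh (supp v pv Dv) pv nv.
pose dh := (size h).-1.
(* Q dh is the pole order of h(t) at infinity, the absolute value makes k at least D(oo), and the
   summand Q puts [m] past all gaps for [count_nongap]. *)
pose k := (`|D voo| + Q)%N; pose m := (k + Q * dh)%N.
have evh0 : evp t h != 0 := evp_neq0 ku h0.
have [d1 hd1 le1] := @isdim_conditions S (fun v => `|v (evp t h) - D v|%N) (Vpole m) _ 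
  (fun v vS => let: And3 pv nv _ := SP v vS in conj pv (fun y Vy => proj2 Vy v pv nv))
  (subspace_Vpole m) (isdim_Vpole m).
set W1 := [set y | _ /\ _] in hd1.
have sW1 : subspace iota W1.
  case: (subspace_Vpole m) => a1 a2 a3; split.
  - by split=> // v _; left.
  - move=> x y [Vx Sx] [Vy Sy]; split=> [|v vS]; first exact: a2.
    by have [pv _ _] := SP v vS; apply: (vgeD pv); [exact: Sx|exact: Sy].
  - move=> c x [Vx Sx]; split=> [|v vS]; first exact: a3.
    by have [pv _ _] := SP v vS; case: (subspace_vge pv `|v (evp t h) - D v|%N) => _ _; apply; exact: Sx.
have W1oo : W1 `<=` vge voo (- m%:Z) by move=> y [[]].
pose k' := `|k%:Z - D voo|%N.
have k'E : k'%:Z = k%:Z - D voo.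
  rewrite /k' abszE ger0_norm // subr_ge0 (le_trans (ler_norm _)) //.
  by rewrite /k PoszD abszE lerDl.
have [d2 le2 hd2] := isdim_step pvoo sW1 doo W1oo hd1 k'.
rewrite muln1 in le2.
set W2 := [set y | _ /\ _] in hd2.
have W2E : W2 = [set evp t h * x | x in riemann_roch_space iota D].
  apply/seteqP; split=> y.
    move=> [[[yo yr] yS] yoo]; exists ((evp t h)^-1 * y); last by rewrite mulrA mulfV ?mul1r.
    have [->|y0] := eqVneq y 0; first by left; rewrite mulr0.
    right=> v pv; rewrite (plM pv) ?invr_eq0 // (plV pv).
    have [ev|/eqP nv] := eqVneq v voo.
      have := vgeP y0 yoo; rewrite ev evp_valoo // k'E /m PoszD PoszM /dh.
      by move: (voo y) (D voo) (Q%:Z * _) => A B C; clear; lia.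
    case: (boolP (v \in S)) => [vS|vS].
      have := vgeP y0 (yS v vS); rewrite abszE ger0_norm ?subr_ge0 ?hD //.
      by move: (v y) (v _) (D v) => A B C; clear; lia.
    have vh0 : v (evp t h) = 0.
      apply/eqP; rewrite eq_le evp_val_ge0 // andbT leNgt; apply: contra vS; exact: SZ.
    have Dv0 : D v = 0 by apply/eqP; apply: contraNT vS; exact: SS.
    by rewrite vh0 Dv0 !oppr0 add0r; exact: vgeP y0 (yr v pv nv).
  move=> [x [->|Lx] <-]; first by rewrite mulr0; case: (sW1) => [[[a1 a2] a3] _ _]; split=> //; left.
  have [->|x0] := eqVneq x 0.
    by rewrite mulr0; case: (sW1) => [[[a1 a2] a3] _ _]; split=> //; left.
  have vy v : places iota v -> v (evp t h * x) = v (evp t h) + v x by move=> pv; rewrite (plM pv).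
  have yoo : vge voo (- m%:Z + k'%:Z) (evp t h * x).
    right; rewrite (vy _ pvoo) evp_valoo // k'E /m PoszD PoszM /dh; have := Lx _ pvoo.
    by move: (voo x) (D voo) (Q%:Z * _) => A B C; clear; lia.
  split=> //; split; last first.
    move=> v vS; have [pv nv _] := SP v vS; right.
    rewrite (vy _ pv) abszE ger0_norm ?subr_ge0 ?hD // lerD2l; exact: Lx.
  split; first by apply: vge_le yoo; rewrite lerDl.
  move=> v pv nv; right; rewrite (vy _ pv).
  have := Lx v pv; case: (boolP (v \in S)) => [/hD|vS].
    by move: (v x) (v _) (D v) => A B C; clear; lia.
  have -> : D v = 0 by apply/eqP; apply: contraNT vS; exact: SS.
  have := evp_val_ge0 h pv nv; by move: (v x) (v _) => A B; clear; lia.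
exists d2.
  have := isdim_scale (invr_neq0 evh0) hd2; congr isdim.
  rewrite W2E; apply/seteqP; split=> x.
    by move=> [_ [y Ly <-] <-]; rewrite mulrA mulVf ?mul1r.
  by move=> Lx; exists (evp t h * x); [exists x|rewrite mulrA mulVf ?mul1r].
have eD : divisor_degree iota D = D voo + \sum_(v <- S) D v * (deg v)%:Z.
  rewrite (@divisor_degreeE D (voo :: S)) ?big_cons ?(place_isdim pvoo doo) ?mulr1 //=.
  - by rewrite Soo.
  - by move=> v; rewrite inE => /orP[/eqP->|/SP[]].
  - move=> v pv Dv; rewrite inE; have [//|/eqP nv] := eqVneq v voo.
    exact: SS.
have zd : \sum_(v <- S) v (evp t h) * (deg v)%:Z <= Q%:Z * dh%:Z.
  by apply: zeros_degree => // v /SP[].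
have sumE : \sum_(v <- S) `|v (evp t h) - D v|%N%:Z * (deg v)%:Z =
    \sum_(v <- S) v (evp t h) * (deg v)%:Z - \sum_(v <- S) D v * (deg v)%:Z.
  rewrite -sumrB big_seq [RHS]big_seq; apply: eq_bigr => v vS.
  by rewrite abszE ger0_norm ?subr_ge0 ?hD // mulrBl.
rewrite sumE in le1.
have cnt : (2 * count nongap (seq.iota 0 m.+1) + Q.-1 = 2 * m.+1)%N.
  by apply: count_nongap => //; rewrite /m /k -addnA addnCA leq_addr.
have mE : m = (k + Q * dh)%N by [].
move: le1 le2 zd eD cnt k'E mE; rewrite -PoszM.
move: (\sum_(v <- S) v _ * _) (\sum_(v <- S) D v * _) (divisor_degree _ _) => A B C.
move: (count _ _) => c; move: (Q * dh)%N => Qdh; clearbody k' m k; clear; lia.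
Qed.

(** The bound is attained by the divisor Q oo: all gaps are below Q, so [count_nongap] already
    applies at m = Q. *)
Lemma kummer_genus g : has_genus iota g <-> (2 * g = Q.-1)%N.
Proof.
have cnt : (2 * count nongap (seq.iota 0 Q.+1) + Q.-1 = 2 * Q.+1)%N by exact: count_nongap.
have upper D : is_divisor iota D ->
    2 * (divisor_degree iota D - (ell iota D)%:Z + 1) <= (Q.-1)%:Z.
  move=> hD; have [d hd] := riemann_inequality hD.
  by rewrite /ell (isdim_dim (subspace0 iota) hd); clear; lia.
pose D0 v := if v == voo then Q%:Z else 0.
have D0d : is_divisor iota D0.
  apply: (@sub_finite_set _ _ [set voo]); last exact: finite_set1.
  by move=> v [_]; rewrite /D0; case: (eqVneq v voo) => [-> //|_]; rewrite eqxx.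
have degD0 : divisor_degree iota D0 = Q%:Z.
  rewrite (@divisor_degreeE D0 [:: voo]) //.
  - by rewrite big_seq1 /D0 eqxx (place_isdim pvoo doo) mulr1.
  - by move=> v; rewrite inE => /eqP->.
  - by move=> v _; rewrite /D0 inE; case: ifP => //; rewrite eqxx.
have ellD0 : ell iota D0 = count nongap (seq.iota 0 Q.+1).
  by rewrite /ell isdim_rr_Vpole; apply: isdim_dim (subspace0 iota) (isdim_Vpole Q).
have eqD0 : 2 * (divisor_degree iota D0 - (ell iota D0)%:Z + 1) = (Q.-1)%:Z.
  by rewrite degD0 ellD0; move: cnt; clear; lia.
split=> [[le [D hD eD]]|hg].
  have := upper D hD; have := le D0 D0d; move: eD eqD0; clear; lia.
split=> [D hD|]; first by have := upper D hD; move: hg; clear; lia.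
by exists D0 => //; move: eqD0 hg; clear; lia.
Qed.

(** * Rational places and affine points *)

Definition affine_points : {set K * K} :=
  [set x | [&& x.1 != 0, x.1 != 1 & x.2 ^+ Q == (kG e a b).[x.1]]].

Definition lies_over (v : F -> int) (x : K * K) :=
  vge v 1 (t - iota x.1) /\ vge v 1 (w - iota x.2).

Lemma vge1_const v c : places iota v -> vge v 1 (iota c) -> c = 0.
Proof.
move=> pv vc; apply/eqP/negPn/negP => c0.
by have := vgeP _ vc; rewrite fmorph_eq0 (plC pv) => /(_ c0).
Qed.

Lemma lies_over_uniq v x y : places iota v -> lies_over v x -> lies_over v y -> x = y.
Proof.
have H c d z : places iota v -> vge v 1 (z - iota c) -> vge v 1 (z - iota d) -> c = d.
  move=> pv hc hd; apply/eqP; rewrite -subr_eq0; apply/eqP/(vge1_const pv).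
  have -> : iota (c - d) = (z - iota d) - (z - iota c) by rewrite rmorphB; ring.
  exact: (vgeB pv).
case: x y => [x1 x2] [y1 y2] pv [/= h1 h2] [/= h3 h4].
by congr pair; [exact: (H _ _ t)|exact: (H _ _ w)].
Qed.

Lemma lies_over_ptval v x P : places iota v -> lies_over v x ->
  vge v 1 (ev2 t w P - iota (ptval x.1 x.2 P)).
Proof.
move=> pv [h1 h2].
have vt : vge v 0 t.
  rewrite -(subrK (iota x.1) t); apply: (vgeD pv); last exact: (vgeC pv).
  exact: vge_le h1.
have vw : vge v 0 w.
  rewrite -(subrK (iota x.2) w); apply: (vgeD pv); last exact: (vgeC pv).
  exact: vge_le h2.
have mulP y z c d : vge v 0 z -> vge v 1 (y - iota c) -> vge v 1 (z - iota d) ->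
    vge v 1 (y * z - iota (c * d)).
  move=> vz hc hd; have -> : y * z - iota (c * d) = (y - iota c) * z + iota c * (z - iota d).
    by rewrite rmorphM; ring.
  apply: (vgeD pv); first by have := vgeM pv hc vz; rewrite addr0.
  by have := vgeM pv (vgeC pv c) hd; rewrite add0r.
have addP y z c d : vge v 1 (y - iota c) -> vge v 1 (z - iota d) ->
    vge v 1 (y + z - iota (c + d)).
  move=> hc hd; have -> : y + z - iota (c + d) = (y - iota c) + (z - iota d) by rewrite rmorphD; ring.
  exact: (vgeD pv).
have evpP f : vge v 1 (evp t f - iota f.[x.1]).
  elim/poly_ind: f => [|f c IHf]; first by rewrite evp0 horner0 (rmorph0 iota) subrr; left.
  rewrite evpD evpM evpX evpC !hornerE; apply: addP; first exact: mulP.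
  by rewrite subrr; left.
elim/poly_ind: P => [|P c IHP]; first by rewrite ev20 /ptval !horner0 (rmorph0 iota) subrr; left.
rewrite ev2D ev2M ev2X ev2C ptvalD ptvalM ptvalX ptvalC.
by apply: addP => //; apply: mulP.
Qed.

Lemma kG_neq0_at tau : tau != 0 -> tau != 1 -> (kG e a b).[tau] != 0.
Proof.
move=> tau0 tau1; rewrite /kG hornerZ hornerM !horner_exp !hornerE.
by rewrite !mulf_neq0 ?(ku_e ku) ?expf_neq0 // subr_eq0 eq_sym.
Qed.

(** X - tau does not divide G at such a point, so the results on unramified places apply to it as
    [pi]. *)
Lemma affine_point_param x : x \in affine_points ->
  prime_ideal_of kR (kM iota t w x.1 x.2) /\ local_param kR (kM iota t w x.1 x.2) (t - iota x.1).
Proof.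
rewrite inE => /and3P[x10 x11 /eqP eqx].
have pRM := kM_prime prQ Qa ku eqx; split=> //.
have -> : t - iota x.1 = evp t ('X - x.1%:P) by rewrite evpB evpX evpC.
apply: (over_pi_param prQ Qa ku pcK coQq (irredp_XsubC x.1)) => //.
  by rewrite dvdp_XsubCl rootE kG_neq0_at.
exists ('X - x.1%:P)%:P; rewrite ev2C ptvalC; split=> //.
by rewrite !hornerE subrr.
Qed.

Lemma affine_point_place x : x \in affine_points ->
  exists v, [/\ places iota v, isdim iota (vge v 0) (vge v 1) 1 & lies_over v x].
Proof.
move=> xA; have [pRM lp] := affine_point_param xA.
have [v [pv vu vO vM]] := local_place pRM lp (kR_C iota t w).
exists v; split=> //.
  exact: (local_degree1 pRM lp pv vO vM (@kM_C _ _ iota t w x.1 x.2)).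
split; apply: vM.
  exists ('X - x.1%:P)%:P; rewrite ev2C evpB evpX evpC ptvalC; split=> //.
  by rewrite !hornerE subrr.
exists ('X - x.2%:P%:P); rewrite ev2B ev2X ev2C evpC ptvalB ptvalX ptvalC; split=> //.
by rewrite hornerC subrr.
Qed.

Lemma lies_over_place_uniq v v' x : x \in affine_points ->
  places iota v -> places iota v' -> lies_over v x -> lies_over v' x -> v = v'.
Proof.
move=> xA pv pv' ov ov'; have [pRM lp] := affine_point_param xA.
have key u : places iota u -> lies_over u x ->
    kM iota t w x.1 x.2 `<=` vge u 1 /\ 0 < u (t - iota x.1).
  move=> pu ou; split.
    by move=> _ [P [-> pt0]]; have := lies_over_ptval P pu ou; rewrite pt0 (rmorph0 iota) subr0.
  case: lp => _ u_neq0 _; case: ou => h _; have := vgeP u_neq0 h; by rewrite gtz0_ge1.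
have [vM vu] := key v pv ov; have [vM' vu'] := key v' pv' ov'.
apply: (local_place_uniq pRM lp pv pv') => //; exact: kM_val0.
Qed.

(** The point is given by the residues of [t] and [w]; it lies on the curve because W^Q - G
    evaluates to 0 in [F]. *)
Lemma rational_place_point v : places iota v -> deg v = 1%N ->
    v t = 0 -> v s = 0 -> v w = 0 ->
  exists2 x, x \in affine_points & lies_over v x.
Proof.
move=> pv dv vt vs vw; have [hd _] := place_isdim_deg pv; rewrite dv in hd.
have res := isdim1_residue pv hd.
have [|tau htau] := res t; first by right; rewrite vt.
have [|om hom] := res w; first by right; rewrite vw.
have ov : lies_over v (tau, om) by [].
exists (tau, om) => //; rewrite inE /=; apply/and3P; split.
- apply/eqP => h; rewrite h (rmorph0 iota) subr0 in htau.
  by have := vgeP t0 htau; rewrite vt.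
- apply/eqP => h; rewrite h (rmorph1 iota) in htau.
  by have := vgeP _ htau; rewrite -opprB oppr_eq0 (plN pv) vs => /(_ s0).
- rewrite -subr_eq0; apply/eqP/(vge1_const pv).
  have := lies_over_ptval (kPhi Q e a b) pv ov.
  rewrite (ev2_kPhi ku) sub0r => /(vgeN pv); rewrite opprK; congr (vge v 1 (iota _)).
  by rewrite ptvalB ptvalC /ptval hornerXn -rmorphXn hornerC.
Qed.

Lemma rational_places_card :
  (rational_places iota #= `I_(3 + #|affine_points|))%card.
Proof.
have /choice[Psi hPsi] (x : K * K) : exists v, x \in affine_points ->
    [/\ places iota v, isdim iota (vge v 0) (vge v 1) 1 & lies_over v x].
  case: (boolP (x \in affine_points)) => [xA|_]; last by exists v0.
  by have [v hv] := affine_point_place xA; exists v.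
pose L := [:: v0; v1; voo] ++ [seq Psi x | x <- enum affine_points].
have Psi0 x : x \in affine_points -> Psi x t = 0 /\ Psi x s = 0.
  move=> xA; have [pv _ [h _]] := hPsi x xA; move: xA; rewrite inE => /and3P[x10 x11 _].
  have cst (c : K) z : c != 0 -> vge (Psi x) 1 (z - iota c) -> Psi x z = 0.
    move=> c0 hc; have ic : iota c != 0 by rewrite fmorph_eq0.
    have := @plD_dom _ _ _ _ pv (iota c) (z - iota c) ic.
    by rewrite (plC pv) add0r => /(_ hc)[_]; rewrite addrC subrK.
  split; first exact: cst x10 h.
  apply: (cst (1 - x.1)); first by rewrite subr_eq0 eq_sym.
  have -> : s - iota (1 - x.1) = - (t - iota x.1) by rewrite rmorphB rmorph1; ring.
  exact: (vgeN pv).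
have uL : uniq L.
  rewrite cat_uniq; apply/and3P; split.
  - have ne (u v : F -> int) : u <> v -> (u == v) = false by move=> uv; apply/eqP.
    rewrite !cons_uniq !in_cons !in_nil !orbF !(ne _ _ v0_voo) (ne _ _ v1_voo) (ne v0 v1) //.
    by move=> h; have := Qz; rewrite -v0t h v1t.
  - apply/hasPn => u /mapP[x]; rewrite mem_enum => xA ->.
    have [pt ps] := Psi0 _ xA; rewrite !in_cons in_nil orbF.
    apply/negP => /or3P[] /eqP h.
    + by have := Qz; rewrite -v0t -h pt.
    + by have := Qz; rewrite -v1s -h ps.
    + by have := Qz; rewrite -oppr_lt0 -voot -h pt.
  - rewrite map_inj_in_uniq ?enum_uniq // => x y; rewrite !mem_enum => xA yA exy.
    have [pv _ ox] := hPsi x xA; have [_ _ oy] := hPsi y yA.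
    by apply: lies_over_uniq pv ox _; rewrite exy.
have memL v : (v \in [fset u in L]%fset) = (v \in L) by rewrite in_fset.
have -> : rational_places iota = [set` [fset u in L]%fset].
  apply/seteqP; split=> v.
    move=> [pv dv]; rewrite /mkset memL /L mem_cat !in_cons in_nil orbF.
    have [->|->|->|[vt vs vw]] := place_cases pv; rewrite ?eqxx ?orbT //.
    have [x xA ox] := rational_place_point pv dv vt vs vw.
    apply/orP; right; apply/mapP; exists x; first by rewrite mem_enum.
    by have [pv' _ ox'] := hPsi x xA; apply: lies_over_place_uniq xA pv pv' ox ox'.
  rewrite /mkset memL /L mem_cat !in_cons in_nil orbF => /orP[/or3P[]/eqP->|/mapP[x]].
  - by split=> //; exact: place_isdim.
  - by split=> //; exact: place_isdim.
  - by split=> //; exact: place_isdim.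
  - by rewrite mem_enum => /hPsi[pv dv _] ->; split=> //; exact: place_isdim.
apply/card_eq_fsetP; rewrite card_fseq undup_id // size_cat size_map -cardE.
by [].
Qed.

End KummerGlobal.

(** * Geometric irreducibility *)

Section GeometricIrreducibility.
Variables (K : finFieldType).
Local Notation q := #|K|.
Hypothesis pcK : [pchar K].-nat q.

Lemma pnat_rmorph (F : fieldType) (iota : {rmorphism K -> F}) k : [pchar F].-nat (q ^ k)%N.
Proof.
rewrite pnatX; apply/orP; left; apply: sub_in_pnat pcK => p _; exact: rmorph_pchar.
Qed.

Lemma expq_inj (F : fieldType) (iota : {rmorphism K -> F}) k (x y : F) :
  x ^+ (q ^ k) = y ^+ (q ^ k) -> x = y.
Proof.
move=> e1; apply/eqP; rewrite -subr_eq0.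
have : (x - y) ^+ (q ^ k) == 0.
  by rewrite exprDn_pchar ?exprNn_pchar ?(pnat_rmorph iota) // e1 subrr.
by rewrite expf_eq0 => /andP[].
Qed.

(** By [poly_frob_period] the powers x^(q^i) and x^(q^j) agree, and raising to q^i is injective. *)
Lemma algebraic_frob (F : fieldType) (iota : {rmorphism K -> F}) (x : F) :
  algebraicOver iota x -> exists2 k : nat, (0 < k)%N & x ^+ (q ^ k) = x.
Proof.
move=> [p p0 /rootP px]; have [i [j [lt_ij /dvdpP[g eg]]]] := poly_frob_period p0.
exists (j - i)%N; first by rewrite subn_gt0.
apply: (@expq_inj _ iota i); rewrite -exprM -expnD subnK ?(ltnW lt_ij) //.
apply/eqP; rewrite -subr_eq0; have := congr1 (peval iota x) eg.
by rewrite evpB !evpXn evpX evpM (evpE iota x p) px mulr0 => ->.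
Qed.

Lemma sum_expq (F : fieldType) (iota : {rmorphism K -> F}) k (I : Type) (r : seq I)
    (P : pred I) (f : I -> F) :
  (\sum_(i <- r | P i) f i) ^+ (q ^ k) = \sum_(i <- r | P i) f i ^+ (q ^ k).
Proof.
apply: (big_morph (fun x : F => x ^+ (q ^ k))) => [x y|].
  by rewrite exprDn_pchar ?(pnat_rmorph iota).
by rewrite expr0n expn_eq0 -[_ == 0%N]negbK -lt0n (ltnW (finNzRing_gt1 K)).
Qed.

(* Elimination with the Frobenius power [x ^+ q ^ k], whose fixed field in F is K:
   it fixes the coefficients [a i] but moves the vectors [b i]. *)
Lemma frob_fixed_disjoint (F L : fieldType) (iota : {rmorphism K -> F}) (j : {rmorphism F -> L})
    (k : nat) :
    (forall x : F, x ^+ (q ^ k) = x -> exists c, x = iota c) ->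
  forall d (b : 'I_d -> F) (a : 'I_d -> L), free_mod iota [set 0] b ->
    (forall i, a i ^+ (q ^ k) = a i) -> \sum_(i < d) a i * j (b i) = 0 -> forall i, a i = 0.
Proof.
move=> fixK; have expC c : iota c ^+ (q ^ k) = iota c.
  by rewrite -rmorphXn; congr (iota _); elim: (k) => [|m IHm];
    rewrite ?expn0 ?expr1 // expnSr exprM IHm expf_card.
elim=> [|d IHd] b a fb fa; first by move=> _ [].
set wd := widen_ord (leqnSn d).
have bm0 : b ord_max != 0.
  apply/eqP => b0; have := fb (fun i => if i == ord_max then 1 else 0).
  rewrite big_ord_recr /= eqxx b0 mulr0 addr0 big1 => [/(_ erefl ord_max)|i _].
    by rewrite eqxx => /eqP; rewrite oner_eq0.
  by rewrite -val_eqE /= ltn_eqF // (rmorph0 iota) mul0r.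
rewrite big_ord_recr /= -/wd => sum0.
pose be i := b (wd i) / b ord_max.
have jbm0 : j (b ord_max) != 0 by rewrite fmorph_eq0.
have sum1 : \sum_(i < d) a (wd i) * j (be i) + a ord_max = 0.
  apply: (mulIf jbm0); rewrite mul0r mulrDl -[RHS]sum0; congr (_ + _).
  rewrite mulr_suml; apply: eq_bigr => i _; rewrite -mulrA -rmorphM; congr (_ * j _).
  by rewrite divfK.
have sum2 : \sum_(i < d) a (wd i) * j (be i ^+ (q ^ k)) + a ord_max = 0.
  have zN : (0 : L) ^+ (q ^ k) = 0.
    by rewrite expr0n expn_eq0 -[_ == 0%N]negbK -lt0n (ltnW (finNzRing_gt1 K)).
  have := congr1 (fun x : L => x ^+ (q ^ k)) sum1.
  rewrite exprDn_pchar ?(pnat_rmorph (j \o iota)) // fa (sum_expq (j \o iota)) zN => e1.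
  rewrite -[RHS]e1; congr (_ + _); apply: eq_bigr => i _.
  by rewrite [RHS]exprMn fa rmorphXn.
have a0 i : a (wd i) = 0.
  apply: (IHd (fun i => be i ^+ (q ^ k) - be i) (fun i => a (wd i))) => //; last first.
    transitivity ((\sum_(i < d) a (wd i) * j (be i ^+ (q ^ k)) + a ord_max) -
       (\sum_(i < d) a (wd i) * j (be i) + a ord_max)).
      rewrite opprD addrACA subrr addr0 -sumrB; apply: eq_bigr => i0 _.
      by rewrite rmorphB mulrBr.
    by rewrite sum1 sum2 subrr.
  move=> c /= hc.
  (* A relation among the differences makes the same combination of the [be i] a fixed element,
     hence a constant; multiplied by [b ord_max] this is a relation among the original vectors. *)
  have [|ka eka] := fixK (\sum_(i < d) iota (c i) * be i).
    rewrite (sum_expq iota); apply/eqP; rewrite -subr_eq0 -sumrB; apply/eqP; rewrite -[RHS]hc.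
    by apply: eq_bigr => i0 _; rewrite exprMn expC mulrBr.
  pose c' (i : 'I_d.+1) := if unlift ord_max i is Some i' then c i' else - ka.
  have c'wd i0 : c' (wd i0) = c i0.
    rewrite /c'; have -> : wd i0 = lift ord_max i0.
      by apply/val_inj; rewrite /= /bump leqNgt ltn_ord.
    by rewrite liftK.
  move=> i0; rewrite -c'wd; apply: fb => /=; rewrite big_ord_recr /= -/wd.
  rewrite {2}/c' unlift_none rmorphN mulNr -eka mulr_suml -sumrB big1 // => i1 _.
  by rewrite c'wd -mulrA divfK // subrr.
move=> i; case: (unliftP ord_max i) => [i'|] ->.
  have -> : lift ord_max i' = wd i' by apply/val_inj; rewrite /= /bump leqNgt ltn_ord.
  exact: a0.
by move: sum1; rewrite big1 ?add0r // => i' _; rewrite a0 mul0r.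
Qed.

(** With a rational place, each Frobenius power has fixed field K in [F]: a nonzero fixed [x] has
    value 0, and if [c] is its residue, x - c is fixed of positive value, hence 0. One power fixes
    all the algebraic coefficients, and [frob_fixed_disjoint] applies. *)
Lemma rational_place_geom_irr (F : fieldType) (iota : {rmorphism K -> F}) (v : F -> int) :
  places iota v -> isdim iota (vge v 0) (vge v 1) 1 -> geometrically_irreducible iota.
Proof.
move=> pv dv L j d b fb a alg_a sum0.
have /choice[k hk] i : exists k, (0 < k)%N /\ a i ^+ (q ^ k) = a i.
  by have [k k0 ak] := algebraic_frob (alg_a i); exists k.
pose m := (\prod_(i < d) k i)%N.
have m0 : (0 < m)%N by rewrite prodn_gt0 // => i; case: (hk i).
apply: (@frob_fixed_disjoint F L iota j m) sum0 => // [x fx|i]; last first.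
  have /dvdnP[c ->] : (k i %| m)%N by rewrite /m (bigD1 i) //= dvdn_mulr.
  have [_ ak] := hk i; elim: c => [|c IHc]; first by rewrite mul0n expn0 expr1.
  by rewrite mulSn expnD exprM ak IHc.
have qm1 : (1 < q ^ m)%N by rewrite -(exp1n m) ltn_exp2r // finNzRing_gt1.
have [->|x0] := eqVneq x 0; first by exists 0; rewrite rmorph0.
have vx : v x = 0.
  have := congr1 v fx; rewrite (plX pv) => /eqP; rewrite -subr_eq0 -{2}[v x]mulr1 -mulrBr.
  by rewrite mulf_eq0 => /orP[/eqP//|]; rewrite subr_eq0 eqz_nat gtn_eqF.
have [|c hc] := isdim1_residue pv dv (z := x); first by right; rewrite vx.
exists c; apply/eqP; rewrite -subr_eq0; apply/negPn/negP => xc0.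
have fxc : (x - iota c) ^+ (q ^ m) = x - iota c.
  rewrite exprDn_pchar ?exprNn_pchar ?(pnat_rmorph iota) // fx -rmorphXn; congr (_ - iota _).
  by elim: (m) => [|n IHn]; rewrite ?expn0 ?expr1 // expnSr exprM IHn expf_card.
have := vgeP xc0 hc; have := congr1 v fxc; rewrite (plX pv).
by move: (v _) (q ^ m)%N qm1 => z n; clear; nia.
Qed.

End GeometricIrreducibility.

(** * Counting rational points *)

Section FiniteFieldCounting.
Variable K : finFieldType.
Local Notation N := (#|K|.-1).

Definition unity (d : nat) : {set K} := [set x | x ^+ d == 1].

Let N_gt0 : (0 < N)%N.
Proof. by rewrite -ltnS prednK ?finNzRing_gt1 // ltnW ?finNzRing_gt1. Qed.

Lemma expf_card1 (x : K) : x != 0 -> x ^+ N = 1.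
Proof.
move=> x0; apply: (mulfI x0); rewrite -exprS prednK ?expf_card ?mulr1 //.
exact: ltnW (finNzRing_gt1 K).
Qed.

Lemma primitive_exists d : (d %| N)%N -> exists y : K, d.-primitive_root y.
Proof.
move=> dN; pose rs := enum (predC1 (0 : K)).
have szrs : size rs = N by rewrite -cardE cardC1.
have /hasP[z _ pz] : has N.-primitive_root rs.
  apply: has_prim_root; rewrite ?szrs ?enum_uniq //.
  by apply/allP => x; rewrite mem_enum unity_rootE => /expf_card1->.
exists (z ^+ (N %/ d)); exact: dvdn_prim_root.
Qed.

Lemma card_unity d : (d %| N)%N -> #|unity d| = d.
Proof.
move=> dN; have [y py] := primitive_exists dN.
pose f (i : 'I_d) := y ^+ i.
have -> : unity d = f @: [set: 'I_d]%SET.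
  apply/setP => x; rewrite inE; apply/eqP/imsetP => [xd|[i _ ->]].
    by have [i ->] := prim_rootP py xd; exists i; rewrite ?inE.
  by rewrite /f -exprM mulnC exprM (prim_expr_order py) expr1n.
rewrite card_imset ?cardsT ?card_ord // => i j /eqP; rewrite /f (eq_prim_root_expr py).
by rewrite !modn_small // => /eqP/val_inj.
Qed.

(** The k-th roots of unity are the powers of y^d for a primitive [y] of order d k, so a solution
    exists, and the fibre is its coset under the d-th roots of unity. *)
Lemma card_power_fiber d k c : (d * k %| N)%N -> c \in unity k ->
  #|[set x in unity (d * k) | x ^+ d == c]%SET| = d.
Proof.
move=> dkN; rewrite inE => /eqP ck.
have [y py] := primitive_exists dkN.
have dk0 : (0 < d * k)%N := prim_order_gt0 py.
have [d0 k0] : (0 < d)%N /\ (0 < k)%N by move: dk0; rewrite muln_gt0 => /andP.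
have pyd : k.-primitive_root (y ^+ d).
  by have := dvdn_prim_root py (dvdn_mull d (dvdnn k)); rewrite mulnK.
have [i ei] := prim_rootP pyd ck.
have y0 : y ^+ i != 0.
  by rewrite expf_neq0 //; apply/eqP => y0; have := prim_expr_order py;
    rewrite y0 expr0n gtn_eqF // => /esym/eqP; rewrite oner_eq0.
have dN : (d %| N)%N by apply: dvdn_trans dkN; exact: dvdn_mulr.
rewrite -[RHS](card_unity dN) -(card_imset (unity d) (mulfI y0)); apply: eq_card => x.
rewrite !inE; apply/andP/imsetP.
  move=> [_ /eqP xd]; exists (x / y ^+ i); last by rewrite mulrC divfK.
  by rewrite inE expr_div_n xd ei -!exprM [(d * i)%N]mulnC mulfV // exprM expf_neq0.
move=> [u]; rewrite inE => /eqP ud ->; split; last by rewrite exprMn ud mulr1 -exprM mulnC exprM -ei.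
by rewrite exprMn [in X in _ * X]exprM ud expr1n mulr1 -exprM mulnC exprM (prim_expr_order py) expr1n.
Qed.

End FiniteFieldCounting.

(** * The number of affine points *)

Section AffinePointCount.
Variables (K : finFieldType) (q Q : nat) (e : K) (a b : nat).
Hypotheses (hK : #|K| = (q ^ 2)%N) (prQ : prime Q) (pcq : [pchar K].-nat q).
Hypotheses (Qa : ~~ (Q %| a)%N) (Qb : ~~ (Q %| b)%N) (Qab : ~~ (Q %| a + b)%N).
Hypotheses (e0 : e != 0) (eq1 : e ^+ q.-1 = 1).

Local Notation A := (affine_points Q e a b).
Local Notation N := (#|K|.-1).

Let Q_gt0 : (0 < Q)%N := prime_gt0 prQ.

Let q_gt1 : (1 < q)%N.
Proof. by have := finNzRing_gt1 K; rewrite hK; case: (q) => [|[]]. Qed.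

Let NE : N = (q.-1 * q.+1)%N.
Proof. by rewrite hK -subn1 -[X in (_ - X)%N](exp1n 2) subn_sqr subn1 addn1. Qed.

Definition value_at (tau : K) : K := e * tau ^+ a * (1 - tau) ^+ b.

Lemma kG_value tau : (kG e a b).[tau] = value_at tau.
Proof. by rewrite /kG hornerZ hornerM !horner_exp !hornerE /value_at ?mulrA. Qed.

Lemma value_at_neq0 tau : tau != 0 -> tau != 1 -> value_at tau != 0.
Proof.
move=> tau0 tau1; rewrite /value_at !mulf_neq0 ?expf_neq0 // subr_eq0 eq_sym //.
Qed.

Lemma card_affine_points :
  #|A| = (\sum_(tau : K | (tau != 0%R) && (tau != 1%R)) #|[set om : K | om ^+ Q == value_at tau]%SET|)%N.
Proof.
rewrite -sum1_card (eq_bigl (fun x : K * K => ((x.1 != 0) && (x.1 != 1)) && (x.2 ^+ Q == value_at x.1))).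
  rewrite -(pair_big_dep (fun tau : K => (tau != 0) && (tau != 1)) (fun tau om => om ^+ Q ==
    value_at tau) (fun _ _ => 1%N)) /=.
  by apply: eq_bigr => tau _; rewrite -sum1_card; apply: eq_bigl => om; rewrite inE.
by move=> x; rewrite inE kG_value andbA.
Qed.

Lemma card_two_out : #|[pred tau : K | (tau != 0) && (tau != 1)]| = (q ^ 2 - 2)%N.
Proof.
have := cardC (pred2 (0 : K) 1); rewrite card2 eq_sym oner_eq0 /= hK => <-.
by rewrite addKn; apply: eq_card => x; rewrite !inE negb_or.
Qed.

Lemma card_affine_coprime : coprime Q N -> #|A| = (q ^ 2 - 2)%N.
Proof.
move=> co; rewrite card_affine_points -card_two_out -sum1_card.
apply: eq_big => [tau|tau /andP[tau0 tau1]]; first by rewrite inE.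
have c0 := value_at_neq0 tau0 tau1; set c := value_at tau in c0 *.
have N0 : (0 < N)%N by rewrite NE muln_gt0 andbT -subn1 subn_gt0.
have [km kn ek _] := egcdnP N Q_gt0.
rewrite (eqP co) in ek.
rewrite -(cards1 (c ^+ km)); apply: eq_card => om; rewrite !inE; apply/eqP/eqP => [<-|->].
  have [->|om0] := eqVneq om 0.
    by rewrite -exprM expr0n gtn_eqF // muln_gt0 Q_gt0; move: ek; case: (km) => //; lia.
  by rewrite -exprM [(Q * km)%N]mulnC ek exprD expr1 mulnC exprM expf_card1 // expr1n mul1r.
by rewrite -exprM ek exprD expr1 mulnC exprM expf_card1 // expr1n mul1r.
Qed.

Lemma card_fiber tau : (Q %| N)%N -> tau != 0 -> tau != 1 ->
  #|[set om : K | om ^+ Q == value_at tau]%SET| = (Q * (value_at tau \in unity K (N %/ Q)))%N.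
Proof.
move=> QN tau0 tau1; have c0 := value_at_neq0 tau0 tau1; set c := value_at tau in c0 *.
have NQ : (Q * (N %/ Q))%N = N by rewrite mulnC divnK.
have [cU|cU] := boolP (c \in _).
  rewrite muln1; have := @card_power_fiber K Q (N %/ Q) c; rewrite NQ => /(_ (dvdnn _) cU) eF;
    rewrite -[RHS]eF.
  apply: eq_card => om; rewrite !inE; case: (om ^+ Q =P c) => [h|_]; rewrite ?andbF // andbT;
    symmetry; apply/eqP.
  apply: expf_card1; apply: contra c0 => /eqP om0; rewrite -h om0 expr0n gtn_eqF //.
rewrite muln0; apply: eq_card0 => om; rewrite !inE; apply: contraNF cU => /eqP h.
rewrite inE -h -exprM NQ; apply/eqP/expf_card1; apply: contra c0 => /eqP om0.
by rewrite -h om0 expr0n gtn_eqF.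
Qed.

Lemma card_affine_dvd : (Q %| N)%N ->
  #|A| = (Q * #|[set tau : K | [&& tau != 0%R, tau != 1%R & value_at tau \in unity K (N %/ Q)]]%SET|)%N.
Proof.
move=> QN; rewrite card_affine_points -sum1_card big_distrr /= big_mkcond [RHS]big_mkcond /=.
apply: eq_bigr => tau _; rewrite inE andbA; case: andP => [[tau0 tau1]|_] //=.
by rewrite card_fiber //; case: (_ \in _); rewrite ?muln1 ?muln0.
Qed.

Section Semiprimitive.
Variable m : nat.
Hypothesis qm : q.+1 = (m * Q)%N.

Let U := unity K q.+1.

Let QN : (Q %| N)%N. Proof. by rewrite NE qm mulnA dvdn_mull. Qed.
Let m_gt0 : (0 < m)%N. Proof. by case: (m) qm. Qed.
Let mN : (m * Q %| N)%N. Proof. by rewrite NE -qm dvdn_mull. Qed.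

Lemma frobB (x y : K) : (x - y) ^+ q = x ^+ q - y ^+ q.
Proof. by rewrite exprDn_pchar // exprNn_pchar. Qed.

(** Since q^2 - 1 = (q - 1) m Q, the nonzero Q-th powers are the c with c^((q-1) m) = 1. For c =
    [value_at tau] this power is (al^a be^b)^m, where (al, be) are the slopes of [tau]; the constant
    [e] drops out because e^(q-1) = 1. *)
Definition slope_pairs : {set K * K} :=
  [set x in finset.setX U U | (x.1 ^+ a * x.2 ^+ b) ^+ m == 1]%SET.

Definition slopes (tau : K) : K * K := (tau ^+ q.-1, (1 - tau) ^+ q.-1).

Lemma exp_predq (x : K) : x != 0 -> x * x ^+ q.-1 = x ^+ q.
Proof. by rewrite -exprS prednK // ltnW. Qed.

(* Both slopes of [tau] lie in the group of norm-one elements and [tau] is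
   recovered from them as (beta - 1) / (beta - alpha). *)
Lemma slopes_image :
  [set slopes tau | tau in [set tau : K | (tau ^+ q != tau) && (value_at tau \in unity K (N %/
    Q))]%SET]%SET =
  [set x in slope_pairs | [&& x.1 != 1, x.2 != 1 & x.1 != x.2]]%SET.
Proof.
have NQ : (N %/ Q = q.-1 * m)%N by rewrite NE qm mulnA mulnK.
have valE tau : value_at tau ^+ (N %/ Q) = ((tau ^+ q.-1) ^+ a * ((1 - tau) ^+ q.-1) ^+ b) ^+ m.
  rewrite NQ exprM /value_at !exprMn eq1 expr1n mul1r; congr (_ * _);
  by rewrite -!exprM; congr (_ ^+ _); lia.
apply/setP => -[al be]; apply/imsetP/idP => [[tau]|].
  rewrite !inE valE => /andP[tq /eqP vt] [-> ->].
  have tau0 : tau != 0 by apply: contra tq => /eqP->; rewrite expr0n gtn_eqF // ltnW.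
  have tau1 : 1 - tau != 0.
    by apply: contra tq; rewrite subr_eq0 => /eqP <-; rewrite expr1n.
  have nU (x : K) : x != 0 -> (x ^+ q.-1) ^+ q.+1 = 1 by move=> x0; rewrite -exprM -NE expf_card1.
  rewrite !nU // vt !eqxx /=.
  have al1 : tau ^+ q.-1 != 1.
    by apply: contra tq => /eqP h; rewrite -exp_predq // h mulr1.
  have be1 : (1 - tau) ^+ q.-1 != 1.
    apply: contra tq => /eqP h; have := exp_predq tau1; rewrite h mulr1 frobB expr1n => /eqP.
    by rewrite (inj_eq (addrI _)) eqr_opp eq_sym.
  (* If the slopes are equal, x -> x^q multiplies tau and 1 - tau, hence their sum 1, by the same
     factor, which must be 1. *)
  rewrite al1 be1 /=; apply: contra al1 => /eqP h.
  have := frobB 1 tau; rewrite expr1n -!exp_predq // -h => e1.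
  apply/eqP; have -> : tau ^+ q.-1 = (1 - tau) * tau ^+ q.-1 + tau * tau ^+ q.-1 by ring.
  by rewrite e1; ring.
rewrite !inE /= => /andP[/andP[/andP[/eqP alU /eqP beU] /eqP ab] /and3P[al1 be1 albe]].
have n0 (x : K) : x ^+ q.+1 = 1 -> x != 0.
  by move=> xU; apply/eqP => x0; move/eqP: xU; rewrite x0 expr0n /= eq_sym oner_eq0.
have al0 := n0 _ alU; have be0 := n0 _ beU.
have Uq (x : K) : x ^+ q.+1 = 1 -> x ^+ q = x^-1.
  by move=> xU; apply: (mulIf (n0 _ xU)); rewrite mulVf ?n0 // -exprSr.
have d0 : be - al != 0 by rewrite subr_eq0 eq_sym.
pose tau := (be - 1) / (be - al).
have tau0 : tau != 0 by rewrite mulf_neq0 // ?invr_eq0 // subr_eq0.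
have tau1E : 1 - tau = (1 - al) / (be - al) by rewrite /tau; field.
have tau1 : 1 - tau != 0 by rewrite tau1E mulf_neq0 ?invr_eq0 // subr_eq0 eq_sym.
have dV0 : be^-1 - al^-1 != 0 by rewrite subr_eq0 (inj_eq invr_inj) eq_sym.
(* The q-th power inverts [al] and [be], which multiplies (be - 1) / (be - al) by [al]. *)
have tq : tau ^+ q = al * tau.
  rewrite /tau expr_div_n !frobB expr1n !Uq //.
  have -> : be^-1 - al^-1 = - (be - al) / (al * be) by field; rewrite al0 be0.
  by field; rewrite al0 be0 d0 oppr_eq0 d0.
have t1q : (1 - tau) ^+ q = be * (1 - tau).
  rewrite frobB expr1n tq /tau; field; exact: d0.
have e1 : tau ^+ q.-1 = al by apply: (mulfI tau0); rewrite exp_predq // tq mulrC.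
have e2 : (1 - tau) ^+ q.-1 = be by apply: (mulfI tau1); rewrite exp_predq // t1q mulrC.
exists tau; last by rewrite /slopes e1 e2.
rewrite !inE valE e1 e2 ab eqxx andbT tq.
by apply: contra al1 => /eqP h; apply/eqP/(mulIf tau0); rewrite h mul1r.
Qed.

Lemma slopes_inj : {in [set tau : K | (tau ^+ q != tau) && (value_at tau \in unity K (N %/ Q))]%SET &,
  injective slopes}.
Proof.
have H (tau : K) : tau ^+ q != tau ->
    (1 - tau) ^+ q.-1 - tau ^+ q.-1 != 0 /\
    tau * ((1 - tau) ^+ q.-1 - tau ^+ q.-1) = (1 - tau) ^+ q.-1 - 1.
  move=> tq.
  have tau0 : tau != 0 by apply: contra tq => /eqP->; rewrite expr0n gtn_eqF // ltnW.
  have tau1 : 1 - tau != 0 by apply: contra tq; rewrite subr_eq0 => /eqP <-; rewrite expr1n.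
  have := frobB 1 tau; rewrite expr1n -!exp_predq //.
  move: ((1 - tau) ^+ q.-1) (tau ^+ q.-1) (exp_predq tau0) => be al ta h.
  split; last by transitivity (be - (1 - tau) * be - tau * al); [ring|rewrite h; ring].
  apply: contra tq; rewrite subr_eq0 => /eqP eb; rewrite -ta -[X in _ == X]mulr1; apply/eqP.
  congr (_ * _); rewrite eb in h; transitivity ((1 - tau) * al + tau * al); first by ring.
  by rewrite h; ring.
move=> x y; rewrite !inE => /andP[xq _] /andP[yq _] [e1 e2].
have [d0 ex] := H x xq; have [_ ey] := H y yq.
by apply: (mulIf d0); rewrite ex e1 e2 -ey -e1 -e2 e1 e2.
Qed.

Let mdN : (m %| N)%N. Proof. by apply: dvdn_trans mN; exact: dvdn_mulr. Qed.

Lemma unity_sub (x : K) : x \in unity K m -> x ^+ q.+1 = 1.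
Proof. by rewrite inE qm exprM => /eqP->; rewrite expr1n. Qed.

Lemma unity_coprime_exp (x : K) c : x ^+ q.+1 = 1 -> ~~ (Q %| c)%N ->
  ((x ^+ c) ^+ m == 1) = (x \in unity K m).
Proof.
move=> xU Qc; rewrite inE; apply/eqP/eqP => [h|h]; last by rewrite -exprM mulnC exprM h expr1n.
have [km kn ek _] := egcdnP c Q_gt0.
have co : gcdn Q c = 1%N by apply/eqP; rewrite -/(coprime Q c) prime_coprime.
rewrite co in ek; have : (x ^+ m) ^+ (km * Q) = (x ^+ m) ^+ (kn * c + 1) by rewrite ek.
rewrite exprD expr1 [(km * Q)%N]mulnC exprM -(exprM x) -qm xU expr1n.
by rewrite [(kn * c)%N]mulnC exprM -(exprM x) [(m * c)%N]mulnC (exprM x) h expr1n mul1r.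
Qed.

(** The m-th powers phi, theta of [al], [be] are Q-th roots of unity, and the condition phi^a
    theta^b = 1 means theta = phi^k. For each of the q + 1 choices of [al] there remains a fibre of
    be -> be^m, with m elements. *)
Lemma card_slope_pairs : #|slope_pairs| = (q.+1 * m)%N.
Proof.
have qN : (q.+1 %| N)%N by rewrite NE dvdn_mull.
have b0 : (0 < b)%N by case: (b) Qb => //; rewrite dvdn0.
have [km kn ek _] := egcdnP Q b0.
have co : gcdn b Q = 1%N by apply/eqP; rewrite gcdnC -/(coprime Q b) prime_coprime.
rewrite co in ek.
(* [k] solves [a + k b = 0] modulo [Q] *)
pose k := (Q.-1 * a * km)%N.
have akb : (a + k * b = (Q.-1 * a * kn + a) * Q)%N.
  by rewrite /k -mulnA ek; move: (prednK Q_gt0); move: Q.-1 => Q' <-; clear; lia.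
have key (ph th : K) : ph ^+ Q = 1 -> th ^+ Q = 1 ->
    (ph ^+ a * th ^+ b == 1) = (th == ph ^+ k).
  move=> phQ thQ; have ph0 : ph != 0.
    by apply/eqP => h; move/eqP: phQ; rewrite h expr0n gtn_eqF //= eq_sym oner_eq0.
  have phk : ph ^+ a * ph ^+ (k * b) = 1 by rewrite -exprD akb mulnC exprM phQ expr1n.
  apply/eqP/eqP => [h|->]; last by rewrite -exprM.
  have e1 : th ^+ b = ph ^+ (k * b).
    by apply: (mulfI (expf_neq0 a ph0)); rewrite h phk.
  have : th ^+ (b * km) = ph ^+ (k * (b * km)) by rewrite exprM e1 -exprM mulnA.
  rewrite [(b * km)%N]mulnC ek mulnDr muln1 mulnA !exprD expr1.
  by rewrite ![(_ * Q)%N]mulnC !exprM thQ phQ !expr1n !mul1r.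
have fib (al be : K) : al ^+ q.+1 = 1 -> be ^+ q.+1 = 1 ->
    ((al ^+ a * be ^+ b) ^+ m == 1) = (be ^+ m == (al ^+ m) ^+ k).
  rewrite qm => alU beU; rewrite -key -?exprM //.
  by rewrite exprMn -!exprM [(a * m)%N]mulnC [(b * m)%N]mulnC.
rewrite -(card_unity qN) -/U -sum_nat_const -sum1_card.
rewrite (eq_bigl (fun x : K * K => (x.1 \in U) && ((x.2 \in U) && (x.2 ^+ m == (x.1 ^+ m) ^+ k)))).
  rewrite -(pair_big_dep (mem U) (fun al be => (be \in U) && (be ^+ m == (al ^+ m) ^+ k)) (fun _ _
    => 1%N)) /=.
  apply: eq_bigr => al; rewrite /U inE => /eqP alU.
  have cU : (al ^+ m) ^+ k \in unity K Q.
    have e1 : ((al ^+ m) ^+ k) ^+ Q = (al ^+ (m * Q)) ^+ k.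
      by rewrite -!exprM; congr (_ ^+ _); rewrite -mulnA [(k * Q)%N]mulnC mulnA.
    by rewrite inE e1 -qm alU expr1n.
  rewrite -[RHS](card_power_fiber mN cU) sum1_card; apply: eq_card => be.
  by rewrite !inE -qm unfold_in inE.
move=> [al be]; rewrite /slope_pairs !inE /=.
by case: eqP => //= alU; case: eqP => //= beU; rewrite fib.
Qed.

(** Each of the loci al = 1, be = 1, al = be contains m pairs, as the exponents b, a, a + b are
    prime to Q, and any two of them meet only in (1, 1); so 3 m - 2 pairs are removed. *)
Lemma card_slope_pairs_generic :
  (#|[set x in slope_pairs | [&& x.1 != 1%R, x.2 != 1%R & x.1 != x.2]]%SET| + 3 * m = q.+1 * m + 2)%N.
Proof.
set X := #|_|; pose S := slope_pairs; pose Um := unity K m.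
have one_m : 1 \in Um by rewrite inE expr1n.
have cUm : #|Um| = m by exact: card_unity.
have inS (al be : K) : ((al, be) \in S) =
    [&& al ^+ q.+1 == 1, be ^+ q.+1 == 1 & (al ^+ a * be ^+ b) ^+ m == 1].
  by rewrite /S /slope_pairs !inE andbA.
have c1 : #|S :&: [set x | x.1 == 1]%SET| = m.
  rewrite -[RHS]cUm -(@card_imset _ _ (fun be : K => (1 : K, be)) (mem Um)) => [|x y []//].
  apply: eq_card => -[al be]; apply/idP/imsetP => [|[u uU [-> ->]]].
    rewrite inE inS inE /= => /andP[/and3P[_ /eqP beU h] /eqP al1]; exists be; last by rewrite al1.
    by move: h; rewrite al1 expr1n mul1r unity_coprime_exp.
  by rewrite inE inS inE /= !expr1n mul1r (unity_sub uU) !eqxx /= unity_coprime_exp ?uU ?(unity_sub uU).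
have cD (T : finType) (V Y : {set T}) : #|V| = (#|V :&: Y| + #|V :\: Y|)%N by rewrite cardsID.
have cUm1 : #|Um :\ 1| = m.-1.
  by have := cardsD1 1 Um; rewrite one_m cUm => ->.
have c2 : #|(S :\: [set x | x.1 == 1]%SET) :&: [set x | x.2 == 1]%SET| = m.-1.
  rewrite -[RHS]cUm1 -(@card_imset _ _ (fun al : K => (al, 1 : K)) (mem (Um :\ 1))) => [|x y []//].
  apply: eq_card => -[al be]; apply/idP/imsetP => [|[u]].
    rewrite finset.in_setI finset.in_setD inS !inE /= => /andP[/andP[al1 /and3P[/eqP alU _ h]] /eqP be1].
    exists al; last by rewrite be1.
    by move: h; rewrite be1 expr1n mulr1 unity_coprime_exp // !inE al1.
  rewrite finset.in_setD1 => /andP[u1 uU] [-> ->].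
  by rewrite finset.in_setI finset.in_setD inS !inE /= !expr1n mulr1 (unity_sub uU) !eqxx u1 /=
    unity_coprime_exp ?uU ?(unity_sub uU).
have c3 : #|((S :\: [set x | x.1 == 1]%SET) :\: [set x | x.2 == 1]%SET) :&: [set x | x.1 ==
  x.2]%SET| = m.-1.
  rewrite -[RHS]cUm1 -(@card_imset _ _ (fun al : K => (al, al)) (mem (Um :\ 1))) => [|x y []//].
  apply: eq_card => -[al be]; apply/idP/imsetP => [|[u]].
    rewrite finset.in_setI 2!finset.in_setD inS !inE /= => /andP[/andP[be1 /andP[al1 /and3P[/eqP
      alU _ h]]] /eqP albe].
    exists al; last by rewrite albe.
    by move: h; rewrite -albe -exprD unity_coprime_exp // !inE al1.
  rewrite finset.in_setD1 => /andP[u1 uU] [-> ->].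
  by rewrite finset.in_setI 2!finset.in_setD inS !inE /= -exprD (unity_sub uU) !eqxx u1 /=
    unity_coprime_exp ?uU ?(unity_sub uU).
have e4 : X = #|(S :\: [set x | x.1 == 1]%SET) :\: [set x | x.2 == 1]%SET :\: [set x | x.1 == x.2]%SET|.
  by apply: eq_card => x; rewrite !inE; do !case: (_ == _).
have := card_slope_pairs; rewrite -/S (cD _ S [set x | x.1 == 1]%SET) c1.
rewrite (cD _ (S :\: _) [set x | x.2 == 1]%SET) c2.
rewrite (cD _ (S :\: _ :\: _) [set x | x.1 == x.2]%SET) c3 -e4.
by move: m_gt0; clear; lia.
Qed.

Lemma card_affine_semiprimitive : (3 + #|A| = 1 + q ^ 2 + q * Q.-1)%N.
Proof.
rewrite (card_affine_dvd QN).
set T := [set tau : K | _]%SET.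
pose Fq := [set tau : K | tau ^+ q == tau]%SET.
have NQ : (N %/ Q = q.-1 * m)%N by rewrite NE qm mulnA mulnK.
have q1N : (q.-1 %| N)%N by rewrite NE dvdn_mulr.
(* For tau in F_q other than 0 and 1 the value is a nonzero element of F_q, and these are all Q-th
   powers in K because Q divides q + 1. *)
have cF : #|T :&: Fq| = (q - 2)%N.
  have -> : T :&: Fq = unity K q.-1 :\ 1.
    apply/setP => tau; rewrite !inE NQ; have [->|tau1] := eqVneq tau 1; first by rewrite andbF.
    have [->|tau0] := eqVneq tau 0.
      have q10 : (0 < q.-1)%N by case: (q) q_gt1 => [|[]].
      by rewrite /= [in RHS]expr0n (gtn_eqF q10) /= [0 == 1 :> K]eq_sym oner_eq0.
    have -> : (tau ^+ q == tau) = (tau ^+ q.-1 == 1).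
      by rewrite -exp_predq // -[X in _ == X]mulr1 (inj_eq (mulfI tau0)).
    case: (tau ^+ q.-1 =P 1) => tq; rewrite ?andbF // andbT /=.
    have t1 : 1 - tau != 0 by rewrite subr_eq0 eq_sym.
    have t1q : (1 - tau) ^+ q.-1 = 1.
      by apply: (mulfI t1); rewrite exp_predq // frobB expr1n -exp_predq // tq !mulr1.
    have vq : value_at tau ^+ q.-1 = 1.
      by rewrite /value_at !exprMn eq1 mul1r exprAC tq expr1n mul1r exprAC t1q expr1n.
    by rewrite exprM vq expr1n eqxx.
  have := cardsD1 1 (unity K q.-1);
    rewrite (card_unity q1N) inE expr1n eqxx /= add1n => /(congr1 predn) /= <-.
  by rewrite subn2.
have cT : #|T :\: Fq| = #|[set x in slope_pairs | [&& x.1 != 1, x.2 != 1 & x.1 != x.2]]%SET|.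
  rewrite -slopes_image card_in_imset; last exact: slopes_inj.
  apply: eq_card => tau; rewrite !inE; case: (boolP (tau ^+ q == tau)) => //= tq.
  have -> : tau != 0 by apply: contra tq => /eqP->; rewrite expr0n gtn_eqF // ltnW.
  by have -> : tau != 1 by apply: contra tq => /eqP->; rewrite expr1n.
have := card_slope_pairs_generic; rewrite -cT => cG.
have := cardsID Fq T; rewrite cF => <-.
move: cG; move: #|_| => X; move: qm q_gt1 Q_gt0; clear => qm q1 Q0 cG.
have QX : (Q * X + 3 * q.+1 = q.+1 * q.+1 + 2 * Q)%N.
  have Qm : (Q * m = q.+1)%N by rewrite mulnC.
  transitivity (Q * (X + 3 * m))%N; first by rewrite -Qm; clear; lia.
  by rewrite cG mulnDr mulnCA Qm [(Q * 2)%N]mulnC.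
move: q1 Q0 QX; clear; case: (q) => [|[|k]] // _; case: (Q) => // Q' _.
by rewrite subn2 /=; clear; nia.
Qed.

End Semiprimitive.
End AffinePointCount.

Lemma kummer_maximal (K : finFieldType) (F : fieldType) (iota : {rmorphism K -> F})
    (q Q : nat) (t w : F) (e : K) (a b : nat) :
    #|K| = (q ^ 2)%N -> [pchar K].-nat q -> coprime q Q -> prime Q ->
    ~~ (Q %| a)%N -> ~~ (Q %| b)%N -> ~~ (Q %| a + b)%N -> e ^+ q.-1 = 1 ->
    kummer iota Q t w e a b ->
  is_maximal iota q <-> (Q %| q.+1)%N.
Proof.
move=> hK pcq coqQ prQ Qa Qb Qab eq1 ku.
have pcK : [pchar K].-nat #|K| by rewrite hK pnatX pcq.
have coKQ : coprime #|K| Q by rewrite hK coprimeXl.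
have [v0 [pv0 d0 v0t v0w u0]] := kummer_origin prQ Qa ku.
have [v1 [pv1 d1 v1s v1w u1]] := kummer_one prQ ku Qb.
have [voo [pvoo doo voot voow uoo]] := kummer_infinity prQ ku Qab.
have genus := kummer_genus prQ Qa Qb Qab ku pcK coKQ pv0 pv1 pvoo v0t v0w v1s v1w voot voow u0 u1
  uoo doo d0 d1.
have ratE := rational_places_card prQ Qa ku pcK coKQ pv0 pv1 pvoo v0t v1s voot u0 u1 uoo doo d0 d1.
have ff := kummer_function_field prQ Qa ku.
have gi := rational_place_geom_irr pcK pv0 d0.
have q1 : (1 < q)%N by have := finNzRing_gt1 K; rewrite hK; case: (q) => [|[]].
have NE : #|K|.-1 = (q.-1 * q.+1)%N.
  by rewrite hK -subn1 -[X in (_ - X)%N](exp1n 2) subn_sqr subn1 addn1.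
have Q1 := prime_gt1 prQ.
split=> [[_ _ [g /genus hg hcard]]|/dvdnP[m qm]]; last first.
  have cA := card_affine_semiprimitive hK prQ pcq Qa Qb Qab (ku_e ku) eq1 qm.
  have [g hg] : exists g, (2 * g = Q.-1)%N.
    by exists (count (fun i => Q <= cgap Q a b i)%N (seq.iota 0 Q)); exact: count_large_cgap.
  split=> //; exists g; first exact/genus.
  have -> : (2 * q * g = q * Q.-1)%N by rewrite -hg mulnA [(q * 2)%N]mulnC.
  by rewrite -cA.
have eqN : (3 + #|affine_points Q e a b| = 1 + q ^ 2 + q * Q.-1)%N.
  have -> : (q * Q.-1 = 2 * q * g)%N by rewrite -hg mulnA [(q * 2)%N]mulnC.
  by apply/card_eq_II; rewrite -(card_eql ratE).
have [QN|QN] := boolP (Q %| #|K|.-1)%N; last first.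
  have co : coprime Q #|K|.-1 by rewrite prime_coprime.
  move: eqN; rewrite (card_affine_coprime hK prQ pcq Qa Qb Qab (ku_e ku) co).
  have qQ : (0 < q * Q.-1)%N by rewrite muln_gt0 (ltnW q1) -subn1 subn_gt0.
  have q2 : (2 ^ 2 <= q ^ 2)%N by rewrite leq_exp2r.
  by move: qQ q2; move: (q * Q.-1)%N (q ^ 2)%N => x y; clear; lia.
move: QN; rewrite NE Euclid_dvdM // => /orP[Qq1|//].
have QM : (Q %| #|affine_points Q e a b|)%N.
  by rewrite (card_affine_dvd a b prQ (ku_e ku)) ?dvdn_mulr // NE dvdn_mulr.
(* The right-hand side is divisible by Q, as Q divides q - 1; so Q divides 2, and then q + 1 = (q -
   1) + 2. *)
have e2 : (#|affine_points Q e a b| + 2 = q * q.-1 + q * Q)%N.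
  move: eqN; move: #|_| => M; move: q1 Q1; clear.
  rewrite -mulnn; case: q => // k _; case: Q => // Q' _ /=; clear; nia.
have : (Q %| #|affine_points Q e a b| + 2)%N by rewrite e2 dvdn_add ?dvdn_mull.
rewrite dvdn_addr // => Q2.
have -> : q.+1 = (q.-1 + 2)%N by move: q1; clear; lia.
exact: dvdn_add.
Qed.

(** * Existence of the cyclic cover *)

Lemma fraction_decomp (R : idomainType) (c : {fraction R}) :
  exists n d : R, d != 0 /\ c = tofrac n / tofrac d.
Proof.
elim/generic_quotient.quotW: c => x; exists \n_x, \d_x; split; first exact: denom_ratioP.
have d0 : tofrac \d_x != 0 :> {fraction R} by rewrite tofrac_eq0 denom_ratioP.
apply: (mulIf d0); rewrite divfK //.
unlock FracField.tofrac; rewrite -[LHS]FracField.pi_mul; apply/generic_quotient.eqmodP.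
rewrite /= FracField.equivfE /FracField.mulf /=.
by rewrite !numden_Ratio ?oner_neq0 ?mulr1 ?denom_ratioP // mulrC.
Qed.

(** A root of any irreducible factor of W^Q - G over K(T) is adjoined; that the extension has full
    degree follows later from [ku_indep], for Q prime and not dividing a. *)
Lemma kummer_exists (K : fieldType) (Q : nat) (e : K) (a b : nat) : (0 < Q)%N -> e != 0 ->
  exists (F : fieldType) (iota : {rmorphism K -> F}) (t w : F), kummer iota Q t w e a b.
Proof.
move=> Q0 e0; pose F0 : fieldType := {fraction {poly K}}.
pose p : {poly F0} := 'X^Q - (tofrac (kG e a b))%:P.
have [|pi irr pip] := @irreducible_factor F0 p; first by rewrite size_XnsubC.
have [L _ [z rz genz]] := irredp_FAdjoin irr.
pose iota : {rmorphism K -> L} := GRing.RMorphism.clone _ _ (in_alg L \o (@tofrac _ \o polyC)) _.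
pose phi : {rmorphism {poly K} -> L} := GRing.RMorphism.clone _ _ (in_alg L \o @tofrac _) _.
have phi_inj f : phi f = 0 -> f = 0.
  move=> h; have /eqP : in_alg L (tofrac f) = 0 by exact: h.
  by rewrite fmorph_eq0 tofrac_eq0 => /eqP.
pose t := phi 'X.
have evphi f : peval iota t f = phi f.
  elim/poly_ind: f => [|f c IHf]; first by rewrite evp0 rmorph0.
  by rewrite evpD evpM evpX evpC IHf rmorphD rmorphM.
exists L, iota, t, z; split=> //.
- by move=> f; rewrite evphi; exact: phi_inj.
- have : root (map_poly (in_alg L) p) z.
    by apply: root_dvdp rz; rewrite dvdp_map.
  rewrite rootE /p rmorphB /= map_polyXn map_polyC hornerD hornerN hornerXn hornerC subr_eq0.
  move=> /eqP ->; transitivity (phi (kG e a b)) => //.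
  by rewrite -evphi evpZ evpM !evpXn evpB evp1 evpX mulrA.
- move=> S sS St Sz x; have : x \in <<1; z>>%VS by rewrite genz memvf.
  case: (sS) => Sc SD SM SV; case/Fadjoin1_polyP=> h ->.
  have Sphi f : S (phi f).
    rewrite -evphi; elim/poly_ind: f => [|f c IHf]; first by rewrite evp0 -(rmorph0 iota); exact: Sc.
    by rewrite evpD evpM evpX evpC; apply: SD => //; apply: SM.
  have Salg c : S (in_alg L c).
    have [n [d [_ ->]]] := fraction_decomp c; rewrite fmorph_div.
    by apply: SM; [exact: Sphi|apply: SV; exact: Sphi].
  elim/poly_ind: h => [|h c IHh]; first by rewrite rmorph0 horner0 -(rmorph0 iota); exact: Sc.
  rewrite rmorphD rmorphM /= map_polyX map_polyC hornerMXaddC.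
  by apply: SD; [exact: SM|exact: Salg].
Qed.

(** * The plane curve *)

Section TernaryForms.
Variable K : fieldType.
Implicit Types (g h r : {mpoly K[3]}) (m : 'X_{1..3}).

Let i0 : 'I_3 := inord 0.
Let i1 : 'I_3 := inord 1.
Let i2 : 'I_3 := inord 2.

Lemma ord3_cases (P : 'I_3 -> Prop) : P (inord 0) -> P (inord 1) -> P (inord 2) -> forall i, P i.
Proof.
move=> P0 P1 P2 i; rewrite -[i]inord_val.
by case: i => [[|[|[|]]]].
Qed.

Lemma big_ord3 (T : Type) (idx : T) (op : Monoid.law idx) (f : 'I_3 -> T) :
  \big[op/idx]_i f i = op (op (f (inord 0)) (f (inord 1))) (f (inord 2)).
Proof.
rewrite !big_ord_recl big_ord0 Monoid.mulm1 Monoid.mulmA; congr (op (op (f _) (f _)) (f _));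
  by apply: val_inj; rewrite /= inordK.
Qed.

Lemma inord3_eq : ((i0 == i1 = false) * (i0 == i2 = false) * (i1 == i2 = false)
  * (i1 == i0 = false) * (i2 == i0 = false) * (i2 == i1 = false))%type.
Proof. by do !split; apply/negbTE; rewrite -val_eqE /= !inordK. Qed.

Definition mnm3 (a b c : nat) : 'X_{1..3} :=
  [multinom nth 0%N [:: a; b; c] i | i < 3].

Lemma mnm3E a b c : ((mnm3 a b c (inord 0) = a) * (mnm3 a b c (inord 1) = b)
  * (mnm3 a b c (inord 2) = c))%type.
Proof.
by rewrite !mnmE !inordK.
Qed.

Lemma mnm3_ext m m' : m (inord 0) = m' (inord 0) -> m (inord 1) = m' (inord 1) ->
  m (inord 2) = m' (inord 2) -> m = m'.
Proof. by move=> h0 h1 h2; apply/mnmP; apply: ord3_cases. Qed.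

Lemma mnm3D a b c a' b' c' : (mnm3 a b c + mnm3 a' b' c')%MM = mnm3 (a + a') (b + b') (c + c').
Proof. by apply: mnm3_ext; rewrite mnmDE !mnm3E. Qed.

Lemma mnm3_eta m : m = mnm3 (m (inord 0)) (m (inord 1)) (m (inord 2)).
Proof. by apply: mnm3_ext; rewrite !mnm3E. Qed.

Lemma mdeg_mnm3 m : mdeg m = (m (inord 0) + m (inord 1) + m (inord 2))%N.
Proof. by rewrite mdegE big_ord3. Qed.

Lemma mpolyX3 a b c :
  'X_[mnm3 a b c] = 'X_(inord 0) ^+ a * 'X_(inord 1) ^+ b * 'X_(inord 2) ^+ c :> {mpoly K[3]}.
Proof. by rewrite mpolyXE_id big_ord3 !mnm3E. Qed.

Lemma mpolyX_eq0 m : ('X_[m] == 0 :> {mpoly K[3]}) = false.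
Proof.
apply/eqP => /(congr1 (mcoeff m)) /eqP.
by rewrite mcoeffX eqxx mcoeff0 oner_eq0.
Qed.

Lemma mmap_mpolyX3 (R : comNzRingType) (f : {rmorphism K -> R}) (P : 'I_3 -> R) a b c :
  mmap f P 'X_[mnm3 a b c] = P (inord 0) ^+ a * P (inord 1) ^+ b * P (inord 2) ^+ c.
Proof. by rewrite mmapX /mmap1 big_ord3 !mnm3E. Qed.

Lemma dhomogX3 a b c : ('X_[mnm3 a b c] : {mpoly K[3]}) \is (a + b + c).-homog.
Proof. by rewrite dhomogX; apply/eqP; rewrite /= mdeg_mnm3 !mnm3E. Qed.

Lemma curveXE n l :
  curveX K n l = 'X_[mnm3 n l 0] + 'X_[mnm3 0 n l] + 'X_[mnm3 l 0 n].
Proof.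
rewrite /curveX !mpolyX3 !expr0 !mul1r !mulr1.
by rewrite ['X_(inord 0) ^+ l * _]mulrC.
Qed.

Section Reduction.
Variables (n l : nat).
Hypotheses (l0 : (0 < l)%N) (ln : (l < n)%N).
Let f : {mpoly K[3]} := curveX K n l.
Let Z : {mpoly K[3]} := 'X_(inord 2).

(* Division by the curve, whose leading term in Y is Y^n Z^l, after multiplication
   by a power of Z. *)
Definition reduces (d : nat) g := exists N0, forall N, (N0 <= N)%N -> exists h r,
  Z ^+ N * g = h * f + r /\
  forall m, r@_m != 0 -> mdeg m = (d + N)%N /\ (m (inord 1) < n)%N.

Lemma reduces0 d : reduces d 0.
Proof.
exists 0%N => N _; exists 0, 0; split; first by rewrite mulr0 mul0r addr0.
by move=> m; rewrite mcoeff0 eqxx.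
Qed.

Lemma reducesD d g g' : reduces d g -> reduces d g' -> reduces d (g + g').
Proof.
move=> [N0 H] [N0' H']; exists (maxn N0 N0') => N; rewrite geq_max => /andP[/H + /H'].
move=> [h [r [e hr]]] [h' [r' [e' hr']]]; exists (h + h'), (r + r'); split.
  by rewrite mulrDr e e' mulrDl addrACA.
move=> m; rewrite mcoeffD; have [r0|/hr//] := eqVneq r@_m 0.
by rewrite r0 add0r => /hr'.
Qed.

Lemma reducesZ d c g : reduces d g -> reduces d (c *: g).
Proof.
move=> [N0 H]; exists N0 => N /H[h [r [e hr]]]; exists (c *: h), (c *: r); split.
  by rewrite -scalerAr e scalerDr scalerAl.
by move=> m; rewrite mcoeffZ mulf_eq0 negb_or => /andP[_ /hr].
Qed.

(** The equation rewrites Y^n Z^l as two monomials; the exponent of Y drops from b to b - n + l or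
    to b - n, and the induction is on it. *)
Lemma reducesX m : reduces (mdeg m) 'X_[m].
Proof.
have [k] := ubnP (m (inord 1)); elim: k m => // k IHk m; rewrite ltnS => mk.
have [mn|nm] := ltnP (m (inord 1)) n.
  exists 0%N => N _; exists 0, (Z ^+ N * 'X_[m]); split; first by rewrite mul0r add0r.
  move=> m'; have -> : Z ^+ N * 'X_[m] = 'X_[mnm3 0 0 N + m].
    by rewrite mpolyXD mpolyX3 !expr0 !mul1r.
  rewrite mcoeffX; have [<- _|_] := eqVneq (mnm3 0 0 N + m)%MM m'; last by rewrite eqxx.
  by rewrite mdegD !mnmDE !mnm3E mdeg_mnm3 !mnm3E addnC.
set a := m (inord 0) in mk nm *; set b := m (inord 1) in mk nm *; pose c := m (inord 2).
pose m1 := mnm3 (n + a) (l + (b - n)) c; pose m2 := mnm3 (l + a) (b - n) (n + c).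
have dm : mdeg m = (a + b + c)%N by rewrite mdeg_mnm3.
have d1 : mdeg m1 = (mdeg m + l)%N.
  by rewrite dm mdeg_mnm3 !mnm3E; move: nm; clear; lia.
have d2 : mdeg m2 = (mdeg m + l)%N.
  by rewrite dm mdeg_mnm3 !mnm3E; move: nm; clear; lia.
have e : Z ^+ l * 'X_[m] = 'X_[mnm3 a (b - n) c] * f - ('X_[m1] + 'X_[m2]).
  have -> : Z ^+ l * 'X_[m] = 'X_[mnm3 0 0 l + m].
    by rewrite mpolyXD mpolyX3 !expr0 !mul1r.
  rewrite /f curveXE !mulrDr -!mpolyXD [m in LHS]mnm3_eta !mnm3D -/a -/b -/c.
  have -> : mnm3 (a + n) (b - n + l) (c + 0) = m1 by rewrite /m1 addnC [(b - n + l)%N]addnC addn0.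
  have -> : mnm3 (a + l) (b - n + 0) (c + n) = m2 by rewrite /m2 addnC addn0 [(c + n)%N]addnC.
  by rewrite !add0n addn0 subnK // [(l + c)%N]addnC; ring.
have red_m1 : reduces (mdeg m1) 'X_[m1].
  by apply: IHk; rewrite !mnm3E; move: nm mk ln; clear; lia.
have red_m2 : reduces (mdeg m2) 'X_[m2].
  by apply: IHk; rewrite !mnm3E; move: nm mk l0 ln; clear; lia.
rewrite d1 in red_m1; rewrite d2 in red_m2.
have [N0 H] := reducesD red_m1 red_m2.
exists (N0 + l)%N => N NN.
have [|h [r [er hr]]] := H (N - l)%N; first by move: NN; clear; lia.
exists (Z ^+ (N - l) * 'X_[mnm3 a (b - n) c] - h), (- r); split.
  rewrite -[N in LHS](@subnK l); last by move: NN; clear; lia.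
  by rewrite exprD -mulrA e mulrBr er mulrBl opprD addrA mulrA.
move=> m'; rewrite mcoeffN oppr_eq0 => /hr[-> ->]; split=> //.
by move: NN; clear; lia.
Qed.

Lemma dhomog_reduces d g : g \is d.-homog -> reduces d g.
Proof.
move=> /dhomogP hg; rewrite (mpolyE g) big_seq; elim/big_ind: _ => [||m mg].
- exact: reduces0.
- exact: reducesD.
by apply: reducesZ; rewrite -(hg m mg); exact: reducesX.
Qed.

Let psi : {rmorphism {mpoly K[3]} -> {mpoly K[3]}} :=
  mmap (@mpolyC 3 K) (fun i => if i == inord 2 then 0 else 'X_i).

(** At Z = 0, the map [psi], the curve becomes X^n Y^l, which is nonzero; so [h] vanishes at Z = 0,
    that is, Z divides [h] and can be cancelled. *)
Lemma curveX_prime_Z N g h : Z ^+ N * g = h * f -> exists h', g = h' * f.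
Proof.
have psiZ : psi Z = 0 by rewrite /psi /= mmapX mmap1U eqxx.
have psif : psi f = 'X_[mnm3 n l 0].
  rewrite /f curveXE !rmorphD /psi /= !mmap_mpolyX3 eqxx -/i0 -/i1 -/i2 !inord3_eq.
  rewrite !expr0n (gtn_eqF l0) (gtn_eqF (ltn_trans l0 ln)) !mulr0 !addr0.
  by rewrite mpolyX3 expr0.
have psiP h1 : exists h2, h1 = psi h1 + Z * h2.
  move: h1; apply: mpolyind => [|c m p _ _ [p' ep]]; first by exists 0; rewrite rmorph0 mulr0 addr0.
  suff [x ex] : exists x, 'X_[m] = psi 'X_[m] + Z * x.
    exists (c *: x + p'); rewrite rmorphD [psi (c *: _)]mmapZ -mul_mpolyC {1}ep {1}ex.
    by rewrite -mul_mpolyC; ring.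
  have [m2|m2] := posnP (m (inord 2)).
    exists 0; rewrite mulr0 addr0 [m]mnm3_eta m2 /psi /= mmap_mpolyX3 eqxx -/i0 -/i1 -/i2 !inord3_eq.
    by rewrite mpolyX3 expr0.
  exists 'X_[mnm3 (m (inord 0)) (m (inord 1)) (m (inord 2)).-1].
  rewrite {2}[m]mnm3_eta /psi /= mmap_mpolyX3 eqxx expr0n gtn_eqF // mulr0 add0r.
  rewrite [m in LHS]mnm3_eta !mpolyX3 -{1}(prednK m2) exprS -/Z; ring.
have Z0 : Z != 0 by rewrite mpolyX_eq0.
elim: N h => [|N IHN] h; first by rewrite expr0 mul1r; exists h.
rewrite exprS -mulrA => e.
have : psi (h * f) = 0 by rewrite -e rmorphM psiZ mul0r.
rewrite rmorphM psif => /eqP; rewrite mulf_eq0 mpolyX_eq0 orbF => /eqP h0.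
have [h' eh] := psiP h; rewrite h0 add0r in eh.
by apply: (IHN h'); apply: (mulfI Z0); rewrite e eh mulrA.
Qed.

End Reduction.
End TernaryForms.

(** * Quotients of forms at a generic point *)

Section FormQuotients.
Variables (K F : fieldType) (iota : {rmorphism K -> F}) (P : 'I_3 -> F).
Local Notation ev := (mmap iota P).

Definition form_quotients : set F := [set z | exists (d : nat) (g h : {mpoly K[3]}),
  [/\ g \is d.-homog, h \is d.-homog, ev h != 0 & z = ev g / ev h]].

Lemma form_quotients_subfield : subfield_set iota form_quotients.
Proof.
split=> [c|x y|x y|x].
- exists 0%N, c%:MP, 1; rewrite [ev 1]rmorph1 mmapC divr1 oner_eq0 dhomog1; split=> //.
  by rewrite -[c%:MP]mulr1 mul_mpolyC; apply: dhomogZ; apply: dhomog1.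
- move=> [d [g [h [hg hh h0 ->]]]] [d' [g' [h' [hg' hh' h0' ->]]]].
  exists (d + d')%N, (g * h' + g' * h), (h * h'); split.
  + by apply: dhomogD; [|rewrite addnC]; apply: dhomogM.
  + exact: dhomogM.
  + by rewrite rmorphM mulf_neq0.
  + by rewrite rmorphD !rmorphM addf_div.
- move=> [d [g [h [hg hh h0 ->]]]] [d' [g' [h' [hg' hh' h0' ->]]]].
  exists (d + d')%N, (g * g'), (h * h'); split; try exact: dhomogM.
  + by rewrite rmorphM mulf_neq0.
  + by rewrite !rmorphM mulf_div.
- move=> [d [g [h [hg hh h0 ->]]]].
  have [g0|g0] := eqVneq (ev g) 0.
    by rewrite g0 mul0r invr0; exists d, g, h; rewrite g0 mul0r.
  by exists d, h, g; rewrite invf_div.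
Qed.

Lemma subfield_form_quotient (S : set F) i d (g : {mpoly K[3]}) :
    subfield_set iota S -> (forall j, S (P j / P i)) -> g \is d.-homog ->
  S (ev g / P i ^+ d).
Proof.
move=> sS SP /dhomogP hg; have [Sc SD SM SV] := sS.
rewrite /mmap mulr_suml big_seq; elim/big_ind: _ => [|x y|m mg].
- by rewrite -(rmorph0 iota).
- exact: SD.
rewrite -mulrA; apply: (SM _ _ (Sc _)).
rewrite -(hg m mg) [mf in _ ^+ mf]mdegE -prodrXr -prodf_div.
apply: big_ind => [||j _]; [by rewrite -(rmorph1 iota)|exact: SM|].
by rewrite -expr_div_n; apply: (subfieldX _ sS).
Qed.

(** Bezout exponents: x = (x^a)^j / (x^b)^k with j a = k b + 1. *)
Lemma subfield_coprime_root (S : set F) x a b : subfield_set iota S -> x != 0 ->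
  coprime a b -> (0 < a)%N -> S (x ^+ a) -> S (x ^+ b) -> S x.
Proof.
move=> sS x0 /eqP co a0 Sa Sb; have [Sc SD SM SV] := sS.
have [j k e _] := egcdnP b a0; rewrite co addn1 in e.
have -> : x = (x ^+ a) ^+ j / (x ^+ b) ^+ k.
  by rewrite -!exprM [(a * j)%N]mulnC e [(k * b)%N]mulnC exprS mulfK ?expf_neq0.
by apply: SM; [|apply: SV]; apply: (subfieldX _ sS).
Qed.

End FormQuotients.

(** * From the cyclic cover to the plane curve *)

Section CurveCoordinates.
Variables (n l : nat).
Hypotheses (l2 : (2 <= l)%N) (ln : (l < n)%N) (co : coprime n l).
Local Notation Q := (n ^ 2 - n * l + l ^ 2)%N.

Lemma normE : Q = (l * l + n * (n - l))%N.
Proof.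
have [k ->] : exists k, n = (l + k)%N by exists (n - l)%N; rewrite subnKC // ltnW.
by rewrite -!mulnn addKn; clear; nia.
Qed.

Lemma norm_gt : (n < Q)%N.
Proof.
rewrite normE -[n in (n < _)%N]add0n -addSn leq_add ?muln_gt0 ?(ltnW l2) //.
by rewrite leq_pmulr // subn_gt0.
Qed.

Lemma coprime_subnl : coprime (n - l) l.
Proof. by rewrite coprime_sym /coprime -gcdnDr subnK 1?ltnW // gcdnC. Qed.

Section Field.
Variables (K F : fieldType) (iota : {rmorphism K -> F}).

(** In t^l (1 - t)^(n-l) the powers of [x] cancel, leaving y^(l l + n (n-l)) with the sign (-1)^l
    (-1)^(n-l). *)
Lemma curve_kummer_eq (x y : F) (t := - (x ^+ (n - l) * y ^+ l)) :
    x != 0 -> x ^+ n * y ^+ l + y ^+ n + x ^+ l = 0 ->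
  1 - t = - (y ^+ n / x ^+ l) /\ y ^+ Q = iota ((-1) ^+ n) * t ^+ l * (1 - t) ^+ (n - l).
Proof.
move=> x0 e; have xl0 := expf_neq0 l x0.
have st : 1 - t = - (y ^+ n / x ^+ l).
  have xn : x ^+ n = x ^+ (n - l) * x ^+ l by rewrite -exprD subnK // ltnW.
  apply: (mulIf xl0); rewrite mulNr divfK // /t opprK; apply/eqP; rewrite -subr_eq0 opprK -e xn.
  by apply/eqP; move: (x ^+ (n - l)) (x ^+ l) (y ^+ l) (y ^+ n) => X1 X2 Y1 Y2; ring.
split=> //; rewrite st /t ![(- (_ * _)) ^+ _]exprNn rmorphXn rmorphN1 normE exprD exprMn exprM.
rewrite expr_div_n -!exprM [((n - l) * l)%N]mulnC.
have -> : (-1) ^+ n = (-1) ^+ l * (-1) ^+ (n - l) :> F by rewrite -exprD subnKC // ltnW.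
set a := (-1) ^+ l; set b := (-1) ^+ (n - l).
have aa : a * a = 1 by rewrite -expr2 sqrr_sign.
have bb : b * b = 1 by rewrite -expr2 sqrr_sign.
have xx := expf_neq0 (l * (n - l)) x0.
transitivity ((a * a) * (b * b) * (x ^+ (l * (n - l)) / x ^+ (l * (n - l))) *
   (y ^+ (l * l) * y ^+ (n * (n - l)))); last by ring.
by rewrite aa bb divff // !mul1r.
Qed.

(** [x] has to satisfy x^(n-l) = al and x^l = be. The Kummer equation is the compatibility al^l =
    be^(n-l), and since n - l and l are coprime, Bezout exponents solve both at once. *)
Lemma kummer_curve_point t w : prime Q -> kummer iota Q t w ((-1) ^+ n) l (n - l) ->
  exists x, [/\ x != 0, t = - (x ^+ (n - l) * w ^+ l) & x ^+ n * w ^+ l + w ^+ n + x ^+ l = 0].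
Proof.
move=> prQ ku; have t0 := t_neq0 ku; have s0 := s_neq0 ku; have w0 := w_neq0 prQ ku.
have nl0 : (0 < n - l)%N by rewrite subn_gt0.
have [j k ejk _] := egcdnP l nl0; rewrite (eqP coprime_subnl) addn1 in ejk.
pose al := - t / w ^+ l; pose be := - w ^+ n / (1 - t).
have wl0 := expf_neq0 l w0; have wn0 := expf_neq0 n w0.
have al0 : al != 0 by rewrite mulf_neq0 ?oppr_eq0 ?invr_eq0.
have be0 : be != 0 by rewrite mulf_neq0 ?oppr_eq0 ?invr_eq0.
have ab : al ^+ l = be ^+ (n - l).
  rewrite /al /be !expr_div_n (exprNn t) (exprNn (w ^+ n)) -!exprM; apply/eqP.
  rewrite eqr_div ?expf_neq0 //; apply/eqP.
  have := ku_eq ku; rewrite {1}normE exprD rmorphXn rmorphN1.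
  have -> : (-1) ^+ n = (-1) ^+ l * (-1) ^+ (n - l) :> F by rewrite -exprD subnKC // ltnW.
  set a := (-1) ^+ l; set b := (-1) ^+ (n - l).
  have bb : b * b = 1 by rewrite -expr2 sqrr_sign.
  move=> ew; transitivity (b * (a * b * t ^+ l * (1 - t) ^+ (n - l))).
    by rewrite -[LHS]mul1r -bb; ring.
  by rewrite -ew; ring.
pose x := al ^+ j / be ^+ k.
have x0 : x != 0 by rewrite mulf_neq0 ?invr_eq0 ?expf_neq0.
have xa : x ^+ (n - l) = al.
  rewrite /x expr_div_n -!exprM [(k * _)%N]mulnC [in X in _ / X]exprM -ab -exprM ejk.
  by rewrite [(l * k)%N]mulnC exprS mulfK ?expf_neq0.
have xb : x ^+ l = be.
  rewrite /x expr_div_n -!exprM [(j * l)%N]mulnC [in X in X / _]exprM ab -exprM.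
  by rewrite [((n - l) * j)%N]mulnC ejk exprS mulfK ?expf_neq0.
exists x; split=> //; first by rewrite xa /al divfK ?opprK.
have -> : x ^+ n = al * be by rewrite -xa -xb -exprD subnK // ltnW.
by rewrite xb /al mulrAC divfK // /be; field.
Qed.

Definition affine_point (x y : F) : 'I_3 -> F := fun i => nth 0 [:: x; y; 1] i.

Lemma affine_pointE x y : ((affine_point x y (inord 0) = x) *
  (affine_point x y (inord 1) = y) * (affine_point x y (inord 2) = 1))%type.
Proof. by rewrite /affine_point !inordK. Qed.

Lemma curveX_point P : mmap iota P (curveX K n l) =
  P (inord 0) ^+ n * P (inord 1) ^+ l + P (inord 1) ^+ n * P (inord 2) ^+ l
  + P (inord 2) ^+ n * P (inord 0) ^+ l.
Proof. by rewrite curveXE !rmorphD /= !mmap_mpolyX3 !expr0 !mulr1 !mul1r [P (inord 0) ^+ l * _]mulrC. Qed.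

(** At the place over t = 0, [w] has value l and [x] has value n, by Q = l l + n (n-l). After
    division by the curve, the remainder has monomials of one total degree, with exponents i of X
    and j < n of Y; their values n i + l j are distinct because n and l are coprime, so a nonzero
    remainder could not vanish at the point. *)
Lemma kummer_curve_ideal t w x (P := affine_point x w) :
    prime Q -> kummer iota Q t w ((-1) ^+ n) l (n - l) -> x != 0 ->
    t = - (x ^+ (n - l) * w ^+ l) -> x ^+ n * w ^+ l + w ^+ n + x ^+ l = 0 ->
  forall d (g : {mpoly K[3]}), g \is d.-homog ->
    mmap iota P g = 0 <-> exists h, g = h * curveX K n l.
Proof.
move=> prQ ku x0 et ef d g hg; have w0 := w_neq0 prQ ku.
have Pf : mmap iota P (curveX K n l) = 0.
  by rewrite curveX_point /P !affine_pointE !expr1n mulr1 mul1r.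
split=> [gP|[h ->]]; last by rewrite rmorphM /= Pf mulr0.
have l0 : (0 < l)%N by rewrite ltnW.
have Ql : ~~ (Q %| l)%N by rewrite gtnNdvd // (ltn_trans ln) ?norm_gt.
have [v [pv _ vt vw _]] := kummer_origin prQ Ql ku.
have vx : v x = n%:Z.
  have := vt; rewrite et (plN pv) (plM pv) ?expf_neq0 // !(plX pv) vw normE => e.
  have : v x * (n - l)%N%:Z = n%:Z * (n - l)%N%:Z by move: e; clear; lia.
  by move/mulIf; apply; rewrite eqz_nat -lt0n subn_gt0.
have [N0 H] := dhomog_reduces l0 ln hg.
have [h [r [e hr]]] := H _ (leqnn N0).
suff r0 : r = 0 by rewrite r0 addr0 in e; exact: curveX_prime_Z e.
apply/eqP/negPn/negP => r0.
have rP : mmap iota P r = 0.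
  have := congr1 (mmap iota P) e; rewrite rmorphD !rmorphM /= gP Pf !mulr0 add0r.
  by move<-.
pose s := msupp r; have us : uniq s := msupp_uniq r.
pose F' (i : 'I_(size s)) := iota r@_(tnth (in_tuple s) i) * mmap1 P (tnth (in_tuple s) i).
have rsum : mmap iota P r = \sum_i F' i by rewrite /mmap big_tnth.
have mE m : mmap1 P m = x ^+ m (inord 0) * w ^+ m (inord 1).
  by rewrite /mmap1 big_ord3 /P !affine_pointE expr1n /= mulr1.
have c0 i : r@_(tnth (in_tuple s) i) != 0 by rewrite -mcoeff_msupp mem_tnth.
have F0 i : F' i != 0.
  by rewrite /F' mE !mulf_neq0 ?expf_neq0 ?fmorph_eq0.
have vF i (m := tnth (in_tuple s) i) : v (F' i) = (n * m (inord 0) + l * m (inord 1))%N%:Z.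
  rewrite /F' mE !(plM pv) ?mulf_neq0 ?expf_neq0 ?fmorph_eq0 // (plC pv) !(plX pv) vx vw add0r.
  by rewrite PoszD !PoszM.
have [||i [_]] := pl_sum_dom (f := F') pv; last by rewrite -rsum rP eqxx.
  move=> i j _ _; rewrite !vF => [[eij]].
  have [di ni] := hr _ (c0 i); have [dj nj] := hr _ (c0 j).
  apply: val_inj; apply/eqP; rewrite -(nth_uniq 0%MM (ltn_ord i) (ltn_ord j) us).
  move: di ni dj nj eij; rewrite !(tnth_nth 0%MM) /=.
  move: (nth _ _ i) (nth _ _ j) => m m'; rewrite !mdeg_mnm3 => di ni dj nj eij.
  have e1 : m (inord 1) = m' (inord 1).
    have : (l * m (inord 1) = l * m' (inord 1) %[mod n])%N.
      by rewrite -(modnMDl (m (inord 0))) mulnC eij mulnC modnMDl.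
    wlog: m m' di ni dj nj eij / (m (inord 1) <= m' (inord 1))%N => [hw|le] emod.
      by case/orP: (leq_total (m (inord 1)) (m' (inord 1))) => le; [|symmetry]; apply: hw.
    move/esym/eqP: emod; rewrite eqn_mod_dvd ?leq_mul2l ?le ?orbT // -mulnBr Gauss_dvdr //.
    have [h0 _|h0 /dvdn_leq] := posnP (m' (inord 1) - m (inord 1))%N.
      by move: le h0; clear; lia.
    by move=> /(_ h0); move: nj h0; clear; lia.
  have e0 : m (inord 0) = m' (inord 0).
    move: eij; rewrite e1 => /addIn /eqP; rewrite eqn_pmul2l ?(ltn_trans l0 ln) //; exact: eqP.
  by apply/eqP; apply: mnm3_ext => //; move: di dj; rewrite e0 e1; clear; lia.
have s0 : (0 < size s)%N by rewrite lt0n size_eq0 msupp_eq0.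
by exists (Ordinal s0).
Qed.

Lemma kummer_curve_model t w : prime Q -> kummer iota Q t w ((-1) ^+ n) l (n - l) ->
  exists x, [/\ x != 0, t = - (x ^+ (n - l) * w ^+ l) &
    is_function_field_of iota (curveX K n l) (affine_point x w)].
Proof.
move=> prQ ku; have [x [x0 et ef]] := kummer_curve_point prQ ku.
exists x; split=> //; split; first exact: (kummer_curve_ideal prQ ku x0 et ef).
have w0 := w_neq0 prQ ku; pose P := affine_point x w.
have sQ := form_quotients_subfield iota P; have [Sc SD SM SV] := sQ.
have Sco i : form_quotients iota P (P i).
  exists 1%N, 'X_i, 'X_(inord 2); rewrite !dhomogX !mmapX !mmap1U /P !affine_pointE.
  by rewrite /= !mdeg1 !eqxx oner_eq0 divr1.
apply: (ku_gen ku sQ).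
  rewrite et -mulN1r -(rmorphN1 iota); apply: (SM _ _ (Sc _)).
  have := Sco (inord 0); have := Sco (inord 1); rewrite /P !affine_pointE => Sw Sx.
  by apply: SM; apply: (subfieldX _ sQ).
by have := Sco (inord 1); rewrite /P affine_pointE.
Qed.

End Field.

End CurveCoordinates.

(** * From the plane curve to the cyclic cover *)

Section CurveFunctionField.
Variables (n l : nat).
Hypotheses (l2 : (2 <= l)%N) (ln : (l < n)%N) (co : coprime n l).
Local Notation Q := (n ^ 2 - n * l + l ^ 2)%N.

(* [t] is the value at P of - X^n Y^l / (Z^n X^l), so [c] of degree less than N
   becomes the form C^N c(- A / C) with A = X^n Y^l and C = Z^n X^l. *)
Lemma homogenize (K : fieldType) (c : {poly K}) : exists d (g : {mpoly K[3]}), g \is d.-homog /\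
  forall (F : fieldType) (iota : {rmorphism K -> F}) (P : 'I_3 -> F),
    (forall i, P i != 0) ->
    let t := - ((P (inord 0) / P (inord 2)) ^+ (n - l) * (P (inord 1) / P (inord 2)) ^+ l) in
    mmap iota P g = 0 <-> peval iota t c = 0.
Proof.
pose A : {mpoly K[3]} := 'X_[mnm3 n l 0]; pose C : {mpoly K[3]} := 'X_[mnm3 l 0 n].
have hA : A \is (n + l).-homog by rewrite -[(n + l)%N]addn0; exact: dhomogX3.
have hC : C \is (n + l).-homog by rewrite addnC -[l in (l + n)%N]addn0; exact: dhomogX3.
pose N := size c; pose G := \sum_(i < N) c`_i *: ((- A) ^+ i * C ^+ (N - i)).
exists ((n + l) * N)%N, G; split.
  apply: rpred_sum => i _; apply: dhomogZ.
  rewrite -[X in (_ * X)%N](subnKC (ltnW (ltn_ord i))) mulnDr.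
  by apply: dhomogM; apply: dhomogMn; rewrite ?dhomogN.
move=> F iota P P0 t; have CP0 : mmap iota P C != 0.
  by rewrite /C mmap_mpolyX3 !mulf_neq0 ?expf_neq0.
have At : mmap iota P (- A) = t * mmap iota P C.
  rewrite rmorphN /= /A /C !mmap_mpolyX3 /t !expr_div_n !expr0 !mulr1.
  have xn i : P i ^+ n = P i ^+ (n - l) * P i ^+ l by rewrite -exprD subnK // ltnW.
  rewrite !xn; have := expf_neq0 (n - l) (P0 (inord 2)); have := expf_neq0 l (P0 (inord 2)).
  move: (_ ^+ (n - l)) (_ ^+ l) (P (inord 0) ^+ _) (P (inord 0) ^+ _) (P (inord 1) ^+ _).
  by move=> x1 x2 x3 x4 x5 h1 h2; field; rewrite h1 h2.
have -> : mmap iota P G = mmap iota P C ^+ N * peval iota t c.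
  rewrite (evp_sum iota t (leqnn N)) mulr_sumr rmorph_sum; apply: eq_bigr => i _.
  rewrite /= mmapZ rmorphM /= !rmorphXn /= At exprMn.
  have -> : mmap iota P C ^+ N = mmap iota P C ^+ i * mmap iota P C ^+ (N - i).
    by rewrite -exprD subnKC // ltnW.
  by move: (_ ^+ (N - i)) (_ ^+ i) (_ ^+ i) => u1 u2 u3; ring.
split=> [/eqP|->]; last by rewrite mulr0.
by rewrite mulf_eq0 (negPf (expf_neq0 _ CP0)) => /eqP.
Qed.

(** The forms vanishing at [P] are the multiples of the curve, exactly as in the model built from
    [kummer_exists]. Transcendence of [t], through [homogenize], and nonvanishing of the coordinates
    are therefore transferred from that model. *)
Lemma curve_function_field_kummer (K F : fieldType) (iota : {rmorphism K -> F}) (P : 'I_3 -> F) :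
    prime Q -> is_function_field_of iota (curveX K n l) P ->
  exists t w, kummer iota Q t w ((-1) ^+ n) l (n - l).
Proof.
move=> prQ [idealP genP].
have e0 : (-1) ^+ n != 0 :> K by rewrite expf_neq0 // oppr_eq0 oner_eq0.
have [F' [iota' [t' [w' ku]]]] := kummer_exists l (n - l) (prime_gt0 prQ) e0.
have [x' [x0' et' [idealP' _]]] := kummer_curve_model l2 ln co prQ ku.
have same d g : g \is d.-homog -> mmap iota P g = 0 <-> mmap iota' (affine_point x' w') g = 0.
  by move=> hg; rewrite (idealP d g hg) -(idealP' d g hg).
have P0' i : affine_point x' w' i != 0.
  by elim/ord3_cases: i; rewrite affine_pointE // ?oner_eq0 // (w_neq0 prQ ku).
have P0 i : P i != 0.
  apply/eqP => Pi; have /same[+ _] : ('X_i : {mpoly K[3]}) \is 1.-homog by rewrite dhomogX /= mdeg1.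
  by rewrite !mmapX !mmap1U => /(_ Pi)/eqP; apply/negP.
pose x := P (inord 0) / P (inord 2); pose y := P (inord 1) / P (inord 2).
have x0 : x != 0 by rewrite mulf_neq0 ?invr_eq0.
have y0 : y != 0 by rewrite mulf_neq0 ?invr_eq0.
have Pxy : x ^+ n * y ^+ l + y ^+ n + x ^+ l = 0.
  have : mmap iota P (curveX K n l) = 0.
    apply/(idealP (n + l)%N); last by exists 1; rewrite mul1r.
    rewrite curveXE; apply: dhomogD; first apply: dhomogD.
    - by rewrite -[(n + l)%N]addn0; exact: dhomogX3.
    - by rewrite -[(n + l)%N]add0n addnA; exact: dhomogX3.
    - by rewrite addnC -[l in (l + n)%N]addn0; exact: dhomogX3.
  rewrite curveX_point /x /y !expr_div_n => e.
  have h1 := expf_neq0 l (P0 (inord 2)); have h2 := expf_neq0 n (P0 (inord 2)).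
  apply: (mulIf (mulf_neq0 h1 h2)); rewrite mul0r -[RHS]e.
  move: (P (inord 2) ^+ l) (P (inord 2) ^+ n) (P (inord 0) ^+ l) (P (inord 0) ^+ n)
     (P (inord 1) ^+ l) (P (inord 1) ^+ n) h1 h2 => z1 z2 x1 x2 y1 y2 h1 h2.
  by field; rewrite h1 h2.
have [st yQ] := curve_kummer_eq ln iota x0 Pxy.
exists (- (x ^+ (n - l) * y ^+ l)), y; split=> //.
- move=> c ct; have [d [g [hg gE]]] := homogenize c.
  have := gE F' iota' _ P0'; rewrite !affine_pointE !divr1 -et' => gE'.
  by apply: (ku_tr ku); apply/gE'; apply/(same d g hg); apply/gE.
- move=> S sS St Sy z; have [Sc SD SM SV] := sS.
  (* [t] and y give x^(n-l), while 1 - t and y give x^l; these exponents are coprime. *)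
  have Sx : S x.
    apply: (subfield_coprime_root sS x0 (coprime_subnl ln co)); first by rewrite subn_gt0.
      have -> : x ^+ (n - l) = iota (-1) * (- (x ^+ (n - l) * y ^+ l)) / y ^+ l.
        by rewrite rmorphN1 mulN1r opprK mulfK ?expf_neq0.
      by apply: (SM _ _ _ (SV _ _)); [exact: SM|exact: (subfieldX _ sS)].
    have s0 : 1 - - (x ^+ (n - l) * y ^+ l) != 0.
      by rewrite st oppr_eq0 mulf_neq0 ?invr_eq0 ?expf_neq0.
    have -> : x ^+ l = iota (-1) * y ^+ n / (iota 1 + iota (-1) * - (x ^+ (n - l) * y ^+ l)).
      apply: (mulIf s0); rewrite rmorph1 !rmorphN1 !mulN1r mulfVK // st mulrN mulrC.
      by rewrite divfK ?expf_neq0.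
    apply: (SM); first by apply: (SM) => //; exact: (subfieldX _ sS).
    by apply: (SV); apply: (SD) => //; exact: SM.
  have SP j : S (P j / P (inord 2)).
    by elim/ord3_cases: j => //; rewrite divff // -(rmorph1 iota).
  have [d [g [h [hg hh h0 ->]]]] := genP z.
  have z0 := expf_neq0 d (P0 (inord 2)).
  have -> : mmap iota P g / mmap iota P h =
      (mmap iota P g / P (inord 2) ^+ d) / (mmap iota P h / P (inord 2) ^+ d).
    by move: (mmap iota P g) (mmap iota P h) h0 (P (inord 2) ^+ d) z0 => u v v0 u' u0; field;
      rewrite v0 u0.
  by apply: SM; [|apply: SV]; apply: subfield_form_quotient.
Qed.

End CurveFunctionField.

Theorem theorem4p5 (p q n l : nat) (K : finFieldType)
  (hp : prime p) (hq : exists k : nat, (0 < k)%N /\ q = (p ^ k)%N)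
  (hK : #|K| = (q ^ 2)%N)
  (hln : (l <= n)%N) (hl : (2 <= l)%N)
  (hpQ : ~~ (p %| n ^ 2 - n * l + l ^ 2)%N)
  (hgcd : gcdn n l = 1%N)
  (hQ : prime (n ^ 2 - n * l + l ^ 2)%N) :
  nonsingular_model_is_maximal (curveX K n l) q <->
  (q + 1 = 0 %[mod n ^ 2 - n * l + l ^ 2])%N.
Proof.
have ln : (l < n)%N.
  by rewrite ltn_neqAle hln andbT; apply/eqP => e; move: hgcd hl; rewrite e gcdnn => ->.
have co : coprime n l by apply/eqP.
have [k [k0 qE]] := hq.
have pK : p \in [pchar K].
  by apply: (card_finPcharP (n := k * 2)) => //; rewrite hK qE expnM.
have pcq : [pchar K].-nat q by rewrite qE pnatX pnatE // pK.
have coqQ : coprime q (n ^ 2 - n * l + l ^ 2) by rewrite qE coprimeXl // prime_coprime.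
have nQ := norm_gt hl ln.
have Qnl : ~~ (n ^ 2 - n * l + l ^ 2 %| n - l)%N.
  by rewrite gtnNdvd ?subn_gt0 // (leq_ltn_trans (leq_subr _ _)).
have Ql : ~~ (n ^ 2 - n * l + l ^ 2 %| l)%N by rewrite gtnNdvd ?(ltn_trans ln) // ltnW.
have Qn : ~~ (n ^ 2 - n * l + l ^ 2 %| l + (n - l))%N.
  by rewrite subnKC // gtnNdvd // (leq_ltn_trans _ ln).
(* A sign has (q-1)-th power 1: for odd p the number q - 1 is even, and for p = 2 the sign is 1. *)
have e1 : ((-1) ^+ n) ^+ q.-1 = 1 :> K.
  have [p2|oddp] := even_prime hp.
    have -> : (-1 : K) = 1 by apply: oppr_pchar2; rewrite -p2.
    by rewrite !expr1n.
  have oddq : odd q by rewrite qE oddX oddp orbT.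
  rewrite -exprM mulnC exprM -signr_odd.
  have -> : odd q.-1 = false by case: (q) oddq => // q' /=; case: (odd q').
  by rewrite expr0 expr1n.
have max (F : fieldType) (iota : {rmorphism K -> F}) t w :
    kummer iota (n ^ 2 - n * l + l ^ 2) t w ((-1) ^+ n) l (n - l) ->
    is_maximal iota q <-> (q + 1 = 0 %[mod n ^ 2 - n * l + l ^ 2])%N.
  move=> ku; rewrite (kummer_maximal hK pcq coqQ hQ Ql Qnl Qn e1 ku) addn1 mod0n.
  by split=> /eqP.
split=> [[F [iota [P [ffP maxP]]]]|hmod].
  have [t [w ku]] := curve_function_field_kummer hl ln co hQ ffP.
  exact/(max _ _ _ _ ku).
have e0 : (-1) ^+ n != 0 :> K by rewrite expf_neq0 // oppr_eq0 oner_eq0.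
have [F [iota [t [w ku]]]] := kummer_exists l (n - l) (prime_gt0 hQ) e0.
have [x [_ _ ffP]] := kummer_curve_model hl ln co hQ ku.
by exists F, iota, (affine_point x w); split=> //; apply/(max _ _ _ _ ku).
Qed.
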